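(* Suppose that $a\in W^{1,2}(0,\ell)$. Then: (i) $\mathbf{D}_a\mathbf{T}_au=\mathbf{T}_{\frac1a}Du$ for all $u\in W^{2,2}(-\ell,\ell)$. (ii) $\mathbf{L}_a\mathbf{T}_au=\mathbf{T}_aD^2u$ for all $u\in W^{3,2}(-\ell,\ell)$. (Here the equalities are between functions on $(0,\ell)$.)
   Context: Let $\ell>0$, $I=(0,\ell)$, $x_0=0$, and let $a$ be positive with $a,\frac1a\in L^2(0,\ell)$. Write $D=\frac{d}{dx}$, $\mathbf{D}_au:=a^2u'$ and $\mathbf{L}_au:=\frac1{a^2}(a^2u')'$. For $\rho\in\mathbb{C}$, $e_a(\rho,\cdot)$ denotes the unique solution of $-\frac1{a^2}(a^2u')'=\rho^2u$ on $(0,\ell)$ with $u(0)=1$, $(a^2u')(0)=i\rho$. Let $\mathcal{T}=\{(x,t)\in\mathbb{R}^2:|t|\le x\le\ell\}$. For $a\in W^{1,2}(0,\ell)$ (indeed for $a\in W^{1,1}(0,\ell)$) there is a kernel $K_a\in L^2(\mathcal{T})$ with $e_a(\rho,x)=e^{i\rho x}-i\rho\int_{-x}^xK_a(x,t)e^{i\rho t}\,dt$ for all $x\in(0,\ell]$ and $\rho\in\mathbb{C}$; for each $x$, $K_a(x,\cdot)$ is uniquely determined by this. The operator $\mathbf{T}_a:W^{1,2}(-\ell,\ell)\to L^2(0,\ell)$ is $\mathbf{T}_au(x):=u(x)-\int_{-x}^xK_a(x,t)u'(t)\,dt$, and it is bounded. $K_{1/a}$ and $\mathbf{T}_{1/a}$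 denote the corresponding objects with $a$ replaced by $\frac1a$ (which also belongs to $W^{1,2}(0,\ell)$). *)

(* Defs.v *)
From HB Require Import structures.
From mathcomp Require Import all_boot all_order all_algebra.
From mathcomp Require Import all_classical all_reals all_analysis.
From mathcomp Require Import complex.

Set Implicit Arguments.
Unset Strict Implicit.
Unset Printing Implicit Defensive.

Import Order.TTheory GRing.Theory Num.Theory.
Import numFieldNormedType.Exports.

Local Open Scope classical_set_scope.
Local Open Scope ring_scope.
Local Open Scope complex_scope.

Section ComplexValued.
Context {R : realType}.

Definition cexp (z : R[i]) : R[i] :=
  (expR (complex.Re z))%:C * (cos (complex.Im z) +i* sin (complex.Im z)).

Definition ccontinuous (D : set R) (f : R -> R[i]) : Prop :=
  {within D, continuous (fun x => complex.Re (f x))} /\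
  {within D, continuous (fun x => complex.Im (f x))}.

Section Measure.
Context {d : measure_display} {X : measurableType d}.
Variable mu : {measure set X -> \bar R}.

Definition cintegrable (D : set X) (f : X -> R[i]) : Prop :=
  mu.-integrable D (fun x => (complex.Re (f x))%:E) /\
  mu.-integrable D (fun x => (complex.Im (f x))%:E).

Definition cintegral (D : set X) (f : X -> R[i]) : R[i] :=
  Rintegral mu D (fun x => complex.Re (f x)) +i*
  Rintegral mu D (fun x => complex.Im (f x)).

(* Functions are extended by 0 outside D because Lfun lives on the full
   space. *)
Definition cL2 (D : set X) (f : X -> R[i]) : Prop :=
  ((fun x => complex.Re (f x)) \_ D) \in Lfun mu 2%:E /\
  ((fun x => complex.Im (f x)) \_ D) \in Lfun mu 2%:E.

End Measure.
End ComplexValued.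

Section Sobolev.
Context {R : realType}.
Local Notation mu := (@lebesgue_measure R).
Implicit Types (c d : R) (f g : R -> R[i]).

(* C_c^oo(]c, d[); real-valued test functions suffice, by linearity. *)
Definition test_function c d (phi : R -> R) : Prop :=
  (forall n x, derivable (derive1n n phi) x 1) /\
  exists c' d', [/\ c < c', d' < d & forall x, x \notin `[c', d'] -> phi x = 0].

Definition clocally_integrable (D : set R) f : Prop :=
  locally_integrable D (fun x => complex.Re (f x)) /\
  locally_integrable D (fun x => complex.Im (f x)).

Definition weak_derivative c d f g : Prop :=
  [/\ clocally_integrable `]c, d[ f, clocally_integrable `]c, d[ g &
   forall phi, test_function c d phi ->
     cintegral mu `]c, d[ (fun x => f x * (derive1 phi x)%:C) =
     - cintegral mu `]c, d[ (fun x => g x * (phi x)%:C)].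

Definition weakly_differentiable c d f : Prop :=
  exists g, weak_derivative c d f g.

(* A chosen representative of the a.e. class of the weak derivative on
   ]c, d[; meaningless (0) if f is not weakly differentiable there. *)
Definition wderiv c d f : R -> R[i] :=
  xget (fun=> 0) [set g | weak_derivative c d f g].

(* W^{k,2}(c, d) *)
Fixpoint sobolev2 (k : nat) c d f : Prop :=
  if k is k'.+1 then
    [/\ cL2 mu `]c, d[ f, weakly_differentiable c d f &
        sobolev2 k' c d (wderiv c d f)]
  else cL2 mu `]c, d[ f.

End Sobolev.

Section Impedance.
Context {R : realType}.
Local Notation mu := (@lebesgue_measure R).
Implicit Types (l : R) (a : R -> R) (u : R -> R[i]) (K : R -> R -> R[i]).

(* D_a u = a^2 u' on ]0, l[ *)
Definition Da l a u : R -> R[i] :=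
  fun x => ((a x) ^+ 2)%:C * wderiv 0 l u x.

(* L_a u = a^-2 (a^2 u')' on ]0, l[ *)
Definition La l a u : R -> R[i] :=
  fun x => ((a x) ^- 2)%:C * wderiv 0 l (Da l a u) x.

(* u = e_a(rho, .): u and a^2 u' are absolutely continuous on [0, l]; v is the
   continuous representative of a^2 u', which gives (a^2 u')(0) its meaning. *)
Definition impedance_solution l a (rho : R[i]) u : Prop :=
  [/\ ccontinuous `[0, l] u /\ weakly_differentiable 0 l u,
      weakly_differentiable 0 l (Da l a u),
      {ae mu, forall x, x \in `]0, l[ -> - La l a u x = rho ^+ 2 * u x},
      u 0 = 1 &
      exists v, [/\ ccontinuous `[0, l] v,
        {ae mu, forall x, x \in `]0, l[ -> v x = Da l a u x} &
        v 0 = 'i * rho]].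

Definition triangle l : set (R * R) := [set p | `|p.2| <= p.1 <= l].

Definition transmutation_kernel l (e : R[i] -> R -> R[i]) K : Prop :=
  [/\ cL2 (lebesgue_measure \x lebesgue_measure)%E (triangle l)
        (fun p : R * R => K p.1 p.2),
      forall x, x \in `]0, l] -> cintegrable mu `[- x, x] (K x) &
      forall x rho, x \in `]0, l] ->
        e rho x = cexp ('i * rho * x%:C) -
          'i * rho * cintegral mu `[- x, x]
                       (fun t => K x t * cexp ('i * rho * t%:C))].

Definition transmutation l K u : R -> R[i] :=
  fun x => u x - cintegral mu `[- x, x] (fun t => K x t * wderiv (- l) l u t).

End Impedance.

(* Main.v *)
(* Uniqueness for first order linear systems gives a^2 e_a(r, .)' = i r e_{1/a}(r, .),
   that is, (T_a u)' = a^-2 T_{1/a} u' for u(t) = e^{irt}, r real. Tested against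
   phi, and after exchanging the integrals over the triangle, this says that a
   functional u |-> int al u + int be u' + int ga u'' with integrable weights
   vanishes on all exponentials; two integrations by parts and the injectivity
   of the Fourier transform show that it then vanishes on W^{2,2}(-l, l). Since
   a \in W^{1,2} and 1/a \in L^2 keep a away from 0 and infinity, the weights are
   integrable, so (T_a u)' = a^-2 T_{1/a} u' weakly: this is (i). Applying it once
   more with 1/a and Du in place of a and u gives (ii). *)
Require Import Defs.
From HB Require Import structures.
From mathcomp Require Import all_boot all_order all_algebra.
From mathcomp Require Import all_classical all_reals all_analysis.
From mathcomp Require Import complex.
From mathcomp Require Import measurable_realfun.
From mathcomp Require Import ring lra zify.

Set Implicit Arguments.
Unset Strict Implicit.
Unset Printing Implicit Defensive.

Import Order.TTheory GRing.Theory Num.Theory.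
Import numFieldNormedType.Exports.

Local Open Scope classical_set_scope.
Local Open Scope ring_scope.
Local Open Scope complex_scope.

(** The kernels are merely square integrable on the triangle, so [T_a u] cannot be differentiated
    under the integral sign; this is why everything is paired with a test function. Real frequencies
    keep sines and cosines bounded, hence integrable against weights that are only L1. Moving the
    functional onto [u''] costs a factor [r^2], so frequency 0 is lost. The boundary terms are
    removed by taking [r = 0] or letting [r] tend to 0, and injectivity has to be proved from the
    nonzero frequencies alone. That dictates odd powers of a cosine as peak functions, since these
    expand into odd harmonics only. The kernels may be complex valued, while integrals are computed
    on real components. The real and imaginary parts of the kernels enter the frequency identities
    with opposite parity in [r], which separates them: the real parts give the identity, and the
    contributions of the imaginary parts cancel. *)

Section IntegralToolkit.
Context {d : measure_display} {T : measurableType d} {R : realType}.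
Variable mu : {measure set T -> \bar R}.
Local Notation L1 f := (mu.-integrable setT (EFin \o f)).
Implicit Types f g h : T -> R.

Lemma aeS (P Q : T -> Prop) : (forall x, P x -> Q x) ->
  {ae mu, forall x, P x} -> {ae mu, forall x, Q x}.
Proof. by move=> PQ; apply: filterS. Qed.

Lemma aeS2 (P Q S : T -> Prop) : (forall x, P x -> Q x -> S x) ->
  {ae mu, forall x, P x} -> {ae mu, forall x, Q x} -> {ae mu, forall x, S x}.
Proof. by move=> PQ; apply: filterS2. Qed.

Lemma integrable_measurable f : L1 f -> measurable_fun setT f.
Proof. by move=> /integrableP[/measurable_EFinP]. Qed.

Lemma integrable_le f g : measurable_fun setT f ->
  (forall x, `|f x| <= g x) -> L1 g -> L1 f.
Proof.
move=> mf fg ig; apply: (le_integrable _ _ _ ig) => //.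
  exact/measurable_EFinP.
by move=> x _ /=; rewrite lee_fin (le_trans (fg x)) ?ler_norm.
Qed.

Lemma integrableD_fin f g : L1 f -> L1 g -> L1 (fun x => f x + g x).
Proof. by move=> lf lg; exact: (integrableD measurableT lf lg). Qed.

Lemma integrableB_fin f g : L1 f -> L1 g -> L1 (fun x => f x - g x).
Proof. by move=> lf lg; exact: (integrableB measurableT lf lg). Qed.

Lemma integrableZ_fin (c : R) f : L1 f -> L1 (fun x => c * f x).
Proof. by move=> lf; exact: (integrableZl measurableT c lf). Qed.

Lemma integrableN_fin f : L1 f -> L1 (fun x => - f x).
Proof.
move=> lf; rewrite (_ : (fun x => - f x) = (fun x => -1 * f x)).
  exact: integrableZ_fin.
by apply/funext => x; rewrite mulN1r.
Qed.

Lemma integrable_norm_fin f : L1 f -> L1 (fun x => `|f x|).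
Proof. exact: integrable_norm. Qed.

Lemma integrable_bounded_mul (M : R) h f : measurable_fun setT h ->
  (forall x, `|h x| <= M) -> L1 f -> L1 (fun x => h x * f x).
Proof.
move=> mh hM lf.
apply: (@integrable_le _ (fun x => M * `|f x|)).
- by apply: measurable_funM => //; exact: integrable_measurable.
- by move=> x; rewrite normrM ler_wpM2r.
- by apply: integrableZ_fin; exact: integrable_norm_fin.
Qed.

Lemma ae_eq_Rintegral f g : measurable_fun setT f -> measurable_fun setT g ->
  {ae mu, forall x, f x = g x} -> Rintegral mu setT f = Rintegral mu setT g.
Proof.
move=> mf mg fg; congr fine; apply: ae_eq_integral => //.
- exact/measurable_EFinP.
- exact/measurable_EFinP.
- by apply: filterS fg => x /= -> _.
Qed.

Lemma ae_eq_integrable f g : measurable_fun setT g ->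
  {ae mu, forall x, f x = g x} -> L1 f -> L1 g.
Proof.
move=> mg fg /integrableP[mf foo]; apply/integrableP; split.
  exact/measurable_EFinP.
rewrite -(@ae_eq_integral _ _ _ _ _ _ (fun x => `|(EFin \o f) x|)%E)//.
- exact: measurableT_comp.
- by apply: measurableT_comp => //; exact/measurable_EFinP.
- by apply: filterS fg => x /= -> _.
Qed.

Lemma RintegralN f : L1 f ->
  Rintegral mu setT (fun x => - f x) = - Rintegral mu setT f.
Proof.
move=> lf; under eq_Rintegral do rewrite -mulN1r.
by rewrite RintegralZl// mulN1r.
Qed.

Lemma le_Rintegral_bound f g : L1 f -> L1 g -> (forall x, `|f x| <= g x) ->
  `|Rintegral mu setT f| <= Rintegral mu setT g.
Proof.
move=> lf lg fg; apply: (le_trans (le_normr_Rintegral _ lf)) => //.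
by apply: le_Rintegral => //; exact: integrable_norm_fin.
Qed.

Lemma EFin_Rintegral f : L1 f ->
  (\int[mu]_x (f x)%:E)%E = (Rintegral mu setT f)%:E.
Proof. by move=> lf; rewrite fineK//; exact: integrable_fin_num. Qed.

End IntegralToolkit.

(** * Primitives of integrable functions on the line *)

Section Primitive.
Context {R : realType}.
Local Notation mu := (@lebesgue_measure R).
Local Notation L1 f := (mu.-integrable setT (EFin \o f)).
Implicit Types f g : R -> R.

(** Starting at -oo avoids a base point: for an integrable function cut off to an interval this is
    the primitive from the left endpoint, defined, bounded and continuous on the whole line. *)
Definition prim f (x : R) := \int[mu]_(t in `]-oo, x]) f t.

Lemma integrable_patch (D : set R) f : measurable D -> L1 f -> L1 (f \_ D).
Proof.
move=> mD lf; rewrite -restrict_EFin.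
apply/integrable_restrict => //; rewrite setTI.
exact: integrableS lf.
Qed.

Lemma Rintegral_le_norm (D : set R) f : measurable D -> L1 f ->
  `|\int[mu]_(t in D) f t| <= \int[mu]_t `|f t|.
Proof.
move=> mD lf; rewrite Rintegral_mkcond; apply: le_Rintegral_bound.
- exact: integrable_patch.
- exact: integrable_norm_fin.
- by move=> x; rewrite patchE; case: ifP => // _; rewrite normr0.
Qed.

Lemma prim_le_norm f x : L1 f -> `|prim f x| <= \int[mu]_t `|f t|.
Proof. exact: Rintegral_le_norm. Qed.

Lemma primB f x y : L1 f -> x <= y ->
  prim f y - prim f x = \int[mu]_(t in `]x, y]) f t.
Proof.
move=> lf xy; rewrite /prim Rintegral_itvB//.
exact: integrableS lf.
Qed.

Lemma prim_dist f x y : L1 f -> x <= y ->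
  `|prim f y - prim f x| <= \int[mu]_(t in `]x, y]) `|f t|.
Proof.
move=> lf xy; rewrite primB//; apply: le_normr_Rintegral => //.
exact: integrableS lf.
Qed.

Lemma lebesgue_measure_oc (x y d : R) : 0 < d -> y - x < d ->
  (mu `]x, y] < d%:E)%E.
Proof.
move=> d0 xyd; rewrite lebesgue_measure_itv/=.
by case: ifPn => _; rewrite -?EFinD lte_fin.
Qed.

(** Absolute continuity of the integral: the increment over an interval of small measure is small,
    on either side of the point. *)
Lemma prim_continuous f : L1 f -> continuous (prim f).
Proof.
move=> lf x; apply/cvgrPdist_lt => /= e e0.
have [d [d0 hd]] := integral_normr_continuous lf e0.
near=> y.
have : `|x - y| < d by near: y; apply: cvgr_dist_lt.
have [xy|yx] := leP x y.
  rewrite distrC ger0_norm ?subr_ge0// => xyd.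
  rewrite distrC (le_lt_trans (prim_dist lf xy))//; apply: hd => //.
  exact: lebesgue_measure_oc.
rewrite gtr0_norm ?subr_gt0// => xyd.
rewrite (le_lt_trans (prim_dist lf (ltW yx)))//; apply: hd => //.
exact: lebesgue_measure_oc.
Unshelve. all: by end_near. Qed.

Lemma prim_measurable f : L1 f -> measurable_fun setT (prim f).
Proof. by move=> lf; apply: continuous_measurable_fun; exact: prim_continuous. Qed.

Lemma derive_prim f : L1 f ->
  {ae mu, forall x, derivable (prim f) x 1 /\ derive1 (prim f) x = f x}.
Proof.
move=> lf; apply: FTC1Ny => [y|]; first exact: integrableS lf.
by apply: open_integrable_locally => //; exact: openT.
Qed.

Lemma derive_prim_continuous f x : L1 f -> {for x, continuous f} ->
  derivable (prim f) x 1 /\ derive1 (prim f) x = f x.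
Proof.
move=> lf cf; apply: (@continuous_FTC1 _ _ -oo%O x (x + 1)) => //; last exact: ltNyr.
- by rewrite ltrDl.
- exact: integrableS lf.
Qed.

Lemma integrable_prod f g : L1 f -> L1 g ->
  (mu \x mu)%E.-integrable setT
    (EFin \o (fun z : measurableTypeR R * measurableTypeR R => f z.1 * g z.2)).
Proof.
move=> lf lg.
have mf := integrable_measurable lf; have mg := integrable_measurable lg.
apply/integrable12ltyP.
  apply/measurable_EFinP; apply: measurable_funM.
    exact: (measurableT_comp mf measurable_fst).
  exact: (measurableT_comp mg measurable_snd).
rewrite (_ : (fun x => _) = (fun x => `|f x|%:E * \int[mu]_y `|g y|%:E)%E).
  apply: (@le_lt_trans _ _ (\int[mu]_x (`|f x|%:E * (\int[mu]_y `|g y|)%:E))%E).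
    by rewrite -EFin_Rintegral//; exact: integrable_norm_fin.
  have/integrableP[_] : L1 (fun x => `|f x| * \int[mu]_y `|g y|).
    rewrite (_ : (fun x => _) = (fun x => (\int[mu]_y `|g y|) * `|f x|)).
      by apply: integrableZ_fin; exact: integrable_norm_fin.
    by apply/funext => x; rewrite mulrC.
  apply: le_lt_trans; rewrite le_eqVlt; apply/orP; left; apply/eqP.
  apply: eq_integral => x _ /=.
  have h : 0 <= `|f x| * \int[mu]_y `|g y| by rewrite mulr_ge0 ?Rintegral_ge0.
  by rewrite -EFinM (ger0_norm h).
apply/funext => x.
rewrite -ge0_integralZl//; last first.
- apply/measurable_EFinP; exact: measurableT_comp.
- by apply: eq_integral => y _; rewrite /= normrM EFinM.
Qed.

Lemma Rintegral_itvc_infty f s : L1 f ->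
  \int[mu]_(t in `[s, +oo[) f t = \int[mu]_t f t - prim f s.
Proof.
move=> lf; rewrite -Rintegral_itv_obnd_cbnd; last exact: integrableS lf.
rewrite -(@Rintegral_itvB _ f -oo%O +oo%O s)//.
  by rewrite /prim set_itvE.
by rewrite set_itvE.
Qed.

(* Fubini on the half plane s <= t *)
Lemma Rintegral_prim_by_parts f g : L1 f -> L1 g ->
  \int[mu]_t (f t * prim g t) =
  (\int[mu]_t f t) * (\int[mu]_t g t) - \int[mu]_t (g t * prim f t).
Proof.
move=> lf lg.
pose D := [set z : R * R | z.2 <= z.1].
have mD : measurable (D : set (measurableTypeR R * measurableTypeR R)).
  rewrite -[X in measurable X]setTI.
  exact: measurable_fun_le.
have inD x y : ((x, y) \in D) = (y <= x).
  by apply/idP/idP; rewrite in_setE.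
pose F := fun z : measurableTypeR R * measurableTypeR R =>
  \1_D z * (f z.1 * g z.2).
have lF : (mu \x mu)%E.-integrable setT (EFin \o F).
  apply: (@integrable_bounded_mul _ _ _ _ 1).
  - exact: measurable_indic.
  - by move=> x; rewrite indicE; case: (_ \in _); rewrite ?normr1 ?normr0.
  - exact: integrable_prod.
have := Fubini lF.
under eq_integral => x _.
  rewrite (_ : (fun y => _) = (fun y => (f x * (g \_ `]-oo, x]) y)%:E)); last first.
    apply/funext => y /=; rewrite /F indicE patchE /= inD mem_setE in_itv/=;
      case: (y <= x); rewrite ?mul1r ?mul0r ?mulr0//.
  rewrite EFin_Rintegral; last first.
    by apply: integrableZ_fin; exact: integrable_patch.
  rewrite RintegralZl//; last exact: integrable_patch.
  rewrite -Rintegral_mkcond -/(prim g x).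
  over.
under [in X in _ = X -> _]eq_integral => y _.
  rewrite (_ : (fun x => _) = (fun x => (g y * (f \_ `[y, +oo[) x)%:E)); last first.
    apply/funext => x /=; rewrite /F indicE patchE /= inD mem_setE in_itv/= andbT;
      case: (y <= x); rewrite ?mul1r ?mul0r ?mulr0//.
    by rewrite mulrC.
  rewrite EFin_Rintegral; last first.
    by apply: integrableZ_fin; exact: integrable_patch.
  rewrite RintegralZl//; last exact: integrable_patch.
  rewrite -Rintegral_mkcond Rintegral_itvc_infty//.
  over.
move=> /(congr1 fine) h.
transitivity (\int[mu]_t (g t * (\int[mu]_t f t - prim f t))); first exact: h.
under eq_Rintegral do rewrite mulrBr.
rewrite RintegralB//.
- by rewrite RintegralZr// mulrC.
- rewrite (_ : _ \o _ = EFin \o (fun x => (\int[mu]_t f t) * g x)).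
    exact: integrableZ_fin.
  by apply/funext => x /=; rewrite mulrC.
- rewrite (_ : _ \o _ = EFin \o (fun x => prim f x * g x)).
    apply: (@integrable_bounded_mul _ _ _ _ (\int[mu]_t `|f t|)) => //.
      exact: prim_measurable.
    by move=> x; exact: prim_le_norm.
  by apply/funext => x /=; rewrite mulrC.
Qed.

End Primitive.

(** * Test functions and weak derivatives on an interval *)

Section Bump.
Context {R : realType}.
Implicit Types (p q : {poly R}) (f g : R -> R).

(* x |-> p(1/x) e^(-1/x) for x > 0, extended by 0: closed under derivation *)
Definition flat p (x : R) : R :=
  if 0 < x then p.[x^-1] * expR (- x^-1) else 0.

(** Each monomial satisfies [y^n <= n! e^y] by the exponential series; the triangle inequality then
    adds up the terms of [p]. *)
Lemma poly_le_exp p : exists2 C, 0 <= C &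
  forall y, 0 <= y -> `|p.[y]| <= C * expR y.
Proof.
have H n : exists2 C : R, 0 <= C & forall y, 0 <= y -> y ^+ n <= C * expR y.
  exists n`!%:R => // y y0; case: n => [|n].
    by rewrite expr0 mul1r -expR0 ler_expR.
  have := expR_ge1Dxn n y0.
  rewrite -ler_pdivrMl ?ltr0n ?fact_gt0// mulrC; apply: le_trans.
  by rewrite lerDr.
rewrite -(coefK p) poly_def.
elim/big_ind : _ => [|a b [A A0 hA] [B B0 hB]|i _].
- by exists 0 => // y y0; rewrite horner0 normr0 mul0r.
- exists (A + B); first exact: addr_ge0.
  move=> y y0; rewrite hornerD mulrDl (le_trans (ler_normD _ _))//.
  by rewrite lerD ?hA ?hB.
- have [C C0 hC] := H i; exists (`|p`_i| * C); first exact: mulr_ge0.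
  move=> y y0; rewrite hornerZ hornerXn normrM -mulrA ler_wpM2l//.
  by rewrite ger0_norm ?hC// exprn_ge0.
Qed.

(** Differentiability at 0 in quantitative form. Two further powers of [h^-1] have to be absorbed,
    so [poly_le_exp] is applied to ['X^2 * p]. *)
Lemma flat_linear_bound p : exists2 C, 0 <= C &
  forall h, `|h^-1 * flat p h| <= C * `|h|.
Proof.
have [C C0 hC] := poly_le_exp ('X^2 * p); exists C => // h.
rewrite /flat; case: ifPn => h0; last by rewrite mulr0 normr0 mulr_ge0.
have hi0 : 0 < h^-1 by rewrite invr_gt0.
have := hC _ (ltW hi0).
rewrite hornerM hornerXn (normrM _ p.[_]) (ger0_norm (exprn_ge0 2 (ltW hi0))).
rewrite normrM (normrM _ (expR _)) (gtr0_norm h0) (gtr0_norm hi0).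
rewrite (gtr0_norm (expR_gt0 _)) expRN.
move: (expR_gt0 h^-1); set E := expR _; set P := `|_| => E0 H.
rewrite mulrA ler_pdivrMr// -(ler_pM2l hi0).
rewrite (_ : h^-1 * (C * h * E) = C * E); last by field; rewrite gt_eqF.
by rewrite mulrA -expr2.
Qed.

(** For positive [x], differentiating [p(1/x) e^(-1/x)] yields the factor [x^-2] and the polynomial
    [p - p']. At 0 the difference quotient is [O(h)], so the derivative is 0, the value there of
    every such function. *)
Lemma is_derive_flat p (x : R) :
  is_derive x 1 (flat p) (flat ('X^2 * (p - p^`())) x).
Proof.
have [x0|x0|->] := ltgtP x 0.
- apply: (@near_eq_is_derive _ _ _ (cst 0)).
    near=> y; rewrite /flat ifF//; apply/negbTE; rewrite -leNgt ltW//.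
    by near: y; exact: lt_nbhsl.
  by rewrite /flat ltNge ltW//=; exact: is_derive_cst.
- have xn0 : x != 0 by rewrite gt_eqF.
  have d1 : is_derive x (1 : R) (fun y : R => y^-1) (- x ^- 2 *: 1).
    exact: (@is_deriveV _ id).
  have d2 := is_derive1_comp (is_derive_poly p x^-1) d1.
  have d3 : is_derive x (1 : R) (fun y : R => - y^-1) (- (- x ^- 2 *: 1)).
    exact: is_deriveN.
  have d4 := @is_derive1_comp _ expR (fun y => - y^-1) x _ _ (is_derive_expR _) d3.
  have d5 := is_deriveM d2 d4.
  apply: near_eq_is_derive (is_derive_eq d5 _).
    near=> y; rewrite /flat ifT//=.
    by near: y; exact: lt_nbhsr.
  rewrite /flat x0 !hornerE /= /GRing.scale /= exprVn.
  by field.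
- have E : flat ('X^2 * (p - p^`())) 0 = 0 by rewrite /flat ltxx.
  rewrite E.
  have H : h^-1 *: (flat p (h *: 1 + 0) - flat p 0) @[h --> 0^'] --> (0:R).
    rewrite (_ : flat p 0 = 0); last by rewrite /flat ltxx.
    have [C C0 hC] := flat_linear_bound p.
    apply/cvgr0Pnorm_le => e e0.
    near=> h.
    rewrite subr0 addr0 /GRing.scale /= mulr1 (le_trans (hC _))//.
    rewrite (@le_trans _ _ ((C + 1) * `|h|))//.
      by rewrite ler_wpM2r// lerDl.
    rewrite -ler_pdivlMl ?ltr_pwDr//.
    near: h; apply: dnbhs0_le; by rewrite mulr_gt0// invr_gt0 ltr_pwDr.
  split; first by apply/cvg_ex; exists 0.
  exact: cvg_lim H.
Unshelve. all: by end_near. Qed.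

Definition smooth f := forall n x, derivable (derive1n n f) x 1.

(** Smoothness by coinduction: iterated derivatives never leave a class of derivable functions that
    is closed under derivation. *)
Lemma smooth_coind (P : (R -> R) -> Prop) :
  (forall f, P f -> (forall x, derivable f x 1) /\ P (derive1 f)) ->
  forall f, P f -> smooth f.
Proof.
move=> H f Pf n; elim: n f Pf => [|n IH] f /H[df Pf'] x.
  exact: df.
by rewrite /derive1n iterSr; exact: IH.
Qed.

Lemma smooth_derivable f : smooth f -> forall x, derivable f x 1.
Proof. by move=> sf x; exact: (sf 0%N). Qed.

Lemma smooth_derive1 f : smooth f -> smooth (derive1 f).
Proof. by move=> sf n x; have := sf n.+1 x; rewrite /derive1n iterSr. Qed.

Lemma smooth_continuous f : smooth f -> continuous f.
Proof.
move=> sf x; apply: differentiable_continuous.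
by apply/derivable1_diffP; exact: smooth_derivable.
Qed.

Lemma smooth_derive1_continuous f : smooth f -> continuous (derive1 f).
Proof. by move=> /smooth_derive1; exact: smooth_continuous. Qed.

Lemma smoothBZ f g c : smooth f -> smooth g -> smooth (fun x => f x - c * g x).
Proof.
move=> sf sg.
pose P h := exists f g, [/\ smooth f, smooth g & h = (fun x => f x - c * g x)].
apply: (@smooth_coind P); last by exists f, g.
move=> _ [{sf}f [{sg}g [sf sg ->]]].
have D (x : R) : is_derive x (1 : R) (fun x => f x - c * g x)
    (derive1 f x - c * derive1 g x).
  have d1 : is_derive x 1 f (derive1 f x).
    by rewrite derive1E; apply/derivableP/smooth_derivable.
  have d2 : is_derive x 1 g (derive1 g x).
    by rewrite derive1E; apply/derivableP/smooth_derivable.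
  have d3 := @is_deriveZ _ _ _ g c x 1 (derive1 g x) d2.
  exact: is_deriveB d1 d3.
split; first by move=> x; case: (D x).
exists (derive1 f), (derive1 g); split; [exact: smooth_derive1..|].
by apply/funext => x; rewrite derive1E; case: (D x).
Qed.

(** The scaling by [n.+1] makes both factors tend to 1 inside the interval, so the bumps tend
    pointwise to its indicator while staying between 0 and 1. *)
Definition bump n (x y : R) (t : R) : R :=
  flat 1 (n.+1%:R * (t - x)) * flat 1 (n.+1%:R * (y - t)).

(** Sums are included because the Leibniz rule turns one product into two; with arbitrary
    polynomials in the factors the class is closed under derivation, as [smooth_coind] requires. *)
Inductive bump_like (n : nat) (x y : R) : (R -> R) -> Prop :=
| BumpLike p q : bump_like n x y
    (fun t => flat p (n.+1%:R * (t - x)) * flat q (n.+1%:R * (y - t)))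
| BumpLikeD f g : bump_like n x y f -> bump_like n x y g ->
    bump_like n x y (fun t => f t + g t).

Lemma flatZ (c : R) p x : flat (c *: p) x = c * flat p x.
Proof. by rewrite /flat; case: ifP => _; rewrite ?mulr0// hornerZ mulrA. Qed.

Lemma bump_like_derive n x y f : bump_like n x y f ->
  exists2 g, bump_like n x y g & forall t : R, is_derive t (1 : R) f (g t).
Proof.
elim=> [p q|{}f g _ [f' Bf' df] _ [g' Bg' dg]]; last first.
  by exists (fun t => f' t + g' t) => [|t]; [exact: BumpLikeD|exact: is_deriveD].
(* The inner derivatives [n.+1] and [- n.+1] are absorbed into the polynomials, which keeps the
   derivative in the class. *)
pose r p : {poly R} := n.+1%:R *: ('X^2 * (p - p^`())).
pose s p : {poly R} := - n.+1%:R *: ('X^2 * (p - p^`())).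
eexists; first exact: (BumpLikeD (BumpLike n x y (r p) q) (BumpLike n x y p (s q))).
move=> t.
have d1 : is_derive t (1 : R) (fun t : R => n.+1%:R * (t - x)) (n.+1%:R * (1 - 0)).
  by apply: is_deriveZ; apply: is_deriveB.
have d2 : is_derive t (1 : R) (fun t : R => n.+1%:R * (y - t)) (n.+1%:R * (0 - 1)).
  by apply: is_deriveZ; apply: is_deriveB.
have d3 := is_derive1_comp (is_derive_flat p _) d1.
have d4 := is_derive1_comp (is_derive_flat q _) d2.
apply: is_derive_eq (is_deriveM d3 d4) _.
rewrite /r /s !flatZ /= /GRing.scale /=.
by ring.
Qed.

Lemma smooth_bump n x y : smooth (bump n x y).
Proof.
apply: (@smooth_coind (bump_like n x y)); last exact: BumpLike.
move=> f /bump_like_derive[g Bg dg]; split; first by move=> t; case: (dg t).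
rewrite (_ : derive1 f = g)//; apply/funext => t.
by rewrite derive1E; case: (dg t).
Qed.

Lemma flat1_ge0 x : 0 <= flat 1 x.
Proof. by rewrite /flat; case: ifP => // _; rewrite hornerC mul1r expR_ge0. Qed.

Lemma flat1_le1 x : flat 1 x <= 1.
Proof.
rewrite /flat; case: ifP => // x0; rewrite hornerC mul1r -[leRHS]expR0 ler_expR.
by rewrite oppr_le0 invr_ge0 ltW.
Qed.

Lemma bump_ge0 n x y t : 0 <= bump n x y t.
Proof. by rewrite mulr_ge0 ?flat1_ge0. Qed.

Lemma bump_le1 n x y t : bump n x y t <= 1.
Proof. by rewrite mulr_ile1 ?flat1_ge0 ?flat1_le1. Qed.

Lemma bump_out n x y t : t \notin `]x, y[ -> bump n x y t = 0.
Proof.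
rewrite in_itv/= negb_and -!leNgt /bump /flat => /orP[tx|yt].
  by rewrite ifF ?mul0r//; apply/negbTE; rewrite -leNgt pmulr_rle0 ?subr_le0.
rewrite [X in _ * X]ifF ?mulr0//; apply/negbTE.
by rewrite -leNgt pmulr_rle0 ?subr_le0.
Qed.

Lemma cvg_flat1 (z : R) : 0 < z -> flat 1 (n.+1%:R * z) @[n --> \oo] --> (1 : R).
Proof.
move=> z0.
rewrite (_ : (fun n => _) = (fun n : nat => expR (- (n.+1%:R^-1 * z^-1)))); last first.
  apply/funext => n; rewrite /flat mulr_gt0 ?ltr0n// hornerC mul1r.
  by rewrite invfM.
rewrite -[X in _ --> X]expR0; apply: continuous_cvg; first exact: continuous_expR.
rewrite -oppr0; apply: cvgN.
rewrite -[X in _ --> X](mul0r z^-1).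
by apply: cvgM; [exact: cvg_harmonic|exact: cvg_cst].
Qed.

Lemma cvg_bump x y t : bump n x y t @[n --> \oo] --> (\1_(`]x, y[) t : R).
Proof.
have [txy|txy] := boolP (t \in `]x, y[); last first.
  rewrite indicE memNset; last exact/negP.
  rewrite (_ : (fun n => _) = (fun=> 0)); first exact: cvg_cst.
  by apply/funext => n; rewrite bump_out.
rewrite indicE mem_set// /bump -[X in _ --> X](mulr1 1).
move: txy; rewrite in_itv/= => /andP[xt ty].
by apply: cvgM; apply: cvg_flat1; rewrite subr_gt0.
Qed.

Lemma test_function_bump n (c d x y : R) : c < x -> y < d ->
  test_function c d (bump n x y).
Proof.
move=> cx yd; split; first exact: smooth_bump.
exists x, y; split => // t; rewrite in_itv/= => txy; apply: bump_out.
by apply: contra txy; rewrite in_itv/= => /andP[/ltW-> /ltW->].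
Qed.

End Bump.

(** * Test functions and the fundamental lemma of the calculus of variations *)

Section WeakReal.
Context {R : realType}.
Local Notation mu := (@lebesgue_measure R).
Local Notation L1 f := (mu.-integrable setT (EFin \o f)).
Implicit Types (f g phi : R -> R) (c d x y : R).

(** By Lebesgue differentiation the derivative of [prim f] is [f] almost everywhere, and it is 0
    wherever the primitive is locally constant. *)
Lemma prim_cst_ae f x y k : L1 f -> (forall t, t \in `]x, y[ -> prim f t = k) ->
  {ae mu, forall t, t \in `]x, y[ -> f t = 0}.
Proof.
move=> lf fk; apply: aeS (derive_prim lf) => t [_ <-] txy.
rewrite derive1E (@near_eq_derive _ _ _ _ (cst k)) ?derive_cst//.
near=> z; apply: fk; near: z.
by apply: near_in_itvoo.
Unshelve. all: by end_near. Qed.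

Lemma test_smooth c d phi : test_function c d phi -> smooth phi.
Proof. by case. Qed.

Lemma derive1_out c d phi : (forall x, x \notin `[c, d] -> phi x = 0) ->
  forall x, x \notin `[c, d] -> derive1 phi x = 0.
Proof.
move=> phi0 x xcd; rewrite derive1E (@near_eq_derive _ _ _ _ (cst 0)) ?derive_cst//.
have : open (~` `[c, d]%classic) by apply: closed_openC; exact: itv_closed.
rewrite openE => /(_ x); rewrite /interior => H.
have /H : (~` `[c, d]%classic) x by move=> /= h; move: xcd; rewrite h.
by apply: filterS => z /= /negP zcd; exact: phi0.
Qed.

Lemma test_function_derive1 c d phi :
  test_function c d phi -> test_function c d (derive1 phi).
Proof.
move=> [sphi [c' [d' [cc dd phi0]]]]; split; first exact: smooth_derive1.
by exists c', d'; split => //; exact: derive1_out.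
Qed.

Lemma test_function_out c d phi x :
  test_function c d phi -> x \notin `]c, d[ -> phi x = 0.
Proof.
move=> [_ [c' [d' [cc dd phi0]]]] xcd; apply: phi0; apply: contra xcd.
by rewrite !in_itv/= => /andP[cx xd]; rewrite (lt_le_trans cc cx) (le_lt_trans xd dd).
Qed.

Lemma test_measurable c d phi : test_function c d phi -> measurable_fun setT phi.
Proof.
by move=> /test_smooth/smooth_continuous; exact: continuous_measurable_fun.
Qed.

Lemma test_bounded c d phi : test_function c d phi ->
  exists M, forall x, `|phi x| <= M.
Proof.
move=> [sphi [c' [d' [cc dd phi0]]]].
have [cd|cd] := leP c' d'; last first.
  exists 0 => x; rewrite phi0 ?normr0// in_itv/=; apply/negP => /andP[h1 h2].
  by move: (le_trans h1 h2); rewrite leNgt cd.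
have cphi : {within `[c', d'], continuous (fun x => `|phi x|)}.
  apply: continuous_subspaceT => x; apply: cvg_norm.
  exact: smooth_continuous.
have [e _ he] := EVT_max cd cphi.
exists `|phi e| => x; have [xcd|xcd] := boolP (x \in `[c', d']).
  exact: he.
by rewrite phi0// normr0.
Qed.

Lemma patch_id (D : set R) f : (forall x, ~ D x -> f x = 0) -> f \_ D = f.
Proof.
by move=> f0; apply/funext => x; rewrite patchE; case: ifPn => // /negP;
  rewrite in_setE => /f0.
Qed.

Lemma lebesgue_measure_itv_lty c d : (mu `[c, d] < +oo)%E.
Proof.
by rewrite lebesgue_measure_itv/=; case: ifP => // _; rewrite -EFinD ltry.
Qed.

Lemma test_integrable c d phi : test_function c d phi -> L1 phi.
Proof.
move=> tphi; rewrite -(@patch_id `[c, d] phi); last first.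
  move=> x /negP xcd; apply: (test_function_out tphi); apply: contra xcd.
  by rewrite /= !in_itv/= => /andP[/ltW-> /ltW->].
rewrite -restrict_EFin; apply/integrable_restrict => //; rewrite setTI.
apply: measurable_bounded_integrable => //.
- exact: lebesgue_measure_itv_lty.
- by apply: measurable_funTS; exact: test_measurable tphi.
- have [M hM] := test_bounded tphi.
  exists M; split; first exact: num_real.
  by move=> z /ltW Mz x _; exact: le_trans (hM x) _.
Qed.

Lemma integrable_mul_test c d phi f : test_function c d phi -> L1 f ->
  L1 (fun x => f x * phi x).
Proof.
move=> tphi lf; have [M hM] := test_bounded tphi.
rewrite (_ : (fun x => _) = (fun x => phi x * f x)).
  by apply: (integrable_bounded_mul (M := M)) => //; exact: test_measurable tphi.
by apply/funext => x; rewrite mulrC.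
Qed.

Lemma prim_eq0 f x : (forall t, t <= x -> f t = 0) -> prim f x = 0.
Proof.
move=> f0; rewrite /prim Rintegral_mkcond (_ : _ \_ _ = cst 0).
  by rewrite Rintegral_cst// mul0r.
apply/funext => t; rewrite patchE mem_setE in_itv/=.
by case: ifP => // /f0.
Qed.

Lemma prim_eqT f x : (forall t, x < t -> f t = 0) -> prim f x = \int[mu]_t f t.
Proof.
move=> f0; rewrite /prim Rintegral_mkcond patch_id// => t /=.
by rewrite in_itv/= => /negP; rewrite -ltNge => /f0.
Qed.

Lemma prim_derive1_test c d phi : test_function c d phi ->
  prim (derive1 phi) = phi.
Proof.
move=> tphi; have tphi' := test_function_derive1 tphi.
have [sphi [c' [d' [cc dd phi0]]]] := tphi.
have l' := test_integrable tphi'.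
have H : forall x, is_derive x (1 : R) (fun x => prim (derive1 phi) x - phi x) 0.
  move=> x; have [h1 h2] := derive_prim_continuous l'
    (smooth_derive1_continuous sphi (x := x)).
  have d1 : is_derive x (1 : R) (prim (derive1 phi)) (derive1 phi x).
    by rewrite -[X in is_derive _ _ _ X]h2 derive1E; exact/derivableP.
  have d2 : is_derive x (1 : R) phi (derive1 phi x).
    by rewrite derive1E; apply/derivableP; exact: smooth_derivable.
  by apply: is_derive_eq (is_deriveB d1 d2) _; rewrite subrr.
apply/funext => x.
(* [c' - 1] lies to the left of the support, where [phi] and the primitive of its derivative both
   vanish, so the constant difference is 0. *)
have := is_derive_0_is_cst x (c' - 1) H => /=.
rewrite [X in _ = X - _ -> _]prim_eq0; last first.
  move=> t tc; apply: (derive1_out phi0); rewrite in_itv/= negb_and -!ltNge.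
  by rewrite (le_lt_trans tc)// ltrBlDr ltrDl.
rewrite [phi (c' - 1)]phi0; last by rewrite in_itv/= negb_and -!ltNge ltrBlDr ltrDl ltr01.
by rewrite subr0 => /eqP; rewrite subr_eq0 => /eqP.
Qed.

Lemma Rintegral_derive1_test c d phi : test_function c d phi ->
  \int[mu]_t derive1 phi t = 0.
Proof.
move=> tphi; have tphi' := test_function_derive1 tphi.
rewrite -(@prim_eqT _ d).
  rewrite (prim_derive1_test tphi) (test_function_out tphi)//.
  by rewrite in_itv/= ltxx andbF.
move=> t dt; apply: (test_function_out tphi').
by rewrite in_itv/= [t < d]ltNge (ltW dt) andbF.
Qed.

Lemma locally_integrable_patch c d x y f : c < x -> y < d ->
  locally_integrable `]c, d[ f -> L1 (f \_ `]x, y[).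
Proof.
move=> cx yd [mf _ fK].
have sub : `[x, y] `<=` `]c, d[.
  move=> t /=; rewrite !in_itv/= => /andP[xt ty].
  by rewrite (lt_le_trans cx xt) (le_lt_trans ty yd).
rewrite -restrict_EFin; apply/integrable_restrict => //; rewrite setTI.
have h : mu.-integrable `[x, y] (EFin \o f).
  apply/integrableP; split.
    by apply/measurable_EFinP; apply: measurable_funS mf.
  by apply: fK => //; exact: segment_compact.
by apply: integrableS h => //; exact: subset_itv_oo_cc.
Qed.

(* A locally integrable f orthogonal to the bumps increasing to the indicator
   of ]x, y[ has a constant primitive, whose a.e. derivative is f. *)
Lemma test_separates c d f : locally_integrable `]c, d[ f ->
  (forall phi, test_function c d phi ->
    \int[mu]_(x in `]c, d[) (f x * phi x) = 0) ->
  {ae mu, forall x, x \in `]c, d[ -> f x = 0}.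
Proof.
move=> locf H.
have I0 x y : c < x -> y < d -> \int[mu]_(t in `]x, y[) f t = 0.
  move=> cx yd.
  have lg := locally_integrable_patch cx yd locf.
  pose g := f \_ `]x, y[.
  have H0 n : \int[mu]_t (g t * bump n x y t) = 0.
    rewrite -[RHS](H _ (test_function_bump n cx yd)) [RHS]Rintegral_mkcond.
    apply: eq_Rintegral => t _; rewrite /g !patchE !mem_setE.
    have [txy|txy] := boolP (t \in `]x, y[).
      rewrite ifT//; move: txy; rewrite !in_itv/= => /andP[xt ty].
      by rewrite (lt_trans cx xt) (lt_trans ty yd).
    by rewrite bump_out// !mulr0; case: ifP.
  have mg : measurable_fun setT g := integrable_measurable lg.
  have lb n := integrable_mul_test (test_function_bump n cx yd) lg.
  have : (\int[mu]_t (g t * bump n x y t)%:E)%E @[n --> \oo] -->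
      (\int[mu]_t (g t)%:E)%E.
    have := @dominated_convergence _ _ _ mu setT measurableT
      (fun n t => (g t * bump n x y t)%:E) (fun t => (g t)%:E)
      (fun t => `|g t|%:E).
    case.
    - by move=> n; case/integrableP: (lb n).
    - exact/measurable_EFinP.
    - apply/aeW => t _; apply: cvg_EFin; first exact: nearW.
      rewrite [X in _ --> X](_ : _ = g t * \1_`]x, y[ t).
        by apply: cvgM; [exact: cvg_cst|exact: cvg_bump].
      by rewrite /g patchE indicE; case: ifP => _; rewrite ?mulr1 ?mulr0.
    - exact: integrable_norm_fin.
    - apply/aeW => t n _; rewrite /= lee_fin normrM ler_piMr//.
      by rewrite ger0_norm ?bump_ge0 ?bump_le1.
    by [].
  rewrite (_ : (fun n => _) = cst 0)%E; last first.
    by apply/funext => n /=; rewrite EFin_Rintegral ?H0.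
  move=> h0.
  have /(congr1 fine) e0 : (0 = \int[mu]_t (g t)%:E)%E.
    by apply: (cvg_unique _ _ h0); [exact: ereal_hausdorff|exact: cvg_cst].
  by rewrite Rintegral_mkcond; exact: esym e0.
have I1 x y : c < x -> y < d -> {ae mu, forall t, t \in `]x, y[ -> f t = 0}.
  move=> cx yd.
  have lg := locally_integrable_patch cx yd locf.
  suff : {ae mu, forall t, t \in `]x, y[ -> (f \_ `]x, y[) t = 0}.
    by apply: aeS => t h txy; move: (h txy); rewrite patchE mem_setE ifT.
  apply: (prim_cst_ae (k := 0) lg) => t; rewrite in_itv/= => /andP[xt ty].
  rewrite -(I0 x t cx (lt_trans ty yd)) /prim.
  rewrite -Rintegral_itv_bndo_bndc; last exact: integrableS lg.
  rewrite Rintegral_mkcond [RHS]Rintegral_mkcond.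
  apply: eq_Rintegral => s _; rewrite !patchE !mem_setE !in_itv/=.
  case: (ltP s t) => st; last by rewrite andbF.
  by rewrite (lt_trans st ty) !andbT.
(* Integrability is only local, so the conclusion is reached on []X n, Y n[] first; these intervals
   exhaust []c, d[], and countably many null sets remain null. *)
pose X n := c + n.+1%:R^-1; pose Y n := d - n.+1%:R^-1.
have : {ae mu, forall t, forall n, t \in `]X n, Y n[ -> f t = 0}.
  apply/ae_foralln => n; apply: I1; first by rewrite ltrDl.
  by rewrite ltrBlDr ltrDl.
apply: aeS => t h; rewrite in_itv/= => /andP[ct td].
have e0 : 0 < Num.min (t - c) (d - t) by rewrite lt_min !subr_gt0 ct.
have [n _ hn] := near_infty_natSinv_lt (PosNum e0).
have := hn n (leqnn n); rewrite /= lt_min => /andP[h1 h2].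
by apply: (h n); rewrite in_itv/= /X /Y -ltrBrDl h1 ltrBrDr -ltrBrDl h2.
Qed.

End WeakReal.

(** * Functions with an integrable weak derivative are primitives *)

Section WeakPrimitive.
Context {R : realType}.
Local Notation mu := (@lebesgue_measure R).
Local Notation L1 f := (mu.-integrable setT (EFin \o f)).
Implicit Types (f g phi : R -> R) (c d x y : R).

Definition rweak c d f g := forall phi, test_function c d phi ->
  \int[mu]_(x in `]c, d[) (f x * derive1 phi x) =
  - \int[mu]_(x in `]c, d[) (g x * phi x).

Lemma ae_itv_ex (P : R -> Prop) c d : c < d ->
  {ae mu, forall x, x \in `]c, d[ -> P x} -> exists2 x, x \in `]c, d[ & P x.
Proof.
move=> cd [N [mN N0 hN]]; apply: contrapT => H.
have : (mu `]c, d[ <= mu N)%E.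
  apply: le_measure; rewrite ?inE//.
  move=> x /= xcd; apply: hN => /= h; apply: H; exists x => //; exact: h.
rewrite N0 lebesgue_measure_itv/= lte_fin cd -EFinD lee_fin.
by rewrite leNgt subr_gt0 cd.
Qed.

Lemma Rintegral_patch_mul (D : set R) f phi :
  \int[mu]_(x in D) (f x * phi x) = \int[mu]_x ((f \_ D) x * phi x).
Proof.
rewrite Rintegral_mkcond; apply: eq_Rintegral => x _; rewrite !patchE.
by case: ifP => // _; rewrite mul0r.
Qed.

Lemma integrable_patchP c d f :
  mu.-integrable `]c, d[ (EFin \o f) <-> L1 (f \_ `]c, d[).
Proof.
by rewrite -restrict_EFin; split => h; [apply/integrable_restrict|
  move/integrable_restrict : h]; rewrite ?setTI//; apply.
Qed.

Lemma integrable_cst_itv c d (k : R) : mu.-integrable `]c, d[ (EFin \o cst k).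
Proof.
have h : mu.-integrable `[c, d] (EFin \o cst k).
  by apply: measurable_bounded_integrable => //;
    [exact: lebesgue_measure_itv_lty|exact: bounded_cst].
by apply: integrableS h => //; exact: subset_itv_oo_cc.
Qed.

(** Otherwise [test_separates] would apply to the constant 1 and make it vanish almost everywhere on
    []c, d[]. *)
Lemma test_integral_neq0 c d : c < d ->
  exists2 phi, test_function c d phi & \int[mu]_t phi t != 0.
Proof.
move=> cd; apply: contrapT => H.
have [x _ /eqP] : exists2 x, x \in `]c, d[ & (cst 1 : R -> R) x = 0.
  apply: (ae_itv_ex cd); apply: test_separates.
    by apply: open_integrable_locally; [exact: itv_open|exact: integrable_cst_itv].
  move=> phi tphi; apply/eqP; apply: contrapT => /negP n0; apply: H; exists phi => //.
  apply: contra n0 => /eqP <-; apply/eqP.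
  rewrite Rintegral_mkcond; apply: eq_Rintegral => x _.
  rewrite patchE mem_setE; case: ifPn; first by rewrite mul1r.
  by move=> /(test_function_out tphi).
by rewrite oner_eq0.
Qed.

(** The zero mean makes the primitive vanish to the right of the support too, so it is again
    compactly supported in []c, d[]. *)
Lemma test_prim c d phi : test_function c d phi -> \int[mu]_t phi t = 0 ->
  test_function c d (prim phi) /\ derive1 (prim phi) = phi.
Proof.
move=> tphi i0; have lphi := test_integrable tphi.
have [sphi [c' [d' [cc dd phi0]]]] := tphi.
have D x := derive_prim_continuous lphi (smooth_continuous sphi (x := x)).
have E : derive1 (prim phi) = phi by apply/funext => x; have [] := D x.
split; last exact: E.
split.
  case=> [|n] x; first by have [] := D x.
  by rewrite /derive1n iterSr E; exact: (sphi n).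
exists c', d'; split => // x; rewrite in_itv/= negb_and -!ltNge => /orP[xc|dx].
  apply: prim_eq0 => t tx; apply: phi0.
  by rewrite in_itv/= [c' <= t]leNgt (le_lt_trans tx xc).
rewrite prim_eqT// => t xt; apply: phi0.
by rewrite in_itv/= [t <= d']leNgt (lt_trans dx xt) andbF.
Qed.

Lemma test_functionBZ c d phi psi (k : R) : test_function c d phi ->
  test_function c d psi -> test_function c d (fun x => phi x - k * psi x).
Proof.
move=> [s1 [c1 [d1 [cc1 dd1 h1]]]] [s2 [c2 [d2 [cc2 dd2 h2]]]]; split.
  exact: (@smoothBZ _ phi psi k s1 s2).
exists (Num.min c1 c2), (Num.max d1 d2); split.
- by rewrite lt_min cc1.
- by rewrite gt_max dd1.
- move=> x; rewrite in_itv/= ge_min le_max negb_and !negb_or -!ltNge => H.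
  rewrite h1 ?h2 ?mulr0 ?subr0// in_itv/= negb_and -!ltNge.
    by case/orP: H => /andP[h3 h4]; rewrite ?h3 ?h4 ?orbT.
  by case/orP: H => /andP[h3 h4]; rewrite ?h3 ?h4 ?orbT.
Qed.

(* du Bois-Reymond: phi - k psi is the derivative of a test function as soon
   as its integral vanishes. *)
Lemma rweak_cst c d f : c < d -> mu.-integrable `]c, d[ (EFin \o f) ->
  rweak c d f (cst 0) ->
  exists k, {ae mu, forall x, x \in `]c, d[ -> f x = k}.
Proof.
move=> cd lf wf; have [psi tpsi psi0] := test_integral_neq0 cd.
have lf0 := (integrable_patchP c d f).1 lf.
set J := `]c, d[%classic in lf0 *.
(* The only possible constant: [f - k] is then orthogonal to [psi]. *)
pose k := (\int[mu]_x ((f \_ J) x * psi x)) / \int[mu]_t psi t.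
exists k.
suff : {ae mu, forall x, x \in `]c, d[ -> f x - k = 0}.
  by apply: aeS => x h /h /eqP; rewrite subr_eq0 => /eqP.
have lfk : mu.-integrable `]c, d[ (EFin \o (fun x => f x - k)).
  by apply: (integrableB _ lf (integrable_cst_itv c d k)).
apply: test_separates.
  by apply: open_integrable_locally; [exact: itv_open|exact: lfk].
move=> phi tphi.
pose r := (\int[mu]_t phi t) / \int[mu]_t psi t.
have tphi' := test_functionBZ r tphi tpsi.
have lphi := test_integrable tphi; have lpsi := test_integrable tpsi.
have i0 : \int[mu]_t (phi t - r * psi t) = 0.
  rewrite RintegralB//; last exact: integrableZ_fin.
  by rewrite RintegralZl// /r divfK// subrr.
have [tp Ep] := test_prim tphi' i0.
have := wf _ tp; rewrite Ep.
rewrite [X in _ = - X](_ : _ = 0); last first.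
  by rewrite /Rintegral; under eq_integral do rewrite mul0r; rewrite integral0.
rewrite oppr0 Rintegral_patch_mul.
have l1 := integrable_mul_test tphi lf0; have l2 := integrable_mul_test tpsi lf0.
under eq_Rintegral do rewrite mulrBr mulrCA.
rewrite RintegralB//; last exact: integrableZ_fin.
rewrite RintegralZl// => /eqP; rewrite subr_eq0 => /eqP h.
rewrite Rintegral_patch_mul.
rewrite [LHS](_ : _ = \int[mu]_x ((f \_ J) x * phi x - k * phi x)); last first.
  apply: eq_Rintegral => x _; rewrite !patchE mem_setE.
  case: ifPn => [_|xJ]; first by rewrite mulrBl.
  by rewrite (test_function_out tphi xJ) !mulr0 subr0.
rewrite RintegralB//; last exact: integrableZ_fin.
rewrite RintegralZl// h /k /r; ring.
Qed.

(** Fubini shows that the primitive of [g] has weak derivative [g]; its difference with [f] then has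
    weak derivative 0 and is constant by [rweak_cst]. *)
Lemma rweak_prim c d f g : c < d ->
  mu.-integrable `]c, d[ (EFin \o f) -> mu.-integrable `]c, d[ (EFin \o g) ->
  rweak c d f g ->
  exists k, {ae mu, forall x, x \in `]c, d[ -> f x = k + prim (g \_ `]c, d[) x}.
Proof.
move=> cd lf lg wfg.
have lg0 := (integrable_patchP c d g).1 lg.
have lf0 := (integrable_patchP c d f).1 lf.
set G := prim _.
have lG : mu.-integrable `]c, d[ (EFin \o G).
  apply: measurable_bounded_integrable => //.
  - apply: le_lt_trans (lebesgue_measure_itv_lty c d).
    by apply: le_measure; rewrite ?inE//; exact: subset_itv_oo_cc.
  - by apply: measurable_funTS; exact: prim_measurable.
  - exists (\int[mu]_t `|(g \_ `]c, d[) t|); split; first exact: num_real.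
    by move=> z /ltW Mz x _; exact: le_trans (prim_le_norm _ lg0) _.
have lG0 := (integrable_patchP c d G).1 lG.
have [k hk] : exists k, {ae mu, forall x, x \in `]c, d[ -> f x - G x = k}.
  apply: (rweak_cst cd (integrableB _ lf lG)) => //.
  move=> phi tphi; have tphi' := test_function_derive1 tphi.
  rewrite [X in _ = - X](_ : _ = 0); last first.
    by rewrite /Rintegral; under eq_integral do rewrite mul0r; rewrite integral0.
  have lp' := test_integrable tphi'.
  rewrite oppr0.
  have l1 := integrable_mul_test tphi' lf0.
  have l2 := integrable_mul_test tphi' lG0.
  transitivity (\int[mu]_x ((f \_ `]c, d[) x * derive1 phi x -
                            (G \_ `]c, d[) x * derive1 phi x)).
    rewrite Rintegral_mkcond; apply: eq_Rintegral => x _; rewrite !patchE.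
    by case: ifP => _; rewrite ?mulrBl// !mul0r subrr.
  rewrite RintegralB//.
  rewrite -[X in X - _]Rintegral_patch_mul wfg// Rintegral_patch_mul.
  rewrite -{1}(prim_derive1_test tphi) Rintegral_prim_by_parts//.
  rewrite (Rintegral_derive1_test tphi) mulr0 sub0r opprK.
  apply/eqP; rewrite subr_eq0; apply/eqP; apply: eq_Rintegral => x _.
  rewrite mulrC patchE mem_setE; case: ifPn => // /(test_function_out tphi') ->.
  by rewrite !mulr0.
by exists k; apply: aeS hk => x h /h <-; rewrite subrK.
Qed.

End WeakPrimitive.

(** * Integration by parts on an interval *)

Section Parts.
Context {R : realType}.
Local Notation mu := (@lebesgue_measure R).
Local Notation L1 f := (mu.-integrable setT (EFin \o f)).
Implicit Types (f g h w : R -> R) (c d x y : R).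

Lemma prim_C1 c d w w' x : (forall t : R, is_derive t (1 : R) w (w' t)) ->
  continuous w' -> c <= x <= d ->
  prim (w' \_ `]c, d[) x = w x - w c.
Proof.
move=> dw cw' /andP[cx xd].
have lw y z : mu.-integrable `[y, z] (EFin \o w').
  by apply: continuous_compact_integrable; [exact: segment_compact|
    exact: continuous_subspaceT].
have cw : continuous w.
  move=> t; apply: differentiable_continuous; apply/derivable1_diffP.
  by case: (dw t).
have E : prim (w' \_ `]c, d[) x = \int[mu]_(t in `]c, x[) w' t.
  rewrite /prim -Rintegral_itv_bndo_bndc; last first.
    apply: (@integrableS _ _ _ _ setT) => //; apply/integrable_patchP.
    by apply: integrableS (lw c d) => //; exact: subset_itv_oo_cc.
  rewrite Rintegral_mkcond [RHS]Rintegral_mkcond; apply: eq_Rintegral => s _.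
  rewrite !patchE !mem_setE !in_itv/=.
  case: (ltP s x) => sx; last by rewrite andbF.
  by rewrite (lt_le_trans sx xd) !andbT.
rewrite E.
move: cx; rewrite le_eqVlt => /predU1P[->|cx].
  by rewrite set_itvoo0 Rintegral_set0 subrr.
rewrite Rintegral_itv_bndo_bndc; last first.
  by apply: integrableS (lw c x) => //; exact: subset_itv_oo_cc.
rewrite Rintegral_itv_obnd_cbnd; last first.
  by apply: integrableS (lw c x) => //; exact: subset_itv_oc_cc.
rewrite /Rintegral (continuous_FTC2 cx (F := w))//.
- exact: continuous_subspaceT.
- split=> [t _||]; first by case: (dw t).
    by apply: cvg_at_right_filter; exact: cw.
  by apply: cvg_at_left_filter; exact: cw.
- by move=> t _; rewrite derive1E; case: (dw t).
Qed.

Lemma integrable_mul_prim f g : L1 f -> L1 g -> L1 (fun x => f x * prim g x).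
Proof.
move=> lf lg; rewrite (_ : (fun x => _) = (fun x => prim g x * f x)).
  apply: (integrable_bounded_mul (M := \int[mu]_t `|g t|)) => //.
    exact: prim_measurable.
  by move=> x; exact: prim_le_norm.
by apply/funext => x; rewrite mulrC.
Qed.

(** [k + \int g] is the value at [d] of the continuous representative of [W]. No boundary term
    appears at [c], because the primitive of the cut-off [f] vanishes there. *)
Lemma parts_AC c d f g W k : L1 (f \_ `]c, d[) -> L1 (g \_ `]c, d[) ->
  measurable_fun `]c, d[ W ->
  {ae mu, forall x, x \in `]c, d[ -> W x = k + prim (g \_ `]c, d[) x} ->
  L1 (fun x => (f \_ `]c, d[) x * W x) /\
  \int[mu]_x ((f \_ `]c, d[) x * W x) =
  (k + \int[mu]_x (g \_ `]c, d[) x) * \int[mu]_x (f \_ `]c, d[) x -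
  \int[mu]_x ((g \_ `]c, d[) x * prim (f \_ `]c, d[) x).
Proof.
move=> lf lg mW WE.
set f0 := f \_ _ in lf *; set g0 := g \_ _ in lg WE *.
have m1 : measurable_fun setT (fun x => f0 x * W x).
  rewrite (_ : (fun x => _) = (fun x => f0 x * (W \_ `]c, d[) x)).
    apply: measurable_funM; first exact: integrable_measurable lf.
    exact/(measurable_restrictT _ _).1.
  apply/funext => x; rewrite /f0 !patchE.
  by case: ifP => // _; rewrite !mul0r.
have l2 : L1 (fun x => k * f0 x + f0 x * prim g0 x).
  by apply: integrableD_fin; [exact: integrableZ_fin|exact: integrable_mul_prim].
have E : {ae mu, forall x, k * f0 x + f0 x * prim g0 x = f0 x * W x}.
  apply: aeS WE => x h; rewrite /f0 patchE mem_setE; case: ifPn => xJ.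
    by rewrite h//; ring.
  by rewrite !mul0r mulr0 addr0.
split; first by apply: ae_eq_integrable E l2.
rewrite -(ae_eq_Rintegral (integrable_measurable l2) m1 E).
rewrite RintegralD//; last 2 first.
- exact: integrableZ_fin.
- exact: integrable_mul_prim.
by rewrite RintegralZl// Rintegral_prim_by_parts//; ring.
Qed.

Lemma parts_C1 c d f w w' : c < d -> L1 (f \_ `]c, d[) ->
  (forall t : R, is_derive t (1 : R) w (w' t)) -> continuous w' ->
  \int[mu]_x ((f \_ `]c, d[) x * w x) =
  w d * \int[mu]_x (f \_ `]c, d[) x -
  \int[mu]_x ((prim (f \_ `]c, d[) \_ `]c, d[) x * w' x).
Proof.
move=> cd lf dw cw'.
have lw : mu.-integrable `[c, d] (EFin \o w').
  by apply: continuous_compact_integrable; [exact: segment_compact|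
    exact: continuous_subspaceT].
have lw0 : L1 (w' \_ `]c, d[).
  by apply/integrable_patchP; apply: integrableS lw => //; exact: subset_itv_oo_cc.
have cw : continuous w.
  move=> t; apply: differentiable_continuous; apply/derivable1_diffP.
  by case: (dw t).
have WE : {ae mu, forall x, x \in `]c, d[ -> w x = w c + prim (w' \_ `]c, d[) x}.
  apply: aeW => x; rewrite in_itv/= => /andP[cx xd].
  by rewrite (prim_C1 dw cw') ?ltW// addrC subrK.
have [_ ->] := parts_AC lf lw0 (measurable_funTS (continuous_measurable_fun cw)) WE.
congr (_ * _ - _).
  rewrite -(@prim_eqT _ _ d).
    by rewrite (prim_C1 dw cw') ?(ltW cd) ?lexx// addrC subrK.
  move=> t dt; rewrite patchE mem_setE in_itv/=.
  by rewrite [t < d]ltNge (ltW dt) andbF.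
apply: eq_Rintegral => x _; rewrite !patchE; case: ifP => _; rewrite ?mul0r//.
by rewrite mulrC.
Qed.

End Parts.

(** * Trigonometric integrals determine a function *)

Section Trigonometric.
Context {R : realType}.
Local Notation mu := (@lebesgue_measure R).
Local Notation L1 f := (mu.-integrable setT (EFin \o f)).
Implicit Types (f g h w : R -> R) (c d x y l r : R).

Lemma is_derive_cosM r (t : R) :
  is_derive t (1 : R) (fun t => cos (r * t)) (- (r * sin (r * t))).
Proof.
have d1 : is_derive t (1 : R) (fun t => r * t) (r * 1) by apply: is_deriveZ.
have d2 := is_derive1_comp (is_derive_cos (r * t)) d1.
by apply: is_derive_eq d2 _; rewrite mulr1 mulNr mulrC.
Qed.

Lemma is_derive_sinM r (t : R) :
  is_derive t (1 : R) (fun t => sin (r * t)) (r * cos (r * t)).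
Proof.
have d1 : is_derive t (1 : R) (fun t => r * t) (r * 1) by apply: is_deriveZ.
have d2 := is_derive1_comp (is_derive_sin (r * t)) d1.
by apply: is_derive_eq d2 _; rewrite mulr1 mulrC.
Qed.

Lemma continuous_cosM r : continuous (fun t : R => cos (r * t)).
Proof.
move=> t; apply: differentiable_continuous; apply/derivable1_diffP.
by case: (is_derive_cosM r t).
Qed.

Lemma continuous_sinM r : continuous (fun t : R => sin (r * t)).
Proof.
move=> t; apply: differentiable_continuous; apply/derivable1_diffP.
by case: (is_derive_sinM r t).
Qed.

Lemma continuous_dcosM r : continuous (fun t : R => - (r * sin (r * t))).
Proof.
move=> t; apply: cvgN; apply: cvgM; first exact: cvg_cst.
exact: continuous_sinM.
Qed.

Lemma continuous_dsinM r : continuous (fun t : R => r * cos (r * t)).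
Proof.
by move=> t; apply: cvgM; [exact: cvg_cst|exact: continuous_cosM].
Qed.

Lemma integrable_mul_continuous f h : continuous h -> (forall x, `|h x| <= 1) ->
  L1 f -> L1 (fun x => f x * h x).
Proof.
move=> ch h1 lf; rewrite (_ : (fun x => _) = (fun x => h x * f x)).
  apply: (integrable_bounded_mul (M := 1)) => //.
  exact: continuous_measurable_fun.
by apply/funext => x; rewrite mulrC.
Qed.

Lemma integrable_cosM f r : L1 f -> L1 (fun x => f x * cos (r * x)).
Proof.
apply: integrable_mul_continuous; first exact: continuous_cosM.
by move=> x; exact: cos_max.
Qed.

Lemma integrable_sinM f r : L1 f -> L1 (fun x => f x * sin (r * x)).
Proof.
apply: integrable_mul_continuous; first exact: continuous_sinM.
by move=> x; exact: sin_max.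
Qed.

(** As [r] tends to 0 the left side tends to [|k|] and the right side to 0. This recovers
    information at frequency 0 from the nonzero ones. *)
Lemma cosM_bound_eq0 (k C l : R) :
  (forall r, r != 0 -> `|k * cos (r * l)| <= C * `|r|) -> k = 0.
Proof.
move=> H.
have c1 : k * cos (r * l) @[r --> 0^'] --> k * 1.
  apply: cvgM; first exact: cvg_cst.
  rewrite [X in _ --> X](_ : 1 = cos (0 * l)); last by rewrite mul0r cos0.
  apply: continuous_cvg; first exact: continuous_cos.
  by apply: cvgM; [exact: nbhs_dnbhs|exact: cvg_cst].
have c2 : k * cos (r * l) @[r --> 0^'] --> (0 : R).
  apply/cvgr0Pnorm_le => e e0.
  near=> r.
  have r0 : r != 0 by near: r; exact: nbhs_dnbhs_neq.
  apply: (le_trans (H _ r0)).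
  apply: (@le_trans _ _ ((`|C| + 1) * `|r|)).
    by rewrite ler_wpM2r// (le_trans (ler_norm _))// lerDl.
  rewrite -ler_pdivlMl ?ltr_pwDr//.
  by near: r; apply: dnbhs0_le; rewrite mulr_gt0// invr_gt0 ltr_pwDr.
by rewrite -[LHS]mulr1; apply: (cvg_unique _ c1 c2).
Unshelve. all: by end_near. Qed.

Lemma Rintegral_mul_bound f h : (forall x, `|h x| <= 1) ->
  measurable_fun setT h ->
  L1 f -> `|\int[mu]_x (f x * h x)| <= \int[mu]_x `|f x|.
Proof.
move=> h1 mh lf; apply: le_Rintegral_bound.
- rewrite (_ : (fun x => _) = (fun x => h x * f x)).
    exact: (integrable_bounded_mul (M := 1)).
  by apply/funext => x; rewrite mulrC.
- exact: integrable_norm_fin.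
- by move=> x; rewrite normrM ler_piMr.
Qed.

(** * Powers of a cosine as peak functions *)

Section Kernel.
Variables (l s : R) (N : R -> R).
Hypothesis l0 : 0 < l.
Hypothesis lN : L1 N.
Hypothesis cosN0 : forall r, r != 0 -> \int[mu]_t (N t * cos (r * t)) = 0.
Hypothesis sinN0 : forall r, r != 0 -> \int[mu]_t (N t * sin (r * t)) = 0.

(** For [s] and [t] in []- l, l[] one has [|t - s| < 2 l], so [th (t - s)] stays strictly between
    [- pi / 2] and [pi / 2]. There the cosine is positive and decreases with [|t - s|], so its
    powers peak at [s]. *)
Let th : R := pi / (4 * l).
Let th0 : 0 < th. Proof. by rewrite divr_gt0 ?pi_gt0 ?mulr_gt0. Qed.
Let ker n r t := cos (th * (t - s)) ^+ n * cos (r * (t - s)).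

Let ker_continuous n r : continuous (ker n r).
Proof.
have H q : continuous (fun t : R => cos (q * (t - s))).
  move=> t; apply: (continuous_comp (f := fun t => q * (t - s)) (g := cos)).
    apply: cvgM; first exact: cvg_cst.
    by apply: cvgB; [exact: cvg_id|exact: cvg_cst].
  exact: continuous_cos.
move=> t; apply: cvgM; last exact: H.
apply: (continuous_comp (f := fun t => cos (th * (t - s)))
  (g := fun x : R => x ^+ n)); first exact: H.
exact: exprn_continuous.
Qed.

Let ker_le1 n r t : `|ker n r t| <= 1.
Proof.
by rewrite normrM normrX mulr_ile1 ?exprn_ge0 ?exprn_ile1// cos_max.
Qed.

Let ker_integrable n r : L1 (fun t => N t * ker n r t).
Proof. exact: (integrable_mul_continuous (@ker_continuous n r) (ker_le1 n r) lN). Qed.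

(* Products of an even power of cos by an odd harmonic only involve odd
   harmonics, so the zero frequency is never used. *)
Lemma kernel_orthogonal n (j : int) :
  \int[mu]_t (N t * ker n.*2 ((2 * j + 1)%:~R * th) t) = 0.
Proof.
elim: n j => [|n IH] j.
  set r := _ * th.
  have r0 : r != 0.
    by rewrite mulf_neq0 ?(gt_eqF th0)// intr_eq0; apply/eqP; lia.
  rewrite (_ : Rintegral _ _ _ = \int[mu]_t
    (cos (r * s) * (N t * cos (r * t)) + sin (r * s) * (N t * sin (r * t)))).
    rewrite RintegralD//; last 2 first.
    - by apply: integrableZ_fin; exact: integrable_cosM.
    - by apply: integrableZ_fin; exact: integrable_sinM.
    rewrite !RintegralZl//; [|exact: integrable_sinM|exact: integrable_cosM].
    by rewrite cosN0// sinN0// !mulr0 addr0.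
  apply: eq_Rintegral => t _; rewrite /ker expr0 mul1r mulrBr cosB; ring.
(* The double angle and product formulas turn the extra squared cosine into the frequencies [k - 2],
   [k] and [k + 2] in units of [th], that is into the indices [j - 1], [j] and [j + 1]; oddness is
   preserved. *)
have E t : N t * ker n.+1.*2 ((2 * j + 1)%:~R * th) t =
    2^-1 * (N t * ker n.*2 ((2 * j + 1)%:~R * th) t) +
    4^-1 * (N t * ker n.*2 ((2 * (j + 1) + 1)%:~R * th) t +
            N t * ker n.*2 ((2 * (j - 1) + 1)%:~R * th) t).
  rewrite /ker doubleS !exprS; set P := _ ^+ _.
  set x := t - s; set k : R := (2 * j + 1)%:~R.
  have -> : (2 * (j + 1) + 1)%:~R * th * x = k * th * x + (th * x + th * x) :> R.
    by rewrite /k !rmorphD !rmorphM /= rmorphD /=; ring.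
  have -> : (2 * (j - 1) + 1)%:~R * th * x = k * th * x - (th * x + th * x) :> R.
    by rewrite /k !rmorphD !rmorphM /= rmorphB /=; ring.
  rewrite cosB cosD cosD.
  have := cos2Dsin2 (th * x); set C := cos (th * x); set S := sin (th * x).
  move=> h; have -> : S * S = 1 - C ^+ 2 by rewrite -h; ring.
  by field.
under eq_Rintegral do rewrite E.
rewrite RintegralD//; last 2 first.
- by apply: integrableZ_fin; exact: ker_integrable.
- by apply: integrableZ_fin; apply: integrableD_fin; exact: ker_integrable.
rewrite RintegralZl; [|by []|exact: ker_integrable].
rewrite RintegralZl; [|by []|by apply: integrableD_fin; exact: ker_integrable].
rewrite RintegralD; [|by []|exact: ker_integrable..].
by rewrite !IH; ring.
Qed.

(** For [j = 0] the harmonic is [cos (th (t - s))] itself, which raises the even power to an odd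
    one. *)
Lemma kernel_odd n : \int[mu]_t (N t * cos (th * (t - s)) ^+ n.*2.+1) = 0.
Proof.
rewrite -[RHS](kernel_orthogonal n 0); apply: eq_Rintegral => t _.
by rewrite /ker exprSr mulr0 add0r mul1r.
Qed.

(** Let [m = 2n + 1]. Within [de / 2] of [s] the peak is at least [p^m]; from distance [de] on it is
    at most [q^m]; in between the integrand is nonnegative. A vanishing integral thus forces
    [e de p^m <= q^m \int |N|] for every [n], impossible because [q < p]. *)
Lemma kernel_pos_false (e de : R) : 0 < e -> 0 < de -> - l <= s - de ->
  s + de <= l -> (forall t, t \notin `]- l, l[ -> N t = 0) ->
  (forall t, s - de < t < s + de -> e <= N t) -> False.
Proof.
move=> e0 de0 lsd lsd' Nout Ne.
have pi0 := pi_gt0 R.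
have thl : th * (4 * l) = pi by rewrite /th divfK// gt_eqF// mulr_gt0.
have del : de <= l.
  rewrite -(ler_pM2l (ltr0n R 2)) mulr2n mulrDl mul1r.
  by have := lerD lsd lsd'; lra.
pose p : R := cos (th * (de / 2)); pose q : R := cos (th * de).
have q0 : 0 < q.
  apply: cos_gt0_pihalf; have h1 : th * de <= th * l by rewrite ler_pM2l.
  by have := mulr_gt0 th0 de0; lra.
have qp : q < p.
  have h1 : th * de <= th * l by rewrite ler_pM2l.
  have h2 := mulr_gt0 th0 de0.
  by rewrite /q /p ltr_cos ?in_itv/=; lra.
have cosm x y : 0 <= x -> x <= y -> y <= 2 * l -> cos (th * y) <= cos (th * x).
  move=> x0 xy yl.
  have h1 : th * x <= th * y by rewrite ler_pM2l.
  have h2 : th * y <= th * (2 * l) by rewrite ler_pM2l.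
  have h3 : 0 <= th * x by rewrite mulr_ge0// ltW.
  have := h1; rewrite le_eqVlt => /predU1P[->//|h4]; apply/ltW.
  by rewrite ltr_cos ?in_itv/=; lra.
have cosE t : cos (th * (t - s)) = cos (th * `|t - s|).
  by rewrite -cos_norm normrM gtr0_norm.
pose D := `[s - de / 2, s + de / 2]%classic.
have pw n t : e * p ^+ n.*2.+1 * \1_D t - q ^+ n.*2.+1 * `|N t| <=
    N t * cos (th * (t - s)) ^+ n.*2.+1.
  have [tJ|tJ] := boolP (t \in `]- l, l[); last first.
    rewrite Nout// mul0r normr0 mulr0 subr0 indicE memNset ?mulr0//.
    by move: tJ; rewrite /D/= !in_itv/= => /negP; lra.
  have ts2 : `|t - s| <= 2 * l.
    by move: tJ; rewrite in_itv/= ler_norml; lra.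
  have c0 : 0 <= cos (th * (t - s)).
    rewrite cosE; apply: cos_ge0_pihalf.
    have h2 : th * `|t - s| <= th * (2 * l) by rewrite ler_pM2l.
    have h3 : 0 <= th * `|t - s| by rewrite mulr_ge0// ltW.
    by lra.
  have [tde|tde] := ltP `|t - s| de.
    have Nt : e <= N t by apply: Ne; move: tde; rewrite ltr_norml; lra.
    apply: (@le_trans _ _ (e * p ^+ n.*2.+1 * \1_D t)).
      by rewrite lerBlDr lerDl mulr_ge0// exprn_ge0// ltW.
    rewrite indicE; have [tD|tD] := boolP (t \in D); last first.
      by rewrite mulr0 mulr_ge0 ?exprn_ge0// (le_trans (ltW e0)).
    have p0 : 0 <= p by exact: ltW (lt_trans q0 qp).
    rewrite mulr1 ler_pM ?exprn_ge0 ?(ltW e0)//.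
    rewrite lerXn2r ?nnegrE//.
    rewrite cosE; apply: cosm => //.
      move: tD; rewrite in_setE /D/= in_itv/= ler_norml; lra.
    lra.
  rewrite indicE memNset ?mulr0 ?sub0r; last first.
    rewrite /D/= in_itv/=; move: tde; rewrite ler_normr; lra.
  apply: (@le_trans _ _ (- (`|N t| * cos (th * (t - s)) ^+ n.*2.+1))).
    rewrite lerN2 mulrC ler_wpM2r// lerXn2r ?nnegrE//; first exact: ltW.
    by rewrite cosE; apply: cosm => //; exact: ltW.
  rewrite -mulNr ler_wpM2r ?exprn_ge0//.
  by rewrite lerNl -normrN ler_norm.
pose C := \int[mu]_t `|N t|.
have lD : L1 \1_D by apply: integrable_indic_itv.
have muD : \int[mu]_t (\1_D t : R) = de.
  rewrite /Rintegral integral_indic//; last exact: measurable_itv.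
  transitivity (fine (mu D)).
    by congr (fine (mu _)); apply/seteqP; split => [x []|x].
  rewrite lebesgue_measure_itv/= lte_fin.
  by rewrite ifT/=; [lra|lra].
have bound n : e * de * p ^+ n.*2.+1 <= q ^+ n.*2.+1 * C.
  have : \int[mu]_t (e * p ^+ n.*2.+1 * \1_D t - q ^+ n.*2.+1 * `|N t|) <=
      \int[mu]_t (N t * cos (th * (t - s)) ^+ n.*2.+1).
    apply: le_Rintegral => //.
    - by apply: integrableB_fin; apply: integrableZ_fin => //; exact: integrable_norm_fin.
    - rewrite (_ : (fun t => _) = (fun t => N t * ker n.*2 th t)).
        exact: ker_integrable.
      by apply/funext => t; rewrite /ker -exprSr.
  rewrite kernel_odd RintegralB//; last 2 first.
  - exact: integrableZ_fin.
  - by apply: integrableZ_fin; exact: integrable_norm_fin.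
  rewrite !RintegralZl// ?muD; last exact: integrable_norm_fin.
  by rewrite subr_le0 => h; rewrite mulrAC.
pose r := q / p.
have p0 : 0 < p by exact: lt_trans q0 qp.
have r0 : 0 < r by rewrite divr_gt0.
have r1 : r < 1 by rewrite ltr_pdivrMr// mul1r.
have C0 : 0 <= C by apply: Rintegral_ge0.
have bound2 n : e * de <= C * r ^+ n.
  apply: (@le_trans _ _ (C * r ^+ n.*2.+1)).
    rewrite /r expr_div_n mulrA ler_pdivlMr ?exprn_gt0//.
    by rewrite [leRHS]mulrC.
  rewrite ler_wpM2l// ler_wiXn2l ?(ltW r0) ?(ltW r1)//.
  by rewrite -addnn -addSn leq_addl.
have c : C * r ^+ n @[n --> \oo] --> C * 0.
  apply: cvgM; first exact: cvg_cst.
  by apply: cvg_expr; rewrite gtr0_norm.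
have : e * de <= 0.
  rewrite -(mulr0 C) -(cvg_lim _ c)//.
  by apply: limr_ge; [apply/cvg_ex; eexists; exact: c|apply: nearW].
by rewrite leNgt mulr_gt0.
Qed.

End Kernel.

(** Near a point where [f] is positive, continuity keeps it above half its value there, which
    [kernel_pos_false] excludes; the other sign follows by passing to [- f]. *)
Lemma trig_separates_continuous l f : 0 < l -> continuous f ->
  L1 (f \_ `]- l, l[) ->
  (forall r, r != 0 -> \int[mu]_t ((f \_ `]- l, l[) t * cos (r * t)) = 0) ->
  (forall r, r != 0 -> \int[mu]_t ((f \_ `]- l, l[) t * sin (r * t)) = 0) ->
  forall s, s \in `]- l, l[ -> f s = 0.
Proof.
move=> l0; wlog suff H : f / continuous f -> L1 (f \_ `]- l, l[) ->
  (forall r, r != 0 -> \int[mu]_t ((f \_ `]- l, l[) t * cos (r * t)) = 0) ->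
  (forall r, r != 0 -> \int[mu]_t ((f \_ `]- l, l[) t * sin (r * t)) = 0) ->
  forall s, s \in `]- l, l[ -> f s <= 0.
  move=> cf lf hc hs s sl; apply/le_anti/andP; split; first exact: H hc hs s sl.
  have E : (fun x => - f x) \_ `]- l, l[ = (fun x => - (f \_ `]- l, l[) x).
    by apply/funext => x; rewrite !patchE; case: ifP => // _; rewrite oppr0.
  rewrite -oppr_le0; apply: (H (fun x => - f x)) => //.
  - by move=> x; apply: cvgN; exact: cf.
  - by rewrite E; exact: integrableN_fin.
  - move=> r r0; under eq_Rintegral do rewrite E mulNr.
    by rewrite RintegralN ?hc ?oppr0//; exact: integrable_cosM.
  - move=> r r0; under eq_Rintegral do rewrite E mulNr.
    by rewrite RintegralN ?hs ?oppr0//; exact: integrable_sinM.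
move=> cf lf hc hs s sl; rewrite leNgt; apply/negP => fs0.
have : \forall t \near s, f s / 2 < f t /\ t \in `]- l, l[.
  apply: filterI; first by apply: (cvgr_gt (f s) (cf s)); lra.
  exact: near_in_itvoo.
move=> [de /= de0 hde].
have hb t : `|t - s| < de -> f s / 2 < f t /\ t \in `]- l, l[.
  by rewrite distrC; exact: hde.
(* Half the radius of the neighbourhood is used, so that the endpoints [s - de / 2] and [s + de / 2]
   still belong to it and hence to []- l, l[]. *)
apply: (@kernel_pos_false l s _ l0 lf hc hs (f s / 2) (de / 2)).
- by rewrite divr_gt0.
- by rewrite divr_gt0.
- have [_] : f s / 2 < f (s - de / 2) /\ s - de / 2 \in `]- l, l[.
    by apply: hb; rewrite ltr_norml; lra.
  by rewrite in_itv/=; lra.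
- have [_] : f s / 2 < f (s + de / 2) /\ s + de / 2 \in `]- l, l[.
    by apply: hb; rewrite ltr_norml; lra.
  by rewrite in_itv/=; lra.
- by move=> t tl; rewrite patchE mem_setE (negbTE tl).
- move=> t ht.
  have [h1 h2] : f s / 2 < f t /\ t \in `]- l, l[.
    by apply: hb; rewrite ltr_norml; lra.
  by rewrite patchE mem_setE h2; exact: ltW.
Qed.

(* Integrating by parts once, the primitive of m inherits the hypothesis and is
   continuous; the boundary term vanishes as the frequency tends to 0. *)
Lemma trig_separates l m : 0 < l -> L1 (m \_ `]- l, l[) ->
  (forall r, r != 0 -> \int[mu]_t ((m \_ `]- l, l[) t * cos (r * t)) = 0) ->
  (forall r, r != 0 -> \int[mu]_t ((m \_ `]- l, l[) t * sin (r * t)) = 0) ->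
  {ae mu, forall t, t \in `]- l, l[ -> m t = 0}.
Proof.
move=> l0 lm hc hs; set m0 := m \_ _ in lm hc hs.
have ll : - l < l by rewrite gtrN.
pose M := prim m0; have cM : continuous M by exact: prim_continuous.
have lM : L1 (M \_ `]- l, l[).
  have lMc : mu.-integrable `[- l, l] (EFin \o M).
    by apply: continuous_compact_integrable; [exact: segment_compact|
      exact: continuous_subspaceT].
  by apply/integrable_patchP; apply: integrableS lMc => //; exact: subset_itv_oo_cc.
have pc r := @parts_C1 _ (- l) l m (fun t => cos (r * t))
  (fun t => - (r * sin (r * t))) ll lm (is_derive_cosM r)
  (@continuous_dcosM r).
have ps r := @parts_C1 _ (- l) l m (fun t => sin (r * t))
  (fun t => r * cos (r * t)) ll lm (is_derive_sinM r)
  (@continuous_dsinM r).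
rewrite -/m0 -/M in pc ps.
have {}pc r : r != 0 -> cos (r * l) * \int[mu]_t m0 t =
    - r * \int[mu]_t ((M \_ `]- l, l[) t * sin (r * t)).
  move=> r0; have := pc r; rewrite hc//.
  rewrite [X in _ = _ - X -> _](_ : \int[mu]_t _ =
    - r * \int[mu]_t ((M \_ `]- l, l[) t * sin (r * t))).
    by move=> /esym/eqP; rewrite subr_eq0 => /eqP.
  rewrite -RintegralZl//; last exact: integrable_sinM.
  by apply: eq_Rintegral => t _; ring.
have {}ps r : r != 0 -> sin (r * l) * \int[mu]_t m0 t =
    r * \int[mu]_t ((M \_ `]- l, l[) t * cos (r * t)).
  move=> r0; have := ps r; rewrite hs//.
  rewrite [X in _ = _ - X -> _](_ : \int[mu]_t _ =
    r * \int[mu]_t ((M \_ `]- l, l[) t * cos (r * t))).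
    by move=> /esym/eqP; rewrite subr_eq0 => /eqP.
  rewrite -RintegralZl//; last exact: integrable_cosM.
  by apply: eq_Rintegral => t _; ring.
have m00 : \int[mu]_t m0 t = 0.
  apply: (@cosM_bound_eq0 _ (\int[mu]_t `|(M \_ `]- l, l[) t|) l) => r r0.
  rewrite mulrC pc// normrM normrN mulrC ler_wpM2r//.
  apply: Rintegral_mul_bound => //.
  - by move=> x; exact: sin_max.
  - by apply: continuous_measurable_fun; exact: continuous_sinM.
have M0 : forall t, t \in `]- l, l[ -> M t = 0.
  apply: trig_separates_continuous => //.
  - move=> r r0; have := ps r r0; rewrite m00 mulr0 => /esym/eqP.
    by rewrite mulf_eq0 (negbTE r0)/= => /eqP.
  - move=> r r0; have := pc r r0; rewrite m00 mulr0 => /esym/eqP.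
    by rewrite mulf_eq0 oppr_eq0 (negbTE r0)/= => /eqP.
have := prim_cst_ae lm M0; apply: aeS => t h tl.
by have := h tl; rewrite /m0 patchE mem_setE tl.
Qed.

End Trigonometric.

Lemma patchB {T : Type} {R : realType} (D : set T) (f g : T -> R) :
  (fun t => f t - g t) \_ D = (fun t => (f \_ D) t - (g \_ D) t).
Proof.
by apply/funext => t; rewrite !patchE; case: ifP => // _; rewrite subr0.
Qed.

(** * Functionals of a function and its first two derivatives that annihilate the exponentials *)

Section Annihilator.
Context {R : realType}.
Local Notation mu := (@lebesgue_measure R).
Local Notation L1 f := (mu.-integrable setT (EFin \o f)).
Variables (l : R) (al be ga : R -> R).
Hypothesis l0 : 0 < l.
Local Notation "f ^J" := (f \_ `]- l, l[) (at level 2, format "f ^J").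
Hypothesis lal : L1 al^J.
Hypothesis lbe : L1 be^J.
Hypothesis lga : L1 ga^J.
Hypothesis annc : forall r, \int[mu]_t (al^J t * cos (r * t)) +
  \int[mu]_t (be^J t * - (r * sin (r * t))) +
  \int[mu]_t (ga^J t * - (r * (r * cos (r * t)))) = 0.
Hypothesis anns : forall r, \int[mu]_t (al^J t * sin (r * t)) +
  \int[mu]_t (be^J t * (r * cos (r * t))) +
  \int[mu]_t (ga^J t * (r * - (r * sin (r * t)))) = 0.

Let ll : - l < l. Proof. by rewrite gtrN. Qed.
(** Two integrations by parts move everything onto the second derivative: the functional at [w]
    becomes [\int m w''] plus the boundary terms [w(l) \int al] and [w'(l) \int B]. *)
Let A := prim al^J.
Let B t := be t - A t.
Let m t := ga t - prim B^J t.

Let lprim f : L1 f -> L1 (prim f)^J.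
Proof.
move=> lf.
have h : mu.-integrable `[- l, l] (EFin \o prim f).
  apply: continuous_compact_integrable; [exact: segment_compact|].
  by apply: continuous_subspaceT; exact: prim_continuous.
by apply/integrable_patchP; apply: integrableS h => //; exact: subset_itv_oo_cc.
Qed.

Let lB : L1 B^J.
Proof. by rewrite /B patchB; apply: integrableB_fin => //; exact: lprim. Qed.

Let lm : L1 m^J.
Proof. by rewrite /m patchB; apply: integrableB_fin => //; exact: lprim. Qed.

Let BE t : B^J t = be^J t - A^J t. Proof. by rewrite /B patchB. Qed.

Let mE t : m^J t = ga^J t - (prim B^J)^J t. Proof. by rewrite /m patchB. Qed.

Let int_bd (w : R -> R) M f : continuous w -> (forall t, `|w t| <= M) -> L1 f ->
  L1 (fun t => f t * w t).
Proof.
move=> cw wM lf; rewrite (_ : (fun x => _) = (fun x => w x * f x)).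
  apply: (integrable_bounded_mul (M := M)) => //.
  exact: continuous_measurable_fun.
by apply/funext => x; rewrite mulrC.
Qed.

Let fold_C1 (w w' w'' : R -> R) M :
  (forall t : R, is_derive t (1 : R) w (w' t)) ->
  (forall t : R, is_derive t (1 : R) w' (w'' t)) ->
  continuous w' -> continuous w'' ->
  (forall t, `|w' t| <= M) -> (forall t, `|w'' t| <= M) ->
  \int[mu]_t (al^J t * w t) + \int[mu]_t (be^J t * w' t) +
  \int[mu]_t (ga^J t * w'' t) =
  w l * \int[mu]_t al^J t + w' l * \int[mu]_t B^J t +
  \int[mu]_t (m^J t * w'' t).
Proof.
move=> dw dw' cw' cw'' bw' bw''.
rewrite (parts_C1 ll lal dw cw') -/A.
have -> : w' l * \int[mu]_t B^J t = \int[mu]_t (be^J t * w' t) -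
    \int[mu]_t (A^J t * w' t) + \int[mu]_t ((prim B^J)^J t * w'' t).
  have := parts_C1 ll lB dw' cw''.
  rewrite [X in X = _ -> _](_ : _ =
    \int[mu]_t (be^J t * w' t - A^J t * w' t)); last first.
    by apply: eq_Rintegral => t _; rewrite BE mulrBl.
  rewrite RintegralB//; last 2 first.
  - exact: int_bd bw' lbe.
  - by apply: int_bd bw' _ => //; exact: lprim.
  by move=> ->; rewrite subrK.
have -> : \int[mu]_t (m^J t * w'' t) = \int[mu]_t (ga^J t * w'' t) -
    \int[mu]_t ((prim B^J)^J t * w'' t).
  rewrite [LHS](_ : _ =
    \int[mu]_t (ga^J t * w'' t - (prim B^J)^J t * w'' t)); last first.
    by apply: eq_Rintegral => t _; rewrite mE mulrBl.
  rewrite RintegralB//; first exact: int_bd bw'' lga.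
  by apply: int_bd bw'' _ => //; exact: lprim.
ring.
Qed.

(** [|r| + |r|^2] dominates the first and second derivatives of the sine and cosine of frequency [r]
    at once, as the single bound [M] of [fold_C1] demands. *)
Let cosb r (t : R) : `|- (r * sin (r * t))| <= `|r| + `|r| * `|r|.
Proof.
rewrite normrN normrM (@le_trans _ _ `|r|)//; last by rewrite lerDl.
by rewrite ler_piMr// sin_max.
Qed.

Let sinb r (t : R) : `|r * cos (r * t)| <= `|r| + `|r| * `|r|.
Proof.
rewrite normrM (@le_trans _ _ `|r|)//; last by rewrite lerDl.
by rewrite ler_piMr// cos_max.
Qed.

Let mulb (r x : R) : `|x| <= `|r| -> `|r * x| <= `|r| + `|r| * `|r|.
Proof.
move=> xr; rewrite normrM (@le_trans _ _ (`|r| * `|r|))//; last by rewrite lerDr.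
by rewrite ler_wpM2l.
Qed.

Let is_derive_sin2 r (t : R) :
  is_derive t (1 : R) (fun t => - (r * sin (r * t))) (- (r * (r * cos (r * t)))).
Proof. by apply: is_deriveN; apply: is_deriveZ; exact: is_derive_sinM. Qed.

Let is_derive_cos2 r (t : R) :
  is_derive t (1 : R) (fun t => r * cos (r * t)) (r * - (r * sin (r * t))).
Proof. by apply: is_deriveZ; exact: is_derive_cosM. Qed.

Let fold_cos r : cos (r * l) * \int[mu]_t al^J t +
  - (r * sin (r * l)) * \int[mu]_t B^J t +
  \int[mu]_t (m^J t * - (r * (r * cos (r * t)))) = 0.
Proof.
rewrite -(annc r); apply/esym.
apply: (fold_C1 (M := `|r| + `|r| * `|r|) (is_derive_cosM r) (is_derive_sin2 r)).
- exact: continuous_dcosM.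
- by move=> t; apply: cvgN; apply: cvgM; [exact: cvg_cst|exact: continuous_dsinM].
- exact: cosb.
- move=> t; rewrite normrN; apply: mulb.
  by rewrite normrM ler_piMr// cos_max.
Qed.

Let fold_sin r : sin (r * l) * \int[mu]_t al^J t +
  r * cos (r * l) * \int[mu]_t B^J t +
  \int[mu]_t (m^J t * (r * - (r * sin (r * t)))) = 0.
Proof.
rewrite -(anns r); apply/esym.
apply: (fold_C1 (M := `|r| + `|r| * `|r|) (is_derive_sinM r) (is_derive_cos2 r)).
- exact: continuous_dsinM.
- by move=> t; apply: cvgM; [exact: cvg_cst|exact: continuous_dcosM].
- exact: sinb.
- by move=> t; apply: mulb; rewrite normrN normrM ler_piMr// sin_max.
Qed.

(** At [r = 0] this is the only term left in the cosine identity. *)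
Let ial0 : \int[mu]_t al^J t = 0.
Proof.
have := fold_cos 0; rewrite !mul0r cos0 oppr0 mul0r addr0 mul1r.
rewrite [X in _ + X = _ -> _](_ : _ = 0) ?addr0// (_ : (fun t => _) = cst 0).
  by rewrite Rintegral_cst// mul0r.
by apply/funext => t; rewrite /= mul0r oppr0 mulr0.
Qed.

(** The sine identity divided by [r] equates the boundary term with [r \int m sin (r t)], which is
    [O(r)]. *)
Let iB0 : \int[mu]_t B^J t = 0.
Proof.
apply: (@cosM_bound_eq0 _ _ (\int[mu]_t `|m^J t|) l) => r r0.
have -> : \int[mu]_t B^J t * cos (r * l) = r * \int[mu]_t (m^J t * sin (r * t)).
  have := fold_sin r; rewrite ial0 mulr0 add0r.
  rewrite [X in _ + X = _ -> _](_ : Rintegral _ _ _ =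
    \int[mu]_t (- r ^+ 2 * (m^J t * sin (r * t)))); last first.
    by apply: eq_Rintegral => t _; ring.
  rewrite RintegralZl//; last exact: integrable_sinM.
  move=> h; apply: (mulfI r0); apply/eqP; rewrite -subr_eq0 -h; apply/eqP; ring.
rewrite normrM mulrC ler_wpM2r//; apply: Rintegral_mul_bound => //.
- by move=> x; exact: sin_max.
- by apply: continuous_measurable_fun; exact: continuous_sinM.
Qed.

(** With both boundary terms gone, only [- r^2] times a trigonometric integral of [m] remains, and
    [r^2] can be cancelled for every nonzero [r]. *)
Let m0 : {ae mu, forall t, t \in `]- l, l[ -> m t = 0}.
Proof.
apply: trig_separates => // r r0.
- have := fold_cos r; rewrite ial0 iB0 !mulr0 !add0r.
  rewrite (_ : Rintegral _ _ _ =
    \int[mu]_t (- r ^+ 2 * (m^J t * cos (r * t)))); last first.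
    by apply: eq_Rintegral => t _; ring.
  rewrite RintegralZl//; last exact: integrable_cosM.
  by move/eqP; rewrite mulf_eq0 oppr_eq0 expf_eq0/= (negbTE r0) => /eqP.
- have := fold_sin r; rewrite ial0 iB0 !mulr0 !add0r.
  rewrite (_ : Rintegral _ _ _ =
    \int[mu]_t (- r ^+ 2 * (m^J t * sin (r * t)))); last first.
    by apply: eq_Rintegral => t _; ring.
  rewrite RintegralZl//; last exact: integrable_sinM.
  by move/eqP; rewrite mulf_eq0 oppr_eq0 expf_eq0/= (negbTE r0) => /eqP.
Qed.

(** The same two integrations by parts are carried out for [u] with derivatives [g] and [h]: both
    boundary integrals are 0 and so is [m]. Integrability of [ga h] is assumed separately, since
    that of each factor says nothing about the product. *)
Lemma annihilator (u g h : R -> R) (k1 k2 : R) :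
  measurable_fun `]- l, l[ u -> measurable_fun `]- l, l[ g ->
  measurable_fun `]- l, l[ h ->
  L1 g^J -> L1 h^J -> L1 (fun t => ga^J t * h t) ->
  {ae mu, forall t, t \in `]- l, l[ -> u t = k1 + prim g^J t} ->
  {ae mu, forall t, t \in `]- l, l[ -> g t = k2 + prim h^J t} ->
  \int[mu]_t (al^J t * u t) + \int[mu]_t (be^J t * g t) +
  \int[mu]_t (ga^J t * h t) = 0.
Proof.
move=> mu_ mg mh lg lh lgh uE gE.
have [_ ->] := parts_AC lal lg mu_ uE.
rewrite ial0 mulr0 sub0r -/A.
have [l1 _] := parts_AC lbe lh mg gE.
have [_] := parts_AC lB lh mg gE.
rewrite iB0 mulr0 sub0r.
rewrite [X in X = _ -> _](_ : _ =
  \int[mu]_t (be^J t * g t - A^J t * g t)); last first.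
  by apply: eq_Rintegral => t _; rewrite BE mulrBl.
have E1 t : g^J t * A t = A^J t * g t.
  by rewrite !patchE; case: ifP => _; rewrite ?mul0r// mulrC.
have l2 : L1 (fun t => A^J t * g t).
  rewrite (_ : (fun t => _) = (fun t => g^J t * A t)).
    exact: integrable_mul_prim.
  by apply/funext => t; rewrite E1.
rewrite RintegralB// => E2.
under eq_Rintegral do rewrite E1.
rewrite [X in X + _ = _]addrC E2.
have E3 t : h^J t * prim B^J t = (prim B^J)^J t * h t.
  by rewrite !patchE; case: ifP => _; rewrite ?mul0r// mulrC.
have l3 : L1 (fun t => (prim B^J)^J t * h t).
  rewrite (_ : (fun t => _) = (fun t => h^J t * prim B^J t)).
    exact: integrable_mul_prim.
  by apply/funext => t; rewrite E3.
under eq_Rintegral do rewrite E3.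
rewrite addrC -RintegralB//.
rewrite (@ae_eq_Rintegral _ _ _ _ _ (cst 0)).
- by rewrite Rintegral_cst// mul0r.
- exact: integrable_measurable (integrableB_fin lgh l3).
- exact: measurable_cst.
- apply: aeS m0 => t h0; rewrite -mulrBl !patchE mem_setE.
  by case: ifPn => tl; rewrite ?subr0 ?mul0r//= -[ga t - _]/(m t) h0// mul0r.
Qed.

End Annihilator.

(** * Integral operators with a kernel in L2 of the triangle *)

Section RealFubini.
Context {R : realType}.
Local Notation mu := (@lebesgue_measure R).
Local Notation mT := (measurableTypeR R).
Local Notation L1 f := (mu.-integrable setT (EFin \o f)).
Variable F : mT * mT -> R.
Hypothesis lF : (mu \x mu)%E.-integrable setT (EFin \o F).

(** The inner integrals in Fubini's theorem are extended reals, finite almost everywhere; passing to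
    [fine] alters them on a null set only. *)
Lemma integrable_fine (g : R -> \bar R) : mu.-integrable setT g ->
  L1 (fun x => fine (g x)).
Proof.
move=> lg; have mg : measurable_fun setT g by case/integrableP: lg.
apply: (le_integrable _ _ _ lg) => //.
  by apply/measurable_EFinP; exact: measurableT_comp.
by move=> x _ /=; case: (g x) => [r| |] /=; rewrite ?normr0 ?lexx ?leey.
Qed.

Lemma integral_fine (g : R -> \bar R) : mu.-integrable setT g ->
  \int[mu]_x fine (g x) = fine (\int[mu]_x g x)%E.
Proof.
move=> lg; congr fine; apply: ae_eq_integral => //.
- by case/integrableP: (integrable_fine lg).
- by case/integrableP: lg.
- by apply: aeS (integrable_ae measurableT lg) => x h _; rewrite fineK// h.
Qed.

Lemma integrable_Rsection1 : L1 (fun x => \int[mu]_t F (x, t)).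
Proof. exact: integrable_fine (integrable_fubini_F lF). Qed.

Lemma integrable_fubini_G : mu.-integrable setT (fubini_G mu (EFin \o F)).
Proof.
have mF : measurable_fun setT (EFin \o F) by case/integrableP: lF.
apply/integrableP; split; first exact: (measurable_fubini_G lF).
apply: (@le_lt_trans _ _ (\int[mu]_t \int[mu]_x `|(F (x, t))%:E|)%E).
  apply: ge0_le_integral => //.
  - by apply: measurableT_comp => //; exact: (measurable_fubini_G lF).
  - apply: (measurable_fun_fubini_tonelli_G (abse \o (EFin \o F))) => //=.
    exact: measurableT_comp.
  - move=> y _; apply: le_abse_integral => //.
    by apply: measurableT_comp => //; exact: measurable_pair2.
exact: (integrable21ltyP mu mu mF).1 lF.
Qed.

Lemma integrable_Rsection2 : L1 (fun t => \int[mu]_x F (x, t)).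
Proof. exact: integrable_fine integrable_fubini_G. Qed.

Lemma Rintegral_Fubini :
  \int[mu]_x \int[mu]_t F (x, t) = \int[mu]_t \int[mu]_x F (x, t).
Proof.
rewrite [LHS](integral_fine (integrable_fubini_F lF)).
rewrite [RHS](integral_fine integrable_fubini_G).
by congr fine; exact: Fubini lF.
Qed.

End RealFubini.

Section KernelFubini.
Context {R : realType}.
Local Notation mu := (@lebesgue_measure R).
Local Notation mT := (measurableTypeR R).
Local Notation L1 f := (mu.-integrable setT (EFin \o f)).
Variables (l : R) (k : R -> R -> R).
Let k0 : mT * mT -> R := (fun p : R * R => k p.1 p.2) \_ (triangle l).
Hypothesis lk : k0 \in Lfun (mu \x mu)%E 2%:E.

Definition kint (w : R -> R) (x : R) := \int[mu]_(t in `[- x, x]) (k x t * w t).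

(** The transpose of [kint]. With the kernel cut off to the triangle, [x] may range over the whole
    line. *)
Definition kadj (zeta : R -> R) (t : R) := \int[mu]_x (zeta x * k0 (x, t)).

Let k0E x t : k0 (x, t) = if `|t| <= x <= l then k x t else 0.
Proof.
rewrite /k0 patchE; case: ifPn => [|/negP]; rewrite in_setE /triangle/=.
  by move=> ->.
by move=> /negP/negbTE ->.
Qed.

Let mk0 : measurable_fun setT k0.
Proof. by have /andP[] := lk; rewrite inE. Qed.

(** The product [|k w|] is at most [k^2 + w^2]. The indicator of [[0, l]] in [x] costs nothing, as
    the kernel vanishes off the triangle, and makes the second term integrable over the plane. *)
Let integrable_core (zeta w : R -> R) M : measurable_fun setT zeta ->
  (forall x, `|zeta x| <= M) -> measurable_fun setT w ->
  L1 (fun t => w t ^+ 2) ->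
  (mu \x mu)%E.-integrable setT
    (EFin \o (fun z : mT * mT => zeta z.1 * (k0 z * w z.2))).
Proof.
move=> mz zM mw lw.
apply: (integrable_bounded_mul (M := M)).
- exact: (measurableT_comp mz measurable_fst).
- by move=> z; exact: zM.
pose ind := \1_`[0, l] : R -> R.
have lind : L1 ind by exact: integrable_indic_itv.
apply: (@integrable_le _ _ _ _ _ (fun z => k0 z ^+ 2 + ind z.1 * w z.2 ^+ 2)).
- apply: measurable_funM; first exact: mk0.
  exact: (measurableT_comp mw measurable_snd).
- move=> [x t] /=; rewrite /ind indicE mem_setE in_itv/= normrM.
  have [h|h] := boolP (0 <= x <= l).
    rewrite mul1r -(real_normK (num_real (k0 _))) -(real_normK (num_real (w t))).
    move: (normr_ge0 (k0 (x, t))) (normr_ge0 (w t)).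
    move: `|k0 _| `|w t| => a b a0 b0.
    have := sqr_ge0 (a - b); have := mulr_ge0 a0 b0; nra.
  rewrite mul0r addr0 k0E ifF ?normr0 ?mul0r ?sqr_ge0//.
  by apply/negP => /andP[tx xl]; move/negP: h; rewrite xl (le_trans _ tx).
- apply: integrableD_fin; first exact: Lfun2_integrable_sqr.
  exact: (integrable_prod lind lw).
Qed.

Section Weighted.
Variables (zeta w : R -> R) (M : R).
Hypothesis mz : measurable_fun setT zeta.
Hypothesis zM : forall x, `|zeta x| <= M.
Hypothesis zout : forall x, x \notin `]0, l[ -> zeta x = 0.
Local Notation w0 := (w \_ `]- l, l[).
Hypothesis mw : measurable_fun setT w0.
Hypothesis lw : L1 (fun t => w0 t ^+ 2).

(** For [0 < x < l] the interval [[- x, x]] is the slice of the triangle at [x] and lies in []- l,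
    l[], so neither cut-off changes the integrand. *)
Lemma kernel_section x : x \in `]0, l[ ->
  (fun t => k x t * w t) \_ `[- x, x] = (fun t => k0 (x, t) * w0 t).
Proof.
rewrite in_itv/= => /andP[x0 xl]; apply/funext => t.
rewrite !patchE !mem_setE !in_itv/= -ler_norml -ltr_norml k0E (ltW xl) andbT.
case: ifPn => h; last by rewrite mul0r.
by rewrite (le_lt_trans h xl).
Qed.

Lemma kintE x : x \in `]0, l[ -> kint w x = \int[mu]_t (k0 (x, t) * w0 t).
Proof. by move=> xl; rewrite /kint Rintegral_mkcond kernel_section. Qed.

Lemma integrable_kernel_mul : (mu \x mu)%E.-integrable setT
  (EFin \o (fun z : mT * mT => k0 z * w0 z.2)).
Proof.
have := @integrable_core (cst 1) w0 1 (measurable_cst _) _ mw lw.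
rewrite (_ : (fun z => cst 1 z.1 * _) = (fun z => k0 z * w0 z.2)).
  by apply => x; rewrite normr1.
by apply/funext => z; rewrite mul1r.
Qed.

Lemma integrable_kint : L1 (kint w \_ `]0, l[).
Proof.
rewrite (_ : _ \_ _ = (fun x => \int[mu]_t (k0 (x, t) * w0 t)) \_ `]0, l[).
  apply: integrable_patch => //; exact: (integrable_Rsection1 integrable_kernel_mul).
apply/funext => x; rewrite !patchE mem_setE; case: ifPn => // xl.
exact: kintE.
Qed.

Lemma ae_integrable_kint : {ae mu, forall x, x \in `]0, l[ ->
  mu.-integrable `[- x, x] (EFin \o (fun t => k x t * w t))}.
Proof.
apply: aeS (ae_integrable1 integrable_kernel_mul) => x h xl.
suff : L1 ((fun t => k x t * w t) \_ `[- x, x]).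
  by rewrite -restrict_EFin => /integrable_restrict; rewrite setTI; apply.
by rewrite kernel_section.
Qed.

(** The indicator of [[- l, l]] plays the role of [w]: it equals 1 wherever the cut-off kernel is
    nonzero. *)
Let core2 : (mu \x mu)%E.-integrable setT
    (EFin \o (fun z : mT * mT => zeta z.1 * k0 z)).
Proof.
pose ind := \1_`[- l, l] : R -> R.
rewrite (_ : (fun z : mT * mT => zeta z.1 * k0 z) =
  (fun z => zeta z.1 * (k0 z * ind z.2))).
  have mi : measurable_fun setT ind by exact: measurable_indic.
  apply: (integrable_core mz zM mi).
  rewrite (_ : (fun t => _) = ind); first exact: integrable_indic_itv.
  by apply/funext => t; rewrite /ind indicE; case: (_ \in _); rewrite ?expr0n ?expr1n.
apply/funext => -[x t]; congr (_ * _); rewrite /= /ind indicE mem_setE in_itv/= k0E.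
case: ifPn => [/andP[tx xl]|_]; last by rewrite mul0r.
by rewrite -ler_norml (le_trans tx xl) mulr1.
Qed.

Lemma kint_swap :
  [/\ L1 (fun x => zeta x * kint w x), L1 (fun t => w0 t * kadj zeta t) &
   \int[mu]_x (zeta x * kint w x) = \int[mu]_t (w0 t * kadj zeta t)].
Proof.
have core := integrable_core mz zM mw lw.
(* [zeta x] is taken out of the inner integral where the section is integrable, which Fubini
   provides for almost every [x]. *)
have E1 : {ae mu, forall x, \int[mu]_t (zeta x * (k0 (x, t) * w0 t)) =
    zeta x * kint w x}.
  apply: aeS (ae_integrable1 integrable_kernel_mul) => x h.
  have [xl|xl] := boolP (x \in `]0, l[).
    by rewrite RintegralZl//= kintE.
  rewrite zout// mul0r (_ : (fun t => _) = cst 0) ?Rintegral_cst ?mul0r//.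
  by apply/funext => t; rewrite mul0r.
have E2 : {ae mu, forall t, \int[mu]_x (zeta x * (k0 (x, t) * w0 t)) =
    w0 t * kadj zeta t}.
  apply: aeS (ae_integrable2 core2) => t h.
  rewrite /kadj -RintegralZl//; apply: eq_Rintegral => x _; ring.
have mE1 : measurable_fun setT (fun x => zeta x * kint w x).
  rewrite (_ : (fun x => _) = (fun x => zeta x * (kint w \_ `]0, l[) x)).
    apply: measurable_funM => //; exact: integrable_measurable integrable_kint.
  apply/funext => x; rewrite patchE mem_setE; case: ifPn => // xl.
  by rewrite zout// !mul0r.
have mE2 : measurable_fun setT (fun t => w0 t * kadj zeta t).
  apply: measurable_funM => //.
  exact: integrable_measurable (integrable_Rsection2 core2).
have l1 := integrable_Rsection1 core; have l2 := integrable_Rsection2 core.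
split; [by apply: ae_eq_integrable E1 l1|by apply: ae_eq_integrable E2 l2|].
rewrite -(ae_eq_Rintegral (integrable_measurable l1) mE1 E1).
rewrite -(ae_eq_Rintegral (integrable_measurable l2) mE2 E2).
exact: (Rintegral_Fubini core).
Qed.

Lemma integrable_kadj : L1 (kadj zeta \_ `]- l, l[).
Proof.
apply: integrable_patch => //; exact: integrable_Rsection2 core2.
Qed.

End Weighted.

End KernelFubini.

(** * Two-sided bounds for the impedance, and Gronwall's inequality *)

Section AeLe.
Context {d : measure_display} {T : measurableType d} {R : realType}.
Variable mu : {measure set T -> \bar R}.

(** Replacing [g] by the maximum of [f] and [g], equal to it almost everywhere, reduces to a
    pointwise comparison. *)
Lemma ae_le_Rintegral (f g : T -> R) : mu.-integrable setT (EFin \o f) ->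
  mu.-integrable setT (EFin \o g) -> {ae mu, forall x, f x <= g x} ->
  Rintegral mu setT f <= Rintegral mu setT g.
Proof.
move=> lf lg fg.
have mf := integrable_measurable lf; have mg := integrable_measurable lg.
pose h x := Num.max (f x) (g x).
have mh : measurable_fun setT h by exact: measurable_maxr.
have hg : {ae mu, forall x, g x = h x}.
  by apply: aeS fg => x fgx; rewrite /h max_r.
rewrite (ae_eq_Rintegral mg mh hg); apply: le_Rintegral => //.
  exact: ae_eq_integrable hg lg.
by move=> x _; rewrite /h le_max lexx.
Qed.

End AeLe.

Section Bounds.
Context {R : realType}.
Local Notation mu := (@lebesgue_measure R).
Local Notation L1 f := (mu.-integrable setT (EFin \o f)).
Implicit Types (a f g : R -> R) (c d x y l : R).

Lemma Rintegral_subset_norm (D E : set R) f : measurable D -> measurable E ->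
  D `<=` E -> L1 f -> \int[mu]_(t in D) `|f t| <= \int[mu]_(t in E) `|f t|.
Proof.
move=> mD mE DE lf; rewrite Rintegral_mkcond [leRHS]Rintegral_mkcond.
have ln := integrable_norm_fin lf.
apply: le_Rintegral => //; try exact: integrable_patch.
move=> x _; rewrite !patchE; case: ifPn => xD.
  by rewrite ifT// mem_set//; apply: DE; move: xD; rewrite inE.
by case: ifP => _ //; exact: normr_ge0.
Qed.

Lemma prim_dist_itv f x y s t : L1 f -> x <= s <= y -> x <= t <= y ->
  `|prim f s - prim f t| <= \int[mu]_(z in `]x, y]) `|f z|.
Proof.
move=> lf; wlog ts : s t / t <= s.
  by move=> H hs ht; have [/H|/ltW/H] := leP t s; last rewrite distrC; apply.
move=> /andP[xs sy] /andP[xt ty].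
apply: (le_trans (prim_dist lf ts)); apply: Rintegral_subset_norm => //.
move=> z /=; rewrite !in_itv/= => /andP[tz zs].
by rewrite (le_lt_trans xt tz) (le_trans zs sy).
Qed.

Lemma lebesgue_measure_oc_eq x y : x <= y -> fine (mu `]x, y]) = y - x.
Proof.
rewrite le_eqVlt => /predU1P[->|xy].
  by rewrite set_itvoc0 measure0 subrr.
by rewrite lebesgue_measure_itv/= lte_fin xy.
Qed.

Lemma integrable_cst_oc x y (k : R) : mu.-integrable `]x, y] (EFin \o cst k).
Proof.
have h : mu.-integrable `[x, y] (EFin \o cst k).
  by apply: measurable_bounded_integrable => //;
    [exact: lebesgue_measure_itv_lty|exact: bounded_cst].
by apply: integrableS h => //; exact: subset_itv_oc_cc.
Qed.

Lemma le_inv_add_sqr (eta s : R) : 0 < eta -> 0 <= s ->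
  s <= eta^-1 + eta * s ^+ 2.
Proof.
move=> eta0 s0; rewrite -subr_ge0 -(pmulr_rge0 _ eta0).
rewrite [X in 0 <= X](_ : _ = 1 + (eta * s) ^+ 2 - eta * s); last first.
  by field; rewrite gt_eqF.
by have := sqr_ge0 (eta * s - 1); have := mulr_ge0 (ltW eta0) s0; nra.
Qed.

(* Cauchy-Schwarz on an interval of length eta^2, by AM-GM *)
Lemma integral_norm_le_sqr g x y (eta : R) : 0 < eta -> y - x = eta ^+ 2 ->
  measurable_fun setT g -> L1 (fun t => g t ^+ 2) -> L1 g ->
  \int[mu]_(t in `]x, y]) `|g t| <= eta * (1 + \int[mu]_t g t ^+ 2).
Proof.
move=> eta0 xy mg lg2 lg.
have xley : x <= y by rewrite -subr_ge0 xy sqr_ge0.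
have ls : mu.-integrable `]x, y] (EFin \o (fun t => g t ^+ 2)).
  exact: integrableS lg2.
apply: (@le_trans _ _ (\int[mu]_(t in `]x, y]) (eta^-1 + eta * g t ^+ 2))).
  apply: le_Rintegral => //.
  - by apply: integrableS (integrable_norm_fin lg).
  - rewrite (_ : _ \o _ = ((EFin \o cst (eta^-1)%R) \+
        (fun t => eta%:E * (g t ^+ 2)%:E))%E) //.
    apply: integrableD => //; first exact: integrable_cst_oc.
    exact: (integrableZl _ eta ls).
  - by move=> t _; rewrite -(real_normK (num_real (g t))) le_inv_add_sqr.
rewrite (@RintegralD _ _ _ _ _ (cst eta^-1))//; last 2 first.
- exact: integrable_cst_oc.
- exact: (integrableZl _ eta ls).
rewrite Rintegral_cst// lebesgue_measure_oc_eq// xy RintegralZl//.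
rewrite expr2 mulrA mulVf ?gt_eqF// mul1r mulrDr mulr1 lerD2l ler_wpM2l ?(ltW eta0)//.
have := @Rintegral_subset_norm `]x, y]%classic setT _ _ _ (@subsetT _ _) lg2.
rewrite (_ : (fun t => `|g t ^+ 2|) = (fun t => g t ^+ 2)); first by apply.
by apply/funext => t; rewrite ger0_norm// sqr_ge0.
Qed.

(* If the continuous representative of a vanished at x0, it would be O(eta) at
   distance eta^2 from x0, so the integral of a^-2 over that interval would
   stay bounded away from 0. *)
Lemma rweak_bounds l a g : 0 < l -> (forall x, x \in `]0, l[ -> 0 < a x) ->
  mu.-integrable `]0, l[ (EFin \o a) ->
  L1 (fun x => ((fun x => (a x)^-1) \_ `]0, l[) x ^+ 2) ->
  L1 (g \_ `]0, l[) -> L1 (fun x => (g \_ `]0, l[) x ^+ 2) ->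
  rweak 0 l a g ->
  exists c C, 0 < c /\ {ae mu, forall x, x \in `]0, l[ -> c <= a x <= C}.
Proof.
move=> l0 apos la lb2 lg lg2 wag.
have lgJ := (integrable_patchP 0 l g).2 lg.
have [k ak] := rweak_prim l0 la lgJ wag.
set g0 := g \_ _ in lg lg2 ak; set b0 := _ \_ _ in lb2.
(* The continuous representative of [a]. Its extrema on [[0, l]] provide the two bounds; only
   positivity of the minimum needs an argument. *)
pose A x := k + prim g0 x.
have cA : continuous A.
  by move=> x; apply: cvgD; [exact: cvg_cst|exact: prim_continuous].
have cAJ : {within `[0, l], continuous A} by exact: continuous_subspaceT.
have [xM xMJ hM] := EVT_max (ltW l0) cAJ.
have [x0 x0J hm] := EVT_min (ltW l0) cAJ.
exists (A x0), (A xM); split; last first.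
  apply: aeS ak => x h xJ; rewrite h// hm ?hM//;
    by move: xJ; rewrite !in_itv/= => /andP[/ltW-> /ltW->].
rewrite ltNge; apply/negP => A0.
pose G := \int[mu]_t g0 t ^+ 2.
have G0 : 0 <= G by apply: Rintegral_ge0 => x _; exact: sqr_ge0.
pose kap := 1 + G.
have kap0 : 0 < kap by rewrite ltr_pwDl.
(* On an interval of length [eta^2] where [a <= eta kap], the integral of [a^-2] is at least
   [eta^2 / (eta kap)^2 = kap^-2], whatever [eta] is. Absolute continuity of the integral forbids
   this for lengths below [d]. *)
have e0 : 0 < (kap ^+ 2)^-1 by rewrite invr_gt0 exprn_gt0.
have [d [d0 hd]] := integral_normr_continuous lb2 e0.
pose de := Num.min (d / 2) (l / 2).
have de0 : 0 < de by rewrite lt_min !divr_gt0.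
pose eta := Num.sqrt de.
have eta0 : 0 < eta by rewrite sqrtr_gt0.
have etaE : eta ^+ 2 = de by rewrite sqr_sqrtr// ltW.
have ded : de < d.
  by rewrite (@le_lt_trans _ _ (d / 2)) ?ge_min ?lexx//; lra.
have del : de <= l / 2 by rewrite ge_min lexx orbT.
(* Since [de <= l / 2], an interval of length [de] fits to the right of [x0] when [x0] is in the
   left half, and to its left otherwise. *)
have [x [y [xy x0x xy0 yl]]] : exists x y, [/\ y - x = de, x <= x0 <= y, 0 <= x & y <= l].
  move: x0J; rewrite in_itv/= => /andP[h1 h2].
  have [h|h] := leP x0 (l / 2).
    by exists x0, (x0 + de); split; lra.
  by exists (x0 - de), x0; split; lra.
have xley : x <= y by lra.
have mg0 : measurable_fun setT g0 := integrable_measurable lg.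
have dist t : x <= t <= y -> A t <= eta * kap.
  move=> ht; apply: le_trans (integral_norm_le_sqr eta0 _ mg0 lg2 lg); last first.
    by rewrite etaE; exact: xy.
  apply: (@le_trans _ _ (A t - A x0)); first by rewrite lerBrDr gerDl.
  rewrite /A opprD addrACA subrr add0r (le_trans (ler_norm _))//.
  exact: prim_dist_itv.
have := hd `]x, y]%classic (measurable_itv _) (lebesgue_measure_oc d0 _).
rewrite xy => /(_ ded); apply/negP; rewrite -leNgt.
have eq1 : (kap ^+ 2)^-1 = \int[mu]_(t in `]x, y]) ((eta * kap) ^+ 2)^-1.
  rewrite Rintegral_cst// lebesgue_measure_oc_eq// xy -etaE.
  by field; rewrite !gt_eqF.
have lc := integrable_cst_oc x y ((eta * kap) ^+ 2)^-1.
have lbxy : mu.-integrable `]x, y] (EFin \o (fun t => `|b0 t ^+ 2|)).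
  by apply: integrableS (integrable_norm_fin lb2).
rewrite eq1 -Rintegral_itv_bndo_bndc; last first.
  by apply: integrableS lc => //;
    apply: subset_itvl; rewrite bnd_simp.
rewrite -Rintegral_itv_bndo_bndc; last first.
  by apply: integrableS lbxy => //;
    apply: subset_itvl; rewrite bnd_simp.
rewrite Rintegral_mkcond [leRHS]Rintegral_mkcond.
apply: ae_le_Rintegral.
- by apply/integrable_patchP; apply: integrableS lc => //;
    apply: subset_itvl; rewrite bnd_simp.
- by apply/integrable_patchP; apply: integrableS lbxy => //;
    apply: subset_itvl; rewrite bnd_simp.
apply: aeS ak => t ht; rewrite !patchE mem_setE; case: ifPn => // txy.
have tJ : t \in `]0, l[.
  by move: txy; rewrite !in_itv/= => /andP[h1 h2];
    rewrite (le_lt_trans xy0 h1) (lt_le_trans h2 yl).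
rewrite /b0 patchE mem_setE tJ ger0_norm ?sqr_ge0// exprVn.
have at0 := apos _ tJ.
rewrite lef_pV2 ?posrE ?exprn_gt0 ?mulr_gt0// lerXn2r ?nnegrE ?(ltW at0)//.
  by rewrite mulr_ge0// ltW.
rewrite ht//; apply: dist; move: txy; rewrite in_itv/= => /andP[h1 h2].
by rewrite !ltW.
Qed.

(* Gronwall: e^{- C x} times the primitive of N decreases from 0. *)
Lemma gronwall l C (N : R -> R) : 0 < l -> continuous N ->
  L1 (N \_ `]0, l[) ->
  (forall x, x \in `[0, l] -> N x <= C * prim (N \_ `]0, l[) x) ->
  forall x, x \in `[0, l] -> 0 <= C -> N x <= 0.
Proof.
move=> l0 cN lN hN; set G := prim _ in hN *.
have G00 : G 0 = 0.
  apply: prim_eq0 => t t0; rewrite patchE mem_setE in_itv/=.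
  by rewrite ltNge t0.
have dG x : x \in `]0, l[ -> is_derive x (1 : R) G (N x).
  move=> xJ.
  have NJx : (N \_ `]0, l[) x = N x by rewrite patchE mem_setE xJ.
  have cx : {for x, continuous (N \_ `]0, l[)}.
    change ((N \_ `]0, l[) t @[t --> x] --> (N \_ `]0, l[) x); rewrite NJx.
    have h : N t @[t --> x] --> N x by exact: cN.
    apply: cvg_trans h; apply: near_eq_cvg; near=> t; rewrite patchE mem_setE ifT//.
    by near: t; exact: near_in_itvoo.
  have [h1] := derive_prim_continuous lN cx.
  rewrite NJx derive1E => h2.
  by rewrite -h2; exact/derivableP.
pose H x := G x * expR (- C * x).
have cG : continuous G by exact: prim_continuous.
have dE x : is_derive x (1 : R) (fun x => expR (- C * x)) (- C * expR (- C * x)).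
  have d1 : is_derive x (1 : R) (fun t => - C * t) (- C * 1) by apply: is_deriveZ.
  have d2 := is_derive1_comp (is_derive_expR (- C * x)) d1.
  by apply: is_derive_eq d2 _; rewrite mulr1 mulrC.
have dH x : x \in `]0, l[ -> is_derive x (1 : R) H
    ((N x - C * G x) * expR (- C * x)).
  move=> xJ; apply: is_derive_eq (is_deriveM (dG x xJ) (dE x)) _.
  rewrite /GRing.scale /=; ring.
have cH : continuous H.
  have cE : continuous (fun x => expR (- C * x)).
    move=> x; apply: differentiable_continuous; apply/derivable1_diffP.
    by case: (dE x).
  by move=> x; apply: cvgM; [exact: cG|exact: cE].
have H_le0 x : x \in `[0, l] -> H x <= 0.
  rewrite in_itv/= => /andP[x0 xl].
  rewrite [X in _ <= X](_ : _ = H 0); last by rewrite /H G00 mul0r.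
  have m0 : 0 \in `[0, l] by rewrite in_itv/= lexx ltW.
  have mx : x \in `[0, l] by rewrite in_itv/= x0 xl.
  apply: (@ler0_derive1_le_cc _ H 0 l _ _ _ x 0 mx m0) => //.
  - by move=> t /dH[].
  - move=> t tJ; rewrite derive1E; have [_ ->] := dH t tJ.
    rewrite pmulr_lle0 ?expR_gt0// subr_le0; apply: hN.
    by move: tJ; rewrite !in_itv/= => /andP[/ltW-> /ltW->].
  - exact: continuous_subspaceT.
move=> x xl C0; apply: le_trans (hN x xl) _; apply: mulr_ge0_le0 => //.
by have := H_le0 x xl; rewrite /H pmulr_lle0// expR_gt0.
Unshelve. all: by end_near. Qed.

End Bounds.

(** * The impedance equation *)

Section WeakComplex.
Context {R : realType}.
Local Notation mu := (@lebesgue_measure R).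
Local Notation L1 f := (mu.-integrable setT (EFin \o f)).
Implicit Types (c d l : R) (f g : R -> R[i]).

Lemma wderivP c d f : weakly_differentiable c d f ->
  weak_derivative c d f (wderiv c d f).
Proof. exact: (@xgetPex _ (fun=> 0) [set g | weak_derivative c d f g]). Qed.

Lemma Re_mulrC (z : R[i]) (r : R) : complex.Re (z * r%:C) = complex.Re z * r.
Proof. by case: z => x y /=; rewrite mulr0 subr0. Qed.

Lemma Im_mulrC (z : R[i]) (r : R) : complex.Im (z * r%:C) = complex.Im z * r.
Proof. by case: z => x y /=; rewrite mulr0 add0r. Qed.

Lemma Re_mulCr (z : R[i]) (r : R) : complex.Re (r%:C * z) = r * complex.Re z.
Proof. by rewrite mulrC Re_mulrC mulrC. Qed.

Lemma Im_mulCr (z : R[i]) (r : R) : complex.Im (r%:C * z) = r * complex.Im z.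
Proof. by rewrite mulrC Im_mulrC mulrC. Qed.

Lemma weak_derivativeP c d f g : weak_derivative c d f g <->
  [/\ clocally_integrable `]c, d[ f, clocally_integrable `]c, d[ g,
    rweak c d (fun x => complex.Re (f x)) (fun x => complex.Re (g x)) &
    rweak c d (fun x => complex.Im (f x)) (fun x => complex.Im (g x))].
Proof.
have E h phi : cintegral mu `]c, d[ (fun x => h x * (phi x)%:C) =
    Rintegral mu `]c, d[ (fun x => complex.Re (h x) * phi x) +i*
    Rintegral mu `]c, d[ (fun x => complex.Im (h x) * phi x).
  by rewrite /cintegral; congr (_ +i* _); apply: eq_Rintegral => x _;
    rewrite ?Re_mulrC ?Im_mulrC.
split=> [[lf lg H]|[lf lg H1 H2]].
  split => // phi tphi; have := H phi tphi; rewrite !E => /eqP;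
    by rewrite eq_complex => /andP[/eqP/= h1 /eqP/= h2].
split => // phi tphi; rewrite !E; apply/eqP.
by rewrite eq_complex/= (H1 _ tphi) (H2 _ tphi) !eqxx.
Qed.

Lemma rweak_ae c d (f f' g g' : R -> R) :
  measurable_fun `]c, d[ f -> measurable_fun `]c, d[ f' ->
  measurable_fun `]c, d[ g -> measurable_fun `]c, d[ g' ->
  {ae mu, forall x, x \in `]c, d[ -> f x = f' x} ->
  {ae mu, forall x, x \in `]c, d[ -> g x = g' x} ->
  rweak c d f g -> rweak c d f' g'.
Proof.
move=> mf mf' mg mg' ff gg H phi tphi.
have K (h h' psi : R -> R) : measurable_fun `]c, d[ h -> measurable_fun `]c, d[ h' ->
    measurable_fun setT psi -> {ae mu, forall x, x \in `]c, d[ -> h x = h' x} ->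
    \int[mu]_(x in `]c, d[) (h x * psi x) = \int[mu]_(x in `]c, d[) (h' x * psi x).
  move=> mh mh' mpsi hh; congr fine; apply: ae_eq_integral => //.
  - by apply/measurable_EFinP; apply: measurable_funM => //; exact: measurable_funTS.
  - by apply/measurable_EFinP; apply: measurable_funM => //; exact: measurable_funTS.
  - by apply: aeS hh => x h0 xJ; rewrite h0.
rewrite -(K f f') //; last exact: test_measurable (test_function_derive1 tphi).
by rewrite -(K g g') //; [exact: H|exact: test_measurable tphi].
Qed.

(** Uniqueness of the weak derivative: [g] minus [g'] is orthogonal to every test function, hence 0
    almost everywhere by [test_separates]. *)
Lemma weak_derivative_ae c d f f' g g' :
  weak_derivative c d f g -> weak_derivative c d f' g' ->
  {ae mu, forall x, x \in `]c, d[ -> f x = f' x} ->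
  {ae mu, forall x, x \in `]c, d[ -> g x = g' x}.
Proof.
move=> /weak_derivativeP[[lf1 lf2] [lg1 lg2] H1 H2].
move=> /weak_derivativeP[[lf1' lf2'] [lg1' lg2'] H1' H2'] ff.
have K (p p' q q' : R -> R) : locally_integrable `]c, d[ p ->
    locally_integrable `]c, d[ p' -> locally_integrable `]c, d[ q ->
    locally_integrable `]c, d[ q' -> rweak c d p q -> rweak c d p' q' ->
    {ae mu, forall x, x \in `]c, d[ -> p x = p' x} ->
    {ae mu, forall x, x \in `]c, d[ -> q x = q' x}.
  move=> lp lp' lq lq' W W' pp.
  have [mp _ _] := lp; have [mp' _ _] := lp'; have [mq _ _] := lq; have [mq' _ _] := lq'.
  have W2 : rweak c d p' q by apply: rweak_ae W => //; exact: aeW.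
  suff : {ae mu, forall x, x \in `]c, d[ -> (q \- q') x = 0}.
    by apply: aeS => x h /h /eqP; rewrite subr_eq0 => /eqP.
  apply: test_separates; first exact: locally_integrableB.
  move=> phi tphi; have := W2 phi tphi; rewrite (W' phi tphi) => /oppr_inj h.
  have [_ [c' [d' [cc dd phi0]]]] := tphi.
  have I0 (m : R -> R) : locally_integrable `]c, d[ m ->
      mu.-integrable `]c, d[ (EFin \o (fun x => m x * phi x)).
    move=> lm; apply/integrable_patchP.
    (* The midpoints cut out an interval around [[c', d']] whose ends are strictly inside []c, d[],
       where [m] is integrable; [phi] vanishes on the two remaining strips. *)
    have l1 := locally_integrable_patch (x := (c + c') / 2) (y := (d + d') / 2) _ _ lm.
    rewrite (_ : _ \_ _ = (fun x => (m \_ `](c + c') / 2, (d + d') / 2[) x * phi x)).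
      by apply: (integrable_mul_test tphi); apply: l1; lra.
    apply/funext => x; rewrite !patchE !mem_setE.
    have [xcd|xcd] := boolP (x \in `[c', d']); last first.
      by rewrite phi0// mulr0; case: ifP; rewrite ?mulr0.
    by move: xcd; rewrite !in_itv/= => xcd; rewrite ifT ?ifT//; lra.
  under eq_Rintegral do rewrite mulrBl.
  rewrite RintegralB//; [by rewrite h subrr|exact: I0..].
have A1 := K _ _ _ _ lf1 lf1' lg1 lg1' H1 H1' _.
have A2 := K _ _ _ _ lf2 lf2' lg2 lg2' H2 H2' _.
apply: aeS2 (A1 _) (A2 _).
- move=> x h1 h2 xJ; move: (h1 xJ) (h2 xJ); case: (g x) (g' x) => x1 y1 [x2 y2] /=.
  by move=> -> ->.
- by apply: aeS ff => x h /h ->.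
- by apply: aeS ff => x h /h ->.
Qed.

(** [rweak_prim] gives the formula almost everywhere with some constant. Both sides are continuous
    and a set of full measure is dense, so it holds at every point; the value at 0 identifies the
    constant. *)
Lemma rweak_continuous l (f g : R -> R) : 0 < l ->
  {within `[0, l], continuous f} -> L1 (g \_ `]0, l[) -> rweak 0 l f g ->
  forall x, x \in `[0, l] -> f x = f 0 + prim (g \_ `]0, l[) x.
Proof.
move=> l0 cf lg W.
have lf : mu.-integrable `[0, l] (EFin \o f).
  by apply: continuous_compact_integrable => //; exact: segment_compact.
have lf' : mu.-integrable `]0, l[ (EFin \o f).
  by apply: integrableS lf => //; exact: subset_itv_oo_cc.
have [k hk] := rweak_prim l0 lf' ((integrable_patchP _ _ _).2 lg) W.
pose D x := f x - prim (g \_ `]0, l[) x.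
have cD : {within `[0, l], continuous D}.
  move=> x; apply: cvgB; first exact: cf.
  by apply: continuous_subspaceT; exact: prim_continuous.
have Dk x : x \in `[0, l] -> D x = k.
  move=> xl; apply/eqP; apply: contrapT => /negP Dxk.
  have e0 : 0 < `|D x - k| by rewrite normr_gt0 subr_eq0.
  have /subspace_continuousP := cD => /(_ x xl) /cvgrPdist_lt /(_ _ e0).
  rewrite /within /= => -[de /= de0 hde].
  have [y] : exists2 y, y \in `](Num.max 0 (x - de)), (Num.min l (x + de))[ &
      D y = k.
    apply: ae_itv_ex.
      by move: xl; rewrite in_itv/= lt_min !gt_max => xl; lra.
    apply: aeS hk => y h; rewrite in_itv/= gt_max lt_min => hy.
    by rewrite /D h ?addrK// in_itv/=; lra.
  rewrite in_itv/= gt_max lt_min => hy Dyk.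
  have : `|D x - D y| < `|D x - k|.
    by apply: (hde y); [rewrite /= ltr_norml|rewrite in_itv/=]; lra.
  by rewrite Dyk ltxx.
have p0 : prim (g \_ `]0, l[) 0 = 0.
  by apply: prim_eq0 => t t0; rewrite patchE mem_setE in_itv/= ltNge t0.
move=> x xl; have := Dk x xl; have := Dk 0 _; rewrite /D p0 subr0 => ->.
  by move=> <-; rewrite subrK.
by rewrite in_itv/= lexx ltW.
Qed.

End WeakComplex.

Section Impedance.
Context {R : realType}.
Local Notation mu := (@lebesgue_measure R).
Local Notation L1 f := (mu.-integrable setT (EFin \o f)).
Implicit Types (l r C : R) (a b f g : R -> R).

Lemma primD f g x : L1 f -> L1 g -> prim (fun t => f t + g t) x = prim f x + prim g x.
Proof.
move=> lf lg; rewrite /prim RintegralD//; exact: integrableS (measurableT) _ _ _.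
Qed.

Lemma primZ r f x : L1 f -> prim (fun t => r * f t) x = r * prim f x.
Proof. by move=> lf; rewrite /prim RintegralZl//; exact: integrableS lf. Qed.

Lemma ae_le_prim f g x : L1 f -> L1 g -> {ae mu, forall t, f t <= g t} ->
  prim f x <= prim g x.
Proof.
move=> lf lg fg; rewrite /prim Rintegral_mkcond [leRHS]Rintegral_mkcond.
apply: ae_le_Rintegral; try exact: integrable_patch.
by apply: aeS fg => t ft; rewrite !patchE; case: ifP.
Qed.

Lemma norm_prim_le f x : L1 f -> `|prim f x| <= prim (fun t => `|f t|) x.
Proof.
by move=> lf; apply: le_normr_Rintegral => //; exact: integrableS lf.
Qed.

Lemma norm4_le0 (s t u v : R) : `|s| + `|t| + `|u| + `|v| <= 0 ->
  [/\ s = 0, t = 0, u = 0 & v = 0].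
Proof.
move: (normr_ge0 s) (normr_ge0 t) (normr_ge0 u) (normr_ge0 v) => s0 t0 u0 v0 h.
by split; apply/eqP; rewrite -normr_le0; lra.
Qed.

(* Uniqueness for the first order system y' = p z, z' = q y with y(0) = z(0) =
   0, where y = y1 + i y2 and so on have been split into real components. *)
Lemma system_unique l C p q y1 y2 z1 z2 : 0 < l -> 0 <= C ->
  {ae mu, forall x, x \in `]0, l[ -> `|p x| <= C} ->
  {ae mu, forall x, x \in `]0, l[ -> `|q x| <= C} ->
  let J (f : R -> R) := (f \_ `]0, l[) in
  L1 (J (fun x => p x * z2 x)) -> L1 (J (fun x => p x * z1 x)) ->
  L1 (J (fun x => q x * y2 x)) -> L1 (J (fun x => q x * y1 x)) ->
  (forall x, x \in `[0, l] -> [/\ y1 x = prim (J (fun x => p x * z2 x)) x,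
    y2 x = - prim (J (fun x => p x * z1 x)) x,
    z1 x = prim (J (fun x => q x * y2 x)) x &
    z2 x = - prim (J (fun x => q x * y1 x)) x]) ->
  forall x, x \in `[0, l] -> [/\ y1 x = 0, y2 x = 0, z1 x = 0 & z2 x = 0].
Proof.
move=> l0 C0 pC qC J; set h1 := J _; set h2 := J _; set h3 := J _; set h4 := J _.
move=> l1 l2 l3 l4 E.
(* The primitives are measured instead of the unknowns: the two agree up to sign on [[0, l]], but
   the primitives are continuous on the whole line, as [gronwall] expects. *)
pose N x := `|prim h1 x| + `|prim h2 x| + `|prim h3 x| + `|prim h4 x|.
have cN : continuous N.
  have cp h : L1 h -> continuous (fun x => `|prim h x|).
    by move=> lh x; apply: cvg_norm; exact: prim_continuous.
  by move=> x; do 3 (apply: cvgD; last exact: cp); exact: cp.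
have lN : L1 (J N).
  have h : mu.-integrable `[0, l] (EFin \o N).
    apply: continuous_compact_integrable; [exact: segment_compact|].
    exact: continuous_subspaceT.
  by apply/integrable_patchP; apply: integrableS h => //; exact: subset_itv_oo_cc.
pose S x := `|h1 x| + `|h2 x| + `|h3 x| + `|h4 x|.
have lS : L1 S by do 3 (apply: integrableD_fin; last exact: integrable_norm_fin);
  exact: integrable_norm_fin.
have SN : {ae mu, forall x, S x <= C * J N x}.
  apply: aeS2 pC qC => x hp hq; rewrite /S /h1 /h2 /h3 /h4 /J !patchE mem_setE.
  case: ifPn => xJ; last by rewrite !normr0 !addr0 mulr0.
  have [e1 e2 e3 e4] : [/\ y1 x = prim h1 x, y2 x = - prim h2 x,
      z1 x = prim h3 x & z2 x = - prim h4 x].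
    by apply: E; move: xJ; rewrite !in_itv/= => /andP[/ltW-> /ltW->].
  rewrite !normrM e1 e2 e3 e4 !normrN /N.
  have := hp xJ; have := hq xJ.
  move: (normr_ge0 (prim h1 x)) (normr_ge0 (prim h2 x)) (normr_ge0 (prim h3 x))
    (normr_ge0 (prim h4 x)).
  move=> n1 n2 n3 n4 hq' hp'.
  have := ler_wpM2r n1 hq'; have := ler_wpM2r n2 hq'.
  have := ler_wpM2r n3 hp'; have := ler_wpM2r n4 hp'.
  lra.
have NS x : N x <= C * prim (J N) x.
  apply: (@le_trans _ _ (prim S x)).
    rewrite /S !primD ?/N; try by repeat apply: integrableD_fin;
      exact: integrable_norm_fin.
    by rewrite !lerD// norm_prim_le.
  rewrite -primZ//; apply: ae_le_prim => //; exact: integrableZ_fin.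
move=> x xl; have := gronwall l0 cN lN (fun x _ => NS x) xl C0.
have [-> -> -> ->] := E x xl; move=> /norm4_le0[-> -> -> ->].
by rewrite oppr0.
Qed.

(** The second order equation becomes a first order system for [u] and its quasi-derivative [v]. For
    real [r] the coefficients are real, so real and imaginary parts solve it separately; the data 1
    and [i r] at 0 are split accordingly. *)
Lemma impedance_real l a r (u : R -> R[i]) : 0 < l ->
  (forall x, x \in `]0, l[ -> 0 < a x) -> measurable_fun `]0, l[ a ->
  measurable_fun `]0, l[ (fun x => (a x)^-1) ->
  impedance_solution l a r%:C u ->
  let u1 x := complex.Re (u x) in let u2 x := complex.Im (u x) in
  exists v1 v2 : R -> R,
  [/\ {within `[0, l], continuous u1} /\ {within `[0, l], continuous u2},
      {within `[0, l], continuous v1} /\ {within `[0, l], continuous v2},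
      [/\ rweak 0 l u1 (fun x => a x ^- 2 * v1 x),
          rweak 0 l u2 (fun x => a x ^- 2 * v2 x),
          rweak 0 l v1 (fun x => - (r ^+ 2 * (a x ^+ 2 * u1 x))) &
          rweak 0 l v2 (fun x => - (r ^+ 2 * (a x ^+ 2 * u2 x)))] &
      [/\ u1 0 = 1, u2 0 = 0, v1 0 = 0 & v2 0 = r]].
Proof.
move=> l0 apos ma mb [[[cu1 cu2] wu] wD eqn u0 [v [[cv1 cv2] vD v0]]] u1 u2.
exists (fun x => complex.Re (v x)), (fun x => complex.Im (v x)).
have mc f : {within `[0, l], continuous f} -> measurable_fun `]0, l[ f.
  move=> cf; apply: (@measurable_funS _ _ _ _ `[0, l]%classic) => //.
    exact: subset_itv_oo_cc.
  exact: subspace_continuous_measurable_fun.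
have a20 x : x \in `]0, l[ -> a x ^+ 2 != 0.
  by move=> /apos a0; rewrite expf_neq0// gt_eqF.
have mia : measurable_fun `]0, l[ (fun x => a x ^- 2).
  rewrite (_ : (fun x => _) = (fun x => (a x)^-1 ^+ 2)); first exact: measurable_funX.
  by apply/funext => x; rewrite exprVn.
have ma2 : measurable_fun `]0, l[ (fun x => a x ^+ 2) by exact: measurable_funX.
have /weak_derivativeP[[[mf1 _ _] [mf2 _ _]] [[mg1 _ _] [mg2 _ _]] W1 W2] := wderivP wu.
have /weak_derivativeP[[[mf3 _ _] [mf4 _ _]] [[mg3 _ _] [mg4 _ _]] W3 W4] := wderivP wD.
have Eu : {ae mu, forall x, x \in `]0, l[ ->
  complex.Re (wderiv 0 l u x) = a x ^- 2 * complex.Re (v x) /\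
    complex.Im (wderiv 0 l u x) = a x ^- 2 * complex.Im (v x)}.
  apply: aeS vD => x h xJ; rewrite h// /Da Re_mulCr Im_mulCr.
  have K z : a x ^- 2 * (a x ^+ 2 * z) = z by rewrite mulrA mulVf ?a20// mul1r.
  by rewrite !K.
have Ev : {ae mu, forall x, x \in `]0, l[ ->
    complex.Re (wderiv 0 l (Da l a u) x) = - (r ^+ 2 * (a x ^+ 2 * u1 x)) /\
    complex.Im (wderiv 0 l (Da l a u) x) = - (r ^+ 2 * (a x ^+ 2 * u2 x))}.
  apply: aeS eqn => x h xJ.
  have := h xJ; rewrite /La -rmorphXn /= => h'.
  have -> : wderiv 0 l (Da l a u) x =
    - ((a x ^+ 2)%:C * (- ((a x ^- 2)%:C * wderiv 0 l (Da l a u) x))).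
    rewrite mulrN opprK mulrA -rmorphM /= mulfV ?a20// rmorph1 mul1r//.
  rewrite h' /u1 /u2.
  case: (u x) => x1 x2 /=; split; ring.
split=> //; last first.
  by rewrite /u1 /u2 u0 v0 /=; split=> //;
    rewrite ?mul0r ?mul1r ?mulr0 ?subrr ?addr0 ?add0r.
split.
- apply: (rweak_ae mf1 _ mg1 _ _ _ W1) => //.
  + by apply: measurable_funM => //; exact: mc.
  + exact: aeW.
  + by apply: aeS Eu => x h /h[].
- apply: (rweak_ae mf2 _ mg2 _ _ _ W2) => //.
  + by apply: measurable_funM => //; exact: mc.
  + exact: aeW.
  + by apply: aeS Eu => x h /h[].
- apply: (rweak_ae mf3 _ mg3 _ _ _ W3) => //.
  + exact: mc.
  + apply: measurable_funN; apply: measurable_funM => //; apply: measurable_funM => //.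
  + by apply: aeS vD => x h /h ->.
  + by apply: aeS Ev => x h /h[].
- apply: (rweak_ae mf4 _ mg4 _ _ _ W4) => //.
  + exact: mc.
  + apply: measurable_funN; apply: measurable_funM => //; apply: measurable_funM => //.
  + by apply: aeS vD => x h /h ->.
  + by apply: aeS Ev => x h /h[].
Qed.

End Impedance.

(** * The relation between the solutions for [a] and [1/a] *)

Section ImpedancePair.
Context {R : realType}.
Local Notation mu := (@lebesgue_measure R).
Local Notation L1 f := (mu.-integrable setT (EFin \o f)).
Implicit Types (l r C : R) (a b f g p w : R -> R).

(** Clipping [f] at [- |M|] and [|M|] gives an everywhere bounded function that agrees with it
    almost everywhere. *)
Lemma integrable_ae_bounded (c d : R) f (M : R) : measurable_fun `]c, d[ f ->
  {ae mu, forall x, x \in `]c, d[ -> `|f x| <= M} -> L1 (f \_ `]c, d[).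
Proof.
move=> mf fM; apply/integrable_patchP.
have M0 : 0 <= `|M| by [].
pose h x := Num.max (- `|M|) (Num.min (f x) `|M|).
have mh : measurable_fun `]c, d[ h.
  by apply: measurable_maxr => //; apply: measurable_minr.
have hM x : `|h x| <= `|M|.
  rewrite ler_norml /h le_max lexx/= ge_max ge_min lexx orbT andbT.
  by apply: le_trans M0; rewrite oppr_le0.
have lh : L1 (h \_ `]c, d[).
  apply/integrable_patchP; apply: measurable_bounded_integrable => //.
  - apply: le_lt_trans (lebesgue_measure_itv_lty c d).
    by apply: le_measure; rewrite ?inE//; exact: subset_itv_oo_cc.
  - exists `|M|; split; first exact: num_real.
    by move=> z /ltW Mz x _; exact: le_trans (hM x) _.
apply/integrable_patchP; apply: ae_eq_integrable lh.
  exact/(measurable_restrictT _ _).1.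
apply: aeS fM => x h1; rewrite !patchE mem_setE; case: ifPn => // xJ.
have := le_trans (h1 xJ) (ler_norm M); rewrite ler_norml => /andP[h2 h3].
by rewrite /h (min_l h3) (max_r h2).
Qed.

Lemma within_continuous_bounded l f : 0 < l -> {within `[0, l], continuous f} ->
  exists M, forall x, x \in `[0, l] -> `|f x| <= M.
Proof.
move=> l0 cf.
have cn : {within `[0, l], continuous (fun x => `|f x|)}.
  by move=> x; apply: cvg_norm; exact: cf.
by have [e _ he] := EVT_max (ltW l0) cn; exists `|f e|.
Qed.

Lemma within_continuous_measurable l f : {within `[0, l], continuous f} ->
  measurable_fun `]0, l[ f.
Proof.
move=> cf; apply: (@measurable_funS _ _ _ _ `[0, l]%classic) => //.
  exact: subset_itv_oo_cc.
exact: subspace_continuous_measurable_fun.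
Qed.

Section Coefficient.
Variables (l P : R) (p : R -> R).
Hypothesis l0 : 0 < l.
Hypothesis mp : measurable_fun `]0, l[ p.
Hypothesis pP : {ae mu, forall x, x \in `]0, l[ -> `|p x| <= P}.

Lemma integrable_coef w : {within `[0, l], continuous w} ->
  L1 ((fun x => p x * w x) \_ `]0, l[).
Proof.
move=> cw; have [M hM] := within_continuous_bounded l0 cw.
apply: (@integrable_ae_bounded _ _ _ (P * M)).
  by apply: measurable_funM => //; exact: within_continuous_measurable.
apply: aeS pP => x h xJ; rewrite normrM ler_pM ?h// hM//.
by move: xJ; rewrite !in_itv/= => /andP[/ltW-> /ltW->].
Qed.

Lemma prim_coef_lin (al be : R) w w' x : {within `[0, l], continuous w} ->
  {within `[0, l], continuous w'} ->
  L1 ((fun x => p x * (al * w x + be * w' x)) \_ `]0, l[) /\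
  prim ((fun x => p x * (al * w x + be * w' x)) \_ `]0, l[) x =
  al * prim ((fun x => p x * w x) \_ `]0, l[) x +
  be * prim ((fun x => p x * w' x) \_ `]0, l[) x.
Proof.
move=> cw cw'; have l1 := integrable_coef cw; have l2 := integrable_coef cw'.
rewrite (_ : _ \_ _ = (fun x => al * ((fun x => p x * w x) \_ `]0, l[) x +
    be * ((fun x => p x * w' x) \_ `]0, l[) x)).
  split; first by apply: integrableD_fin; exact: integrableZ_fin.
  by rewrite primD ?primZ//; exact: integrableZ_fin.
apply/funext => t; rewrite !patchE; case: ifP => _; first by ring.
by rewrite !mulr0 addr0.
Qed.

Lemma rweak_coef_prim (be : R) f w : {within `[0, l], continuous f} ->
  {within `[0, l], continuous w} -> rweak 0 l f (fun x => be * (p x * w x)) ->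
  forall x, x \in `[0, l] ->
  f x = f 0 + be * prim ((fun x => p x * w x) \_ `]0, l[) x.
Proof.
move=> cf cw W x xl.
have lw := integrable_coef cw.
have E : (fun x => be * (p x * w x)) \_ `]0, l[ =
    (fun x => be * ((fun x => p x * w x) \_ `]0, l[) x).
  by apply/funext => t; rewrite !patchE; case: ifP => _; rewrite ?mulr0.
by rewrite (rweak_continuous l0 cf _ W xl) E ?primZ//; exact: integrableZ_fin.
Qed.

End Coefficient.

Lemma rweak_eq c d f g g' : (forall x, x \in `]c, d[ -> g x = g' x) ->
  rweak c d f g -> rweak c d f g'.
Proof.
move=> gg W phi tphi; rewrite W//; congr (- _); apply: eq_Rintegral => x.
by rewrite mem_setE => xJ; rewrite gg.
Qed.

(** Primes mark the objects of [1/a], and [D] is derivation. With quasi-derivatives [v] and [v'],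
    the functions [y = v - i r e'] and [z = v' - i r e] vanish at 0 and satisfy [D y = - i r a^2 z],
    [D z = - i r a^-2 y]. Uniqueness gives [v = i r e']. *)
Lemma impedance_pair l a r c C (e e' : R -> R[i]) : 0 < l ->
  (forall x, x \in `]0, l[ -> 0 < a x) -> measurable_fun `]0, l[ a ->
  measurable_fun `]0, l[ (fun x => (a x)^-1) ->
  0 < c -> {ae mu, forall x, x \in `]0, l[ -> c <= a x <= C} ->
  impedance_solution l a r%:C e ->
  impedance_solution l (fun x => (a x)^-1) r%:C e' ->
  rweak 0 l (fun x => complex.Re (e x))
    (fun x => a x ^- 2 * - (r * complex.Im (e' x))) /\
  rweak 0 l (fun x => complex.Im (e x))
    (fun x => a x ^- 2 * (r * complex.Re (e' x))).
Proof.
move=> l0 apos ma mb c0 cC se se'.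
have [v1 [v2 [[cu1 cu2] [cv1 cv2] [W1 W2 W3 W4] [u10 u20 v10 v20]]]] :=
  impedance_real l0 apos ma mb se.
have apos' x : x \in `]0, l[ -> 0 < (a x)^-1 by move=> /apos; rewrite invr_gt0.
have mb' : measurable_fun `]0, l[ (fun x => ((a x)^-1)^-1).
  by rewrite (_ : (fun x => _) = a)//; apply/funext => x; rewrite invrK.
have [v1' [v2' [[cu1' cu2'] [cv1' cv2'] [W1' W2' W3' W4'] [u10' u20' v10' v20']]]] :=
  impedance_real l0 apos' mb mb' se'.
set u1 := fun x => complex.Re (e x) in cu1 W1 W3 u10 *.
set u2 := fun x => complex.Im (e x) in cu2 W2 W4 u20 *.
set u1' := fun x => complex.Re (e' x) in cu1' W1' W3' u10' *.
set u2' := fun x => complex.Im (e' x) in cu2' W2' W4' u20' *.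
have {}u10 : u1 0 = 1 := u10; have {}u20 : u2 0 = 0 := u20.
have {}u10' : u1' 0 = 1 := u10'; have {}u20' : u2' 0 = 0 := u20'.
pose p x := a x ^+ 2; pose q x := a x ^- 2.
have mp : measurable_fun `]0, l[ p by exact: measurable_funX.
have mq : measurable_fun `]0, l[ q.
  rewrite (_ : q = (fun x => (a x)^-1 ^+ 2)); first exact: measurable_funX.
  by apply/funext => x; rewrite exprVn.
(* One constant for both [a^2] and [a^-2], since [system_unique] takes a single bound. *)
pose D := C ^+ 2 + c ^- 2.
have pD : {ae mu, forall x, x \in `]0, l[ -> `|p x| <= D}.
  apply: aeS cC => x h xJ; have /andP[h1 h2] := h xJ; have a0 := apos _ xJ.
  rewrite ger0_norm ?sqr_ge0// (@le_trans _ _ (C ^+ 2))//.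
    by rewrite /p lerXn2r ?nnegrE ?(ltW a0)// (le_trans (ltW a0)).
  by rewrite lerDl invr_ge0 exprn_ge0// ltW.
have qD : {ae mu, forall x, x \in `]0, l[ -> `|q x| <= D}.
  apply: aeS cC => x h xJ; have /andP[h1 h2] := h xJ; have a0 := apos _ xJ.
  rewrite ger0_norm ?invr_ge0 ?sqr_ge0// (@le_trans _ _ (c ^- 2))//.
    by rewrite /q lef_pV2 ?posrE ?exprn_gt0// lerXn2r ?nnegrE ?(ltW a0)// ltW.
  by rewrite lerDr sqr_ge0.
have V1 x : x \in `[0, l] ->
    v1 x = - r ^+ 2 * prim ((fun x => p x * u1 x) \_ `]0, l[) x.
  move=> xl; rewrite (rweak_coef_prim (be := - r ^+ 2) l0 mp pD cv1 cu1 _ xl)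
    ?v10 ?add0r//.
  by apply: rweak_eq W3 => t _; rewrite mulNr.
have V2 x : x \in `[0, l] ->
    v2 x = r + - r ^+ 2 * prim ((fun x => p x * u2 x) \_ `]0, l[) x.
  move=> xl; rewrite (rweak_coef_prim (be := - r ^+ 2) l0 mp pD cv2 cu2 _ xl)
    ?v20//.
  by apply: rweak_eq W4 => t _; rewrite mulNr.
have U1' x : x \in `[0, l] -> u1' x = 1 + prim ((fun x => p x * v1' x) \_ `]0, l[) x.
  move=> xl; rewrite (rweak_coef_prim (be := 1) l0 mp pD cu1' cv1' _ xl)
    ?u10' ?mul1r//.
  by apply: rweak_eq W1' => t _; rewrite exprVn invrK mul1r.
have U2' x : x \in `[0, l] -> u2' x = prim ((fun x => p x * v2' x) \_ `]0, l[) x.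
  move=> xl; rewrite (rweak_coef_prim (be := 1) l0 mp pD cu2' cv2' _ xl)
    ?u20' ?add0r ?mul1r//.
  by apply: rweak_eq W2' => t _; rewrite exprVn invrK mul1r.
have V1' x : x \in `[0, l] ->
    v1' x = - r ^+ 2 * prim ((fun x => q x * u1' x) \_ `]0, l[) x.
  move=> xl; rewrite (rweak_coef_prim (be := - r ^+ 2) l0 mq qD cv1' cu1' _ xl)
    ?v10' ?add0r//.
  by apply: rweak_eq W3' => t _; rewrite exprVn mulNr.
have V2' x : x \in `[0, l] ->
    v2' x = r + - r ^+ 2 * prim ((fun x => q x * u2' x) \_ `]0, l[) x.
  move=> xl; rewrite (rweak_coef_prim (be := - r ^+ 2) l0 mq qD cv2' cu2' _ xl)
    ?v20'//.
  by apply: rweak_eq W4' => t _; rewrite exprVn mulNr.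
have U1 x : x \in `[0, l] -> u1 x = 1 + prim ((fun x => q x * v1 x) \_ `]0, l[) x.
  move=> xl; rewrite (rweak_coef_prim (be := 1) l0 mq qD cu1 cv1 _ xl)
    ?u10 ?mul1r//.
  by apply: rweak_eq W1 => t _; rewrite mul1r.
have U2 x : x \in `[0, l] -> u2 x = prim ((fun x => q x * v2 x) \_ `]0, l[) x.
  move=> xl; rewrite (rweak_coef_prim (be := 1) l0 mq qD cu2 cv2 _ xl)
    ?u20 ?add0r ?mul1r//.
  by apply: rweak_eq W2 => t _; rewrite mul1r.
(* Real and imaginary parts of [v - i r e'] and [v' - i r e]; the explicit factors 1 match the shape
   of [prim_coef_lin]. *)
pose y1 x := 1 * v1 x + r * u2' x; pose y2 x := 1 * v2 x + - r * u1' x.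
pose z1 x := 1 * v1' x + r * u2 x; pose z2 x := 1 * v2' x + - r * u1 x.
have Z : forall x, x \in `[0, l] -> [/\ y1 x = 0, y2 x = 0, z1 x = 0 & z2 x = 0].
  have Ly1 := prim_coef_lin l0 mq qD 1 r _ cv1 cu2'.
  have Ly2 := prim_coef_lin l0 mq qD 1 (- r) _ cv2 cu1'.
  have Lz1 := prim_coef_lin l0 mp pD 1 r _ cv1' cu2.
  have Lz2 := prim_coef_lin l0 mp pD 1 (- r) _ cv2' cu1.
  have Er (k : R -> R) w : (fun x => (r * k x) * w x) \_ `]0, l[ =
      (fun x => r * ((fun x => k x * w x) \_ `]0, l[) x).
    by apply/funext => x; rewrite !patchE; case: ifP; rewrite ?mulr0 ?mulrA.
  have rD (k : R -> R) : {ae mu, forall x, x \in `]0, l[ -> `|k x| <= D} ->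
      {ae mu, forall x, x \in `]0, l[ -> `|r * k x| <= `|r| * D}.
    by apply: aeS => x h /h; rewrite normrM; exact: ler_wpM2l.
  have D0 : 0 <= `|r| * D.
    by rewrite mulr_ge0// addr_ge0 ?sqr_ge0// invr_ge0 exprn_ge0// ltW.
  apply: (system_unique l0 D0 (rD _ pD) (rD _ qD)); rewrite ?Er.
  - by apply: integrableZ_fin; exact: (Lz2 0).1.
  - by apply: integrableZ_fin; exact: (Lz1 0).1.
  - by apply: integrableZ_fin; exact: (Ly2 0).1.
  - by apply: integrableZ_fin; exact: (Ly1 0).1.
  move=> x xl; rewrite !primZ; [|exact: (Ly1 0).1|exact: (Ly2 0).1|
    exact: (Lz1 0).1|exact: (Lz2 0).1].
  rewrite (Ly1 x).2 (Ly2 x).2 (Lz1 x).2 (Lz2 x).2.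
  rewrite /y1 /y2 /z1 /z2 V1// V2// V1'// V2'// U1// U2// U1'// U2'//.
  by split; ring.
split.
- apply: rweak_eq W1 => x xJ; congr (_ * _).
  have [] := Z x; first by move: xJ; rewrite !in_itv/= => /andP[/ltW-> /ltW->].
  by rewrite /y1 mul1r => /eqP; rewrite addr_eq0 => /eqP.
- apply: rweak_eq W2 => x xJ; congr (_ * _).
  have [] := Z x; first by move: xJ; rewrite !in_itv/= => /andP[/ltW-> /ltW->].
  by rewrite /y2 mul1r mulNr => _ /eqP; rewrite subr_eq0 => /eqP.
Qed.

End ImpedancePair.

Lemma continuous_bounded_L2 {R : realType} (c d : R) (w : R -> R) :
  continuous w -> (forall x, `|w x| <= 1) ->
  measurable_fun setT (w \_ `]c, d[) /\
  (@lebesgue_measure R).-integrable setT (EFin \o (fun t => (w \_ `]c, d[) t ^+ 2)).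
Proof.
move=> cw w1; have mw : measurable_fun `]c, d[ w.
  by apply: measurable_funTS; exact: continuous_measurable_fun.
split; first exact/(measurable_restrictT _ _).1.
rewrite (_ : (fun t => _) = (fun t => w t ^+ 2) \_ `]c, d[).
  apply: (integrable_ae_bounded (M := 1)); first exact: measurable_funX.
  by apply: aeW => x _; rewrite normrX exprn_ile1.
by apply/funext => t; rewrite !patchE; case: ifP => //; rewrite expr0n.
Qed.

(** * Transmutation operators *)

Section Functional.
Context {R : realType}.
Local Notation mu := (@lebesgue_measure R).
Local Notation L1 f := (mu.-integrable setT (EFin \o f)).
Local Notation kernel_L2 l k :=
  (((fun p : R * R => k p.1 p.2) \_ (triangle l)) \in Lfun (mu \x mu)%E 2%:E).
Variables (l : R) (k1 k2 k1' k2' : R -> R -> R) (f1 f2 : R -> R) (M : R).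
Hypothesis l0 : 0 < l.
Hypothesis lk1 : kernel_L2 l k1.
Hypothesis lk2 : kernel_L2 l k2.
Hypothesis lk1' : kernel_L2 l k1'.
Hypothesis lk2' : kernel_L2 l k2'.
Hypothesis mf1 : measurable_fun setT f1.
Hypothesis mf2 : measurable_fun setT f2.
Hypothesis f1M : forall x, `|f1 x| <= M.
Hypothesis f2M : forall x, `|f2 x| <= M.
Hypothesis f1out : forall x, x \notin `]0, l[ -> f1 x = 0.
Hypothesis f2out : forall x, x \notin `]0, l[ -> f2 x = 0.
Local Notation "f ^J" := (f \_ `]- l, l[) (at level 2, format "f ^J").

Let C (f : R -> R) r := \int[mu]_t (f t * cos (r * t)).
Let S (f : R -> R) r := \int[mu]_t (f t * sin (r * t)).

(** [HX] and [HY] are the real and imaginary parts of [\int f1 T u + \int f2 T' u' = 0] at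
    [u(t) = e^(i r t)], for the kernels [k1 + i k2] and [k1' + i k2']. *)
Hypothesis HX : forall r,
  C f1 r + r * \int[mu]_x (f1 x * kint k1 (fun t => sin (r * t)) x)
         + r * \int[mu]_x (f1 x * kint k2 (fun t => cos (r * t)) x)
  - r * S f2 r
  + r ^+ 2 * \int[mu]_x (f2 x * kint k1' (fun t => cos (r * t)) x)
  - r ^+ 2 * \int[mu]_x (f2 x * kint k2' (fun t => sin (r * t)) x) = 0.
Hypothesis HY : forall r,
  S f1 r - r * \int[mu]_x (f1 x * kint k1 (fun t => cos (r * t)) x)
         + r * \int[mu]_x (f1 x * kint k2 (fun t => sin (r * t)) x)
  + r * C f2 r
  + r ^+ 2 * \int[mu]_x (f2 x * kint k1' (fun t => sin (r * t)) x)
  + r ^+ 2 * \int[mu]_x (f2 x * kint k2' (fun t => cos (r * t)) x) = 0.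

Let p1 := kadj l k1 f1.
Let p2 := kadj l k2 f1.
Let q1 := kadj l k1' f2.
Let q2 := kadj l k2' f2.

Let lp1 : L1 p1^J. Proof. exact: integrable_kadj f1M. Qed.
Let lp2 : L1 p2^J. Proof. exact: integrable_kadj f1M. Qed.
Let lq1 : L1 q1^J. Proof. exact: integrable_kadj f2M. Qed.
Let lq2 : L1 q2^J. Proof. exact: integrable_kadj f2M. Qed.

Let sub0J x : x \in `]0, l[ -> x \in `]- l, l[.
Proof. by rewrite !in_itv/= => /andP[x0 ->]; rewrite andbT; have := l0; lra. Qed.

Let fJ (f : R -> R) : (forall x, x \notin `]0, l[ -> f x = 0) -> f^J = f.
Proof.
move=> f0; apply: patch_id => x /= /negP xJ; apply: f0.
by apply: contra xJ; exact: sub0J.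
Qed.

Let lf (f : R -> R) : measurable_fun setT f -> (forall x, `|f x| <= M) ->
  (forall x, x \notin `]0, l[ -> f x = 0) -> L1 f.
Proof.
move=> mf fM /fJ <-; apply: (integrable_ae_bounded (M := M)).
  exact: measurable_funTS.
exact: aeW.
Qed.

Let lf1 : L1 f1. Proof. exact: lf. Qed.
Let lf2 : L1 f2. Proof. exact: lf. Qed.

Let trig_sq (w : R -> R) : continuous w -> (forall x, `|w x| <= 1) ->
  measurable_fun setT w^J /\ L1 (fun t => w^J t ^+ 2).
Proof. exact: continuous_bounded_L2. Qed.

Let swap_trig k (f w : R -> R) : kernel_L2 l k -> measurable_fun setT f ->
  (forall x, `|f x| <= M) -> (forall x, x \notin `]0, l[ -> f x = 0) ->
  continuous w -> (forall x, `|w x| <= 1) ->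
  \int[mu]_x (f x * kint k w x) = \int[mu]_t ((kadj l k f)^J t * w t).
Proof.
move=> lk mf fM f0 cw w1; have [mw lw] := trig_sq cw w1.
have [_ _ ->] := kint_swap lk mf fM f0 mw lw.
apply: eq_Rintegral => t _; rewrite !patchE; case: ifP => _; last by rewrite !mul0r.
by rewrite mulrC.
Qed.

Let swap_cos k (f : R -> R) r : kernel_L2 l k -> measurable_fun setT f ->
  (forall x, `|f x| <= M) -> (forall x, x \notin `]0, l[ -> f x = 0) ->
  \int[mu]_x (f x * kint k (fun t => cos (r * t)) x) = C (kadj l k f)^J r.
Proof.
move=> lk mf fM f0; apply: swap_trig => //; first exact: continuous_cosM.
by move=> x; exact: cos_max.
Qed.

Let swap_sin k (f : R -> R) r : kernel_L2 l k -> measurable_fun setT f ->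
  (forall x, `|f x| <= M) -> (forall x, x \notin `]0, l[ -> f x = 0) ->
  \int[mu]_x (f x * kint k (fun t => sin (r * t)) x) = S (kadj l k f)^J r.
Proof.
move=> lk mf fM f0; apply: swap_trig => //; first exact: continuous_sinM.
by move=> x; exact: sin_max.
Qed.

Let CN f r : C f (- r) = C f r.
Proof. by apply: eq_Rintegral => t _; rewrite mulNr cosN. Qed.

Let SN f r : L1 f -> S f (- r) = - S f r.
Proof.
move=> lf'; rewrite -RintegralN; last exact: integrable_sinM.
by apply: eq_Rintegral => t _; rewrite mulNr sinN mulrN.
Qed.

Let HX' r : C f1 r + r * S p1^J r + r * C p2^J r - r * S f2 r
  + r ^+ 2 * C q1^J r - r ^+ 2 * S q2^J r = 0.
Proof. by rewrite -(HX r) !swap_cos// !swap_sin. Qed.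

Let HY' r : S f1 r - r * C p1^J r + r * S p2^J r + r * C f2 r
  + r ^+ 2 * S q1^J r + r ^+ 2 * C q2^J r = 0.
Proof. by rewrite -(HY r) !swap_cos// !swap_sin. Qed.

(* Comparing the frequencies r and -r separates the two kernels. *)
Let parity r :
  [/\ C f1 r + r * S p1^J r - r * S f2 r + r ^+ 2 * C q1^J r = 0,
      r * C p2^J r - r ^+ 2 * S q2^J r = 0,
      S f1 r - r * C p1^J r + r * C f2 r + r ^+ 2 * S q1^J r = 0 &
      r * S p2^J r + r ^+ 2 * C q2^J r = 0].
Proof.
have := HX' r; have := HY' r; have := HX' (- r); have := HY' (- r).
rewrite (CN f1) (CN f2) (CN p1^J) (CN p2^J) (CN q1^J) (CN q2^J).
rewrite (SN r lf1) (SN r lf2) (SN r lp1) (SN r lp2) (SN r lq1) (SN r lq2) sqrrN.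
move: (C f1 r) (S f1 r) (C f2 r) (S f2 r) (C p1^J r) (S p1^J r) (C p2^J r)
  (S p2^J r) (C q1^J r) (S q1^J r) (C q2^J r) (S q2^J r).
by move=> a1 a2 a3 a4 a5 a6 a7 a8 a9 a10 a11 a12 e1 e2 e3 e4; split; lra.
Qed.

Let Cadd f g r (x : R) : L1 f -> L1 g ->
  C (fun t => f t + x * g t) r = C f r + x * C g r.
Proof.
move=> lf' lg; rewrite /C -RintegralZl//; last exact: integrable_cosM.
rewrite -RintegralD//; last 2 first.
- exact: integrable_cosM.
- by apply: integrableZ_fin; exact: integrable_cosM.
by apply: eq_Rintegral => t _; ring.
Qed.

Let Sadd f g r (x : R) : L1 f -> L1 g ->
  S (fun t => f t + x * g t) r = S f r + x * S g r.
Proof.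
move=> lf' lg; rewrite /S -RintegralZl//; last exact: integrable_sinM.
rewrite -RintegralD//; last 2 first.
- exact: integrable_sinM.
- by apply: integrableZ_fin; exact: integrable_sinM.
by apply: eq_Rintegral => t _; ring.
Qed.

Let Cscale f r x (w : R -> R) : L1 f -> (forall t, w t = x * cos (r * t)) ->
  \int[mu]_t (f t * w t) = x * C f r.
Proof.
move=> lf' wE; rewrite /C -RintegralZl//; last exact: integrable_cosM.
by apply: eq_Rintegral => t _; rewrite wE; ring.
Qed.

Let Sscale f r x (w : R -> R) : L1 f -> (forall t, w t = x * sin (r * t)) ->
  \int[mu]_t (f t * w t) = x * S f r.
Proof.
move=> lf' wE; rewrite /S -RintegralZl//; last exact: integrable_sinM.
by apply: eq_Rintegral => t _; rewrite wE; ring.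
Qed.

Variables (u g h : R -> R) (c1 c2 : R).
Hypothesis mu_ : measurable_fun `]- l, l[ u.
Hypothesis mg : measurable_fun `]- l, l[ g.
Hypothesis mh : measurable_fun `]- l, l[ h.
Hypothesis lg : L1 g^J.
Hypothesis lh : L1 h^J.
Hypothesis lg2 : L1 (fun t => g^J t ^+ 2).
Hypothesis lh2 : L1 (fun t => h^J t ^+ 2).
Hypothesis uE : {ae mu, forall t, t \in `]- l, l[ -> u t = c1 + prim g^J t}.
Hypothesis gE : {ae mu, forall t, t \in `]- l, l[ -> g t = c2 + prim h^J t}.

Let mg0 : measurable_fun setT g^J.
Proof. exact/(measurable_restrictT _ _).1. Qed.
Let mh0 : measurable_fun setT h^J.
Proof. exact/(measurable_restrictT _ _).1. Qed.

(** Besides the exchange of integrals, Fubini yields integrability of the adjoint weight times [w],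
    which is what [annihilator] asks of [ga h]. *)
Let swap_gen k (f w : R -> R) : kernel_L2 l k -> measurable_fun setT f ->
  (forall x, `|f x| <= M) -> (forall x, x \notin `]0, l[ -> f x = 0) ->
  measurable_fun setT w^J -> L1 (fun t => w^J t ^+ 2) ->
  L1 (fun t => (kadj l k f)^J t * w t) /\
  \int[mu]_x (f x * kint k w x) = \int[mu]_t ((kadj l k f)^J t * w t).
Proof.
move=> lk mf fM f0 mw lw.
have [_ h1 ->] := kint_swap lk mf fM f0 mw lw.
have E : (fun t => w^J t * kadj l k f t) = (fun t => (kadj l k f)^J t * w t).
  apply/funext => t; rewrite !patchE; case: ifP => _; last by rewrite !mul0r.
  by rewrite mulrC.
by rewrite -E.
Qed.

(** The identities carrying [k2] and [k2'] say that the weights 0, [p2], [q2] annihilate all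
    exponentials; so the contributions of the imaginary parts of the two kernels cancel. *)
Lemma functional2 : \int[mu]_x (f1 x * kint k2 g x) +
  \int[mu]_x (f2 x * kint k2' h x) = 0.
Proof.
have [lpg ->] := swap_gen lk2 mf1 f1M f1out mg0 lg2.
have [lqh ->] := swap_gen lk2' mf2 f2M f2out mh0 lh2.
have l00 : L1 ((fun=> 0 : R)^J).
  rewrite (_ : _ \_ _ = cst 0); first exact: integrable0.
  by apply/funext => t; rewrite patchE; case: ifP.
have z0 (w : R -> R) : \int[mu]_t ((fun=> 0 : R)^J t * w t) = 0.
  rewrite (_ : (fun t => _) = cst 0) ?Rintegral_cst ?mul0r//.
  by apply/funext => t; rewrite patchE; case: ifP; rewrite mul0r.
have := @annihilator R l (fun=> 0) p2 q2 l0 l00 lp2 lq2 _ _ u g h c1 c2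
  mu_ mg mh lg lh lqh uE gE.
rewrite z0 add0r; apply => r; rewrite z0 add0r.
- rewrite (Sscale (r := r) (x := - r) lp2); last by move=> t; rewrite mulNr.
  rewrite (Cscale (r := r) (x := - r ^+ 2) lq2); last by move=> t; ring.
  by have [_ _ _ h0] := parity r; rewrite !mulNr -opprD h0 oppr0.
- rewrite (Cscale (r := r) (x := r) lp2)//.
  rewrite (Sscale (r := r) (x := - r ^+ 2) lq2); last by move=> t; ring.
  by have [_ h0 _ _] := parity r; rewrite mulNr h0.
Qed.

(** [annihilator] with weights [f1], [f2 - p1] and [- q1], where Fubini has turned the kernel terms
    acting on the first and second derivatives into [p1] and [q1]. *)
Lemma functional1 : \int[mu]_x (f1 x * u x) + \int[mu]_x (f2 x * g x) -
  \int[mu]_x (f1 x * kint k1 g x) - \int[mu]_x (f2 x * kint k1' h x) = 0.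
Proof.
have [lpg ->] := swap_gen lk1 mf1 f1M f1out mg0 lg2.
have [lqh ->] := swap_gen lk1' mf2 f2M f2out mh0 lh2.
pose be t := f2 t - p1 t; pose ga t := - q1 t.
have beE t : be^J t = f2 t + -1 * p1^J t.
  by rewrite /be patchB (fJ f2out) mulN1r.
have gaE t : ga^J t = -1 * q1^J t.
  by rewrite /ga !patchE; case: ifP => _; rewrite ?mulr0// mulN1r.
have lbe : L1 be^J.
  rewrite (_ : be^J = (fun t => f2 t + -1 * p1^J t)); last exact/funext.
  by apply: integrableD_fin => //; exact: integrableZ_fin.
have lga : L1 ga^J.
  rewrite (_ : ga^J = (fun t => -1 * q1^J t)); last exact/funext.
  exact: integrableZ_fin.
have lf1J : L1 f1^J by rewrite (fJ f1out).
have Cbe r : C be^J r = C f2 r - C p1^J r.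
  rewrite (_ : _ - _ = C f2 r + -1 * C p1^J r); last by rewrite mulN1r.
  by rewrite -Cadd//; apply: eq_Rintegral => t _; rewrite beE.
have Sbe r : S be^J r = S f2 r - S p1^J r.
  rewrite (_ : _ - _ = S f2 r + -1 * S p1^J r); last by rewrite mulN1r.
  by rewrite -Sadd//; apply: eq_Rintegral => t _; rewrite beE.
have Cga r : C ga^J r = - C q1^J r.
  rewrite /C -RintegralN; last exact: integrable_cosM.
  by apply: eq_Rintegral => t _; rewrite gaE mulN1r mulNr.
have Sga r : S ga^J r = - S q1^J r.
  rewrite /S -RintegralN; last exact: integrable_sinM.
  by apply: eq_Rintegral => t _; rewrite gaE mulN1r mulNr.
have lgah : L1 (fun t => ga^J t * h t).
  rewrite (_ : (fun t => _) = (fun t => - (q1^J t * h t))).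
    exact: integrableN_fin.
  by apply/funext => t; rewrite gaE mulN1r mulNr.
have lf2g : L1 (fun t => f2 t * g t).
  rewrite (_ : (fun t => _) = (fun t => f2 t * g^J t)).
    by apply: (integrable_bounded_mul (M := M)).
  apply/funext => t; rewrite patchE mem_setE; case: ifPn => // tJ.
  rewrite f2out ?mul0r//; apply: contra tJ; exact: sub0J.
have := @annihilator R l f1 be ga l0 lf1J lbe lga _ _ u g h c1 c2
  mu_ mg mh lg lh lgah uE gE.
rewrite (fJ f1out) => H.
rewrite -[RHS]H.
- rewrite [X in _ = _ + X + _](_ : _ = \int[mu]_t (f2 t * g t) -
      \int[mu]_t (p1^J t * g t)); last first.
    rewrite -RintegralB//; apply: eq_Rintegral => t _.
    by rewrite beE mulN1r mulrDl mulNr.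
  rewrite [X in _ = _ + X](_ : _ = - \int[mu]_t (q1^J t * h t)); last first.
    rewrite -RintegralN//; apply: eq_Rintegral => t _.
    by rewrite gaE mulN1r mulNr.
  by rewrite addrA.
- move=> r; rewrite (Sscale (r := r) (x := - r) lbe); last by move=> t; rewrite mulNr.
  rewrite (Cscale (r := r) (x := - r ^+ 2) lga); last by move=> t; ring.
  have [h0 _ _ _] := parity r; rewrite -[RHS]h0 Sbe Cga -/(C f1 r); ring.
- move=> r; rewrite (Cscale (r := r) (x := r) lbe)//.
  rewrite (Sscale (r := r) (x := - r ^+ 2) lga); last by move=> t; ring.
  have [_ _ h0 _] := parity r; rewrite -[RHS]h0 Cbe Sga -/(S f1 r); ring.
Qed.

End Functional.

(** * Complex kernels split into real components *)

Section ComplexKernel.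
Context {R : realType}.
Local Notation mu := (@lebesgue_measure R).
Local Notation L1 f := (mu.-integrable setT (EFin \o f)).
Local Notation kernel_L2 l k :=
  (((fun p : R * R => k p.1 p.2) \_ (triangle l)) \in Lfun (mu \x mu)%E 2%:E).
Variables (l : R) (K : R -> R -> R[i]) (W : R -> R[i]).
Let k1 x t := complex.Re (K x t).
Let k2 x t := complex.Im (K x t).
Let w1 t := complex.Re (W t).
Let w2 t := complex.Im (W t).
Hypothesis lk1 : kernel_L2 l k1.
Hypothesis lk2 : kernel_L2 l k2.
Local Notation "f ^J" := (f \_ `]- l, l[) (at level 2, format "f ^J").
Hypothesis mw1 : measurable_fun setT w1^J.
Hypothesis mw2 : measurable_fun setT w2^J.
Hypothesis lw1 : L1 (fun t => w1^J t ^+ 2).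
Hypothesis lw2 : L1 (fun t => w2^J t ^+ 2).

Definition ckint (x : R) := cintegral mu `[- x, x] (fun t => K x t * W t).

Let ReE x t : complex.Re (K x t * W t) = k1 x t * w1 t - k2 x t * w2 t.
Proof. by rewrite /k1 /k2 /w1 /w2; case: (K x t) (W t) => a b []. Qed.

Let ImE x t : complex.Im (K x t * W t) = k1 x t * w2 t + k2 x t * w1 t.
Proof. by rewrite /k1 /k2 /w1 /w2; case: (K x t) (W t) => a b []. Qed.

(** The planar integrand is used before it is split into two terms, because at that stage the
    section identity holds at every [x] of []0, l[]. *)
Lemma integrable_ckint :
  L1 ((fun x => complex.Re (ckint x)) \_ `]0, l[) /\
  L1 ((fun x => complex.Im (ckint x)) \_ `]0, l[).
Proof.
split.
  have lF := integrableB_fin (integrable_kernel_mul lk1 mw1 lw1)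
    (integrable_kernel_mul lk2 mw2 lw2).
  have := integrable_patch (measurable_itv `]0, l[) (integrable_Rsection1 lF).
  congr (is_true (mu.-integrable _ (EFin \o _))).
  apply/funext => x; rewrite !patchE mem_setE; case: ifPn => // xl.
  rewrite /ckint [RHS]/= [RHS]Rintegral_mkcond; apply: eq_Rintegral => t _.
  have h1 := congr1 (fun f => f t) (kernel_section k1 w1 xl).
  have h2 := congr1 (fun f => f t) (kernel_section k2 w2 xl).
  rewrite /= in h1 h2; rewrite /= -h1 -h2 !patchE.
  by case: ifP => _; rewrite ?ReE// subr0.
have lF := integrableD_fin (integrable_kernel_mul lk1 mw2 lw2)
  (integrable_kernel_mul lk2 mw1 lw1).
have := integrable_patch (measurable_itv `]0, l[) (integrable_Rsection1 lF).
congr (is_true (mu.-integrable _ (EFin \o _))).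
apply/funext => x; rewrite !patchE mem_setE; case: ifPn => // xl.
rewrite /ckint [RHS]/= [RHS]Rintegral_mkcond; apply: eq_Rintegral => t _.
have h1 := congr1 (fun f => f t) (kernel_section k1 w2 xl).
have h2 := congr1 (fun f => f t) (kernel_section k2 w1 xl).
rewrite /= in h1 h2; rewrite /= -h1 -h2 !patchE.
by case: ifP => _; rewrite ?ImE// addr0.
Qed.

(** Splitting into four real integrals uses that each product is integrable on [[- x, x]], which is
    available for almost every [x]. *)
Let ckintE : {ae mu, forall x, x \in `]0, l[ ->
  complex.Re (ckint x) = kint k1 w1 x - kint k2 w2 x /\
  complex.Im (ckint x) = kint k1 w2 x + kint k2 w1 x}.
Proof.
have A11 := ae_integrable_kint lk1 mw1 lw1.
have A22 := ae_integrable_kint lk2 mw2 lw2.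
have A12 := ae_integrable_kint lk1 mw2 lw2.
have A21 := ae_integrable_kint lk2 mw1 lw1.
pose I k w x := x \in `]0, l[ ->
  mu.-integrable `[- x, x] (EFin \o (fun t : R => k x t * w t)).
have A1 : {ae mu, forall x, I k1 w1 x /\ I k2 w2 x}.
  by apply: aeS2 A11 A22 => x.
have A2 : {ae mu, forall x, I k1 w2 x /\ I k2 w1 x}.
  by apply: aeS2 A12 A21 => x.
apply: aeS2 A1 A2 => x [i11 i22] [i12 i21] xl.
have h1 := i11 xl; have h2 := i22 xl; have h3 := i12 xl; have h4 := i21 xl.
rewrite /kint -RintegralB// -RintegralD//; split; apply: eq_Rintegral => t _.
  exact: ReE.
exact: ImE.
Qed.

Lemma Rintegral_ckint (f : R -> R) (M : R) : measurable_fun setT f ->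
  (forall x, `|f x| <= M) -> (forall x, x \notin `]0, l[ -> f x = 0) ->
  [/\ L1 (fun x => f x * complex.Re (ckint x)),
      L1 (fun x => f x * complex.Im (ckint x)),
      \int[mu]_x (f x * complex.Re (ckint x)) =
        \int[mu]_x (f x * kint k1 w1 x) - \int[mu]_x (f x * kint k2 w2 x) &
      \int[mu]_x (f x * complex.Im (ckint x)) =
        \int[mu]_x (f x * kint k1 w2 x) + \int[mu]_x (f x * kint k2 w1 x)].
Proof.
move=> mf fM f0; have [l1 l2] := integrable_ckint.
have E (g : R -> R) : (fun x => f x * g x) = (fun x => f x * (g \_ `]0, l[) x).
  apply/funext => x; rewrite patchE mem_setE; case: ifPn => // xl.
  by rewrite f0// !mul0r.
have l1' : L1 (fun x => f x * complex.Re (ckint x)).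
  by rewrite E; apply: (integrable_bounded_mul (M := M)).
have l2' : L1 (fun x => f x * complex.Im (ckint x)).
  by rewrite E; apply: (integrable_bounded_mul (M := M)).
have [i11 _ _] := kint_swap lk1 mf fM f0 mw1 lw1.
have [i22 _ _] := kint_swap lk2 mf fM f0 mw2 lw2.
have [i12 _ _] := kint_swap lk1 mf fM f0 mw2 lw2.
have [i21 _ _] := kint_swap lk2 mf fM f0 mw1 lw1.
split => //.
- rewrite -RintegralB//; apply: ae_eq_Rintegral.
  + exact: integrable_measurable l1'.
  + exact: integrable_measurable (integrableB_fin i11 i22).
  + apply: aeS ckintE => x h; have [xl|xl] := boolP (x \in `]0, l[).
      by have [-> _] := h xl; rewrite mulrBr.
    by rewrite f0// !mul0r subr0.
- rewrite -RintegralD//; apply: ae_eq_Rintegral.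
  + exact: integrable_measurable l2'.
  + exact: integrable_measurable (integrableD_fin i12 i21).
  + apply: aeS ckintE => x h; have [xl|xl] := boolP (x \in `]0, l[).
      by have [_ ->] := h xl; rewrite mulrDr.
    by rewrite f0// !mul0r addr0.
Qed.

End ComplexKernel.

(** * The weak derivative of the transmuted function *)

Section Transmutation.
Context {R : realType}.
Local Notation mu := (@lebesgue_measure R).
Local Notation L1 f := (mu.-integrable setT (EFin \o f)).

(** On a bounded interval square integrability implies integrability through [|f| <= 1 + f^2]. *)
Lemma Lfun2_facts (c d : R) (f : R -> R) : (f \_ `]c, d[) \in Lfun mu 2%:E ->
  [/\ measurable_fun `]c, d[ f, measurable_fun setT (f \_ `]c, d[),
      L1 (f \_ `]c, d[) & L1 (fun t => (f \_ `]c, d[) t ^+ 2)].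
Proof.
move=> lf; have mf : measurable_fun setT (f \_ `]c, d[).
  by have /andP[] := lf; rewrite inE.
have l2 := Lfun2_integrable_sqr lf.
split => //; first exact/(measurable_restrictT _ _).2.
have lg : L1 (fun t : R => (\1_`]c, d[ t : R) + (f \_ `]c, d[) t ^+ 2).
  by apply: integrableD_fin => //; exact: integrable_indic_itv.
apply: integrable_le lg; first exact: mf.
move=> x; rewrite patchE indicE; case: ifPn => _; last first.
  by rewrite normr0 add0r sqr_ge0.
rewrite -(real_normK (num_real (f x))).
have := normr_ge0 (f x); have := sqr_ge0 (`|f x| - 1).
by move: `|f x| => y; rewrite /=; nra.
Qed.

Lemma Rintegral_supp (D : set R) (X f : R -> R) : (forall x, ~ D x -> f x = 0) ->
  \int[mu]_(x in D) (X x * f x) = \int[mu]_x (f x * X x).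
Proof.
move=> f0; rewrite Rintegral_mkcond; apply: eq_Rintegral => x _; rewrite patchE.
by case: ifPn => [_|/negP]; [exact: mulrC|rewrite in_setE => /f0 ->; rewrite mul0r].
Qed.

Lemma cexp_real (r t : R) :
  cexp ('i * r%:C * t%:C) = (cos (r * t)) +i* (sin (r * t)).
Proof.
rewrite /cexp /= !(mul0r, mulr0, mul1r, subr0, addr0, add0r, oppr0) expR0.
by rewrite mul1r.
Qed.

Lemma integrable_weight_continuous (l M : R) (f X : R -> R) :
  measurable_fun setT f -> (forall x, `|f x| <= M) ->
  (forall x, x \notin `]0, l[ -> f x = 0) ->
  {within `[0, l], continuous X} -> L1 (fun x => f x * X x).
Proof.
move=> mf fM f0 cX.
have h : mu.-integrable `[0, l] (EFin \o X).
  by apply: continuous_compact_integrable => //; exact: segment_compact.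
have h0 : L1 (X \_ `]0, l[).
  by apply/integrable_patchP; apply: integrableS h => //; exact: subset_itv_oo_cc.
rewrite (_ : (fun x => _) = (fun x => f x * (X \_ `]0, l[) x)).
  exact: (integrable_bounded_mul (M := M)).
apply/funext => x; rewrite patchE mem_setE; case: ifPn => // xl.
by rewrite f0// !mul0r.
Qed.

Lemma Rintegral_kernel_solution (l M : R) e K (r : R) (f : R -> R) :
  transmutation_kernel l e K -> measurable_fun setT f ->
  (forall x, `|f x| <= M) -> (forall x, x \notin `]0, l[ -> f x = 0) ->
  let k1 x t := complex.Re (K x t) in let k2 x t := complex.Im (K x t) in
  let co t := cos (r * t) in let si t := sin (r * t) in
  \int[mu]_x (f x * complex.Re (e r%:C x)) = \int[mu]_x (f x * co x) +
    r * (\int[mu]_x (f x * kint k1 si x) + \int[mu]_x (f x * kint k2 co x)) /\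
  \int[mu]_x (f x * complex.Im (e r%:C x)) = \int[mu]_x (f x * si x) -
    r * (\int[mu]_x (f x * kint k1 co x) - \int[mu]_x (f x * kint k2 si x)).
Proof.
move=> [[lk1 lk2] _ eE] mf fM f0 k1 k2 co si.
pose W (t : R) : R[i] := cos (r * t) +i* sin (r * t).
have [mco lco] := @continuous_bounded_L2 R (- l) l co (@continuous_cosM R r)
  (fun x => cos_max _).
have [msi lsi] := @continuous_bounded_L2 R (- l) l si (@continuous_sinM R r)
  (fun x => sin_max _).
have [i1 i2 <- <-] := @Rintegral_ckint R l K W lk1 lk2 mco msi lco lsi f M mf fM f0.
have EE x : x \in `]0, l[ -> e r%:C x = W x - 'i * r%:C * ckint K W x.
  move=> xl; rewrite eE; last first.
    by move: xl; rewrite !in_itv/= => /andP[-> /ltW].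
  rewrite cexp_real -/(W x); congr (_ - _ * _); congr cintegral.
  by apply/funext => t; rewrite cexp_real.
have lf (w : R -> R) : continuous w -> L1 (fun x => f x * w x).
  move=> cw; apply: integrable_weight_continuous mf fM f0 _.
  exact: continuous_subspaceT.
rewrite -!RintegralZl//; split.
- rewrite -RintegralD//; last 2 first.
  + by apply: lf; exact: continuous_cosM.
  + exact: integrableZ_fin.
  apply: eq_Rintegral => x _; have [xl|xl] := boolP (x \in `]0, l[); last first.
    by rewrite f0// !mul0r mulr0 addr0.
  rewrite EE//; case: (ckint K W x) => y z; rewrite /= /co; ring.
- rewrite -RintegralB//; last 2 first.
  + by apply: lf; exact: continuous_sinM.
  + exact: integrableZ_fin.
  apply: eq_Rintegral => x _; have [xl|xl] := boolP (x \in `]0, l[); last first.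
    by rewrite f0// !mul0r mulr0 subr0.
  rewrite EE//; case: (ckint K W x) => y z; rewrite /= /si; ring.
Qed.

Lemma frequency_eq_Re (A B D S P Q r : R) :
  A + r * B + r * D - r * S + r ^+ 2 * P - r ^+ 2 * Q =
  A + r * (B + D) - - (- r * (S - r * (P - Q))).
Proof. by ring. Qed.

Lemma frequency_eq_Im (A B D S P Q r : R) :
  A - r * B + r * D + r * S + r ^+ 2 * P + r ^+ 2 * Q =
  A - r * (B - D) - - (r * (S + r * (P + Q))).
Proof. by ring. Qed.

Variables (l : R) (a : R -> R) (c C : R).
Variables (e e' : R[i] -> R -> R[i]) (K K' : R -> R -> R[i]).
Hypothesis l0 : 0 < l.
Hypothesis apos : forall x, x \in `]0, l[ -> 0 < a x.
Hypothesis ma : measurable_fun `]0, l[ a.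
Hypothesis mb : measurable_fun `]0, l[ (fun x => (a x)^-1).
Hypothesis c0 : 0 < c.
Hypothesis cC : {ae mu, forall x, x \in `]0, l[ -> c <= a x <= C}.
Hypothesis se : forall r : R, impedance_solution l a r%:C (e r%:C).
Hypothesis se' : forall r : R,
  impedance_solution l (fun x => (a x)^-1) r%:C (e' r%:C).
Hypothesis tK : transmutation_kernel l e K.
Hypothesis tK' : transmutation_kernel l e' K'.

(* a^-2 truncated at its a.e. bound, so that it can be used as an everywhere
   bounded weight. *)
Let q x := ((fun x => Num.min (a x ^- 2) (c ^- 2)) \_ `]0, l[) x.

Let mia : measurable_fun `]0, l[ (fun x => a x ^- 2).
Proof.
rewrite (_ : (fun x => _) = (fun x => (a x)^-1 ^+ 2)); first exact: measurable_funX.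
by apply/funext => x; rewrite exprVn.
Qed.

Let mq : measurable_fun setT q.
Proof.
by apply/(measurable_restrictT _ _).1 => //; apply: measurable_minr.
Qed.

Let q_bound x : `|q x| <= c ^- 2.
Proof.
rewrite /q patchE mem_setE; case: ifPn => [xl|_]; last first.
  by rewrite normr0 invr_ge0 exprn_ge0// ltW.
rewrite ger0_norm; first by rewrite ge_min lexx orbT.
by rewrite le_min !invr_ge0 !exprn_ge0// ltW// apos.
Qed.

Let qE : {ae mu, forall x, x \in `]0, l[ -> q x = a x ^- 2}.
Proof.
apply: aeS cC => x h xl; have /andP[h1 _] := h xl.
rewrite /q patchE mem_setE xl min_l//.
have a0 := apos xl.
by rewrite lef_pV2 ?posrE ?exprn_gt0// lerXn2r ?nnegrE// ltW.
Qed.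

Section Test.
Variable phi : R -> R.
Hypothesis tphi : test_function 0 l phi.
(** The weights produced by the weak formulation: [phi'] goes with [T u] and [a^-2 phi] with
    [T' u'], the latter with [q] in place of [a^-2] so that it is bounded everywhere. *)
Let f1 := derive1 phi.
Let f2 x := q x * phi x.

Let ex_bound : exists M, (forall x, `|f1 x| <= M) /\ (forall x, `|f2 x| <= M).
Proof.
have [M1 h1] := test_bounded (test_function_derive1 tphi).
have [M2 h2] := test_bounded tphi.
exists (`|M1| + c ^- 2 * `|M2|); split => x.
  rewrite (le_trans (h1 x))// (le_trans (ler_norm _))// lerDl mulr_ge0//.
  by rewrite invr_ge0 exprn_ge0// ltW.
rewrite normrM (@le_trans _ _ (c ^- 2 * `|M2|)) ?lerDr// ler_pM//.
exact: le_trans (h2 x) (ler_norm _).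
Qed.

Let mf1 : measurable_fun setT f1.
Proof. exact: test_measurable (test_function_derive1 tphi). Qed.

Let mf2 : measurable_fun setT f2.
Proof. by apply: measurable_funM => //; exact: test_measurable tphi. Qed.

Let f1out x : x \notin `]0, l[ -> f1 x = 0.
Proof. exact: (test_function_out (test_function_derive1 tphi)). Qed.

Let f2out x : x \notin `]0, l[ -> f2 x = 0.
Proof. by move=> /(test_function_out tphi); rewrite /f2 => ->; rewrite mulr0. Qed.

Let f1out' x : ~ `]0, l[%classic x -> f1 x = 0.
Proof. by move=> /= /negP; exact: f1out. Qed.

Let f2out' x : ~ `]0, l[%classic x -> f2 x = 0.
Proof. by move=> /= /negP; exact: f2out. Qed.

Lemma Rintegral_inv_sqr_test (X : R -> R) : measurable_fun `]0, l[ X ->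
  \int[mu]_(x in `]0, l[) (a x ^- 2 * X x * phi x) = \int[mu]_x (f2 x * X x).
Proof.
move=> mX; rewrite -(Rintegral_supp X f2out'); congr fine.
have mphi : measurable_fun `]0, l[ phi.
  by apply: measurable_funTS; exact: test_measurable tphi.
apply: ae_eq_integral => //.
- by apply/measurable_EFinP; do 2 apply: measurable_funM => //.
- by apply/measurable_EFinP; apply: measurable_funM => //; exact: measurable_funTS.
- by apply: aeS qE => x h xl; rewrite /f2 h//; congr EFin; ring.
Qed.

Let k1 x t := complex.Re (K x t).
Let k2 x t := complex.Im (K x t).
Let k1' x t := complex.Re (K' x t).
Let k2' x t := complex.Im (K' x t).
Local Notation kernel_L2 k :=
  (((fun p : R * R => k p.1 p.2) \_ (triangle l)) \in Lfun (mu \x mu)%E 2%:E).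
Let lk1 : kernel_L2 k1. Proof. by have [[]] := tK. Qed.
Let lk2 : kernel_L2 k2. Proof. by have [[]] := tK. Qed.
Let lk1' : kernel_L2 k1'. Proof. by have [[]] := tK'. Qed.
Let lk2' : kernel_L2 k2'. Proof. by have [[]] := tK'. Qed.

(** The first order relation of [impedance_pair] is tested against [phi], and both solutions are
    replaced by their kernel representations. *)
Let HXY r : let Cf f := \int[mu]_t (f t * cos (r * t)) in
  let Sf f := \int[mu]_t (f t * sin (r * t)) in
  let co t := cos (r * t) in let si t := sin (r * t) in
  Cf f1 + r * \int[mu]_x (f1 x * kint k1 si x)
         + r * \int[mu]_x (f1 x * kint k2 co x)
  - r * Sf f2 + r ^+ 2 * \int[mu]_x (f2 x * kint k1' co x)
  - r ^+ 2 * \int[mu]_x (f2 x * kint k2' si x) = 0 /\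
  Sf f1 - r * \int[mu]_x (f1 x * kint k1 co x)
         + r * \int[mu]_x (f1 x * kint k2 si x)
  + r * Cf f2 + r ^+ 2 * \int[mu]_x (f2 x * kint k1' si x)
  + r ^+ 2 * \int[mu]_x (f2 x * kint k2' co x) = 0.
Proof.
move=> Cf Sf co si.
have [M [f1M f2M]] := ex_bound.
have [W1 W2] := impedance_pair l0 apos ma mb c0 cC (se r) (se' r).
have [E1 E2] := Rintegral_kernel_solution r tK mf1 f1M f1out.
have [E1' E2'] := Rintegral_kernel_solution r tK' mf2 f2M f2out.
have [[[ce1 ce2] _] _ _ _ _] := se' r.
have me1 := within_continuous_measurable ce1.
have me2 := within_continuous_measurable ce2.
have le1 : L1 (fun x => f2 x * complex.Re (e' r%:C x)).
  exact: integrable_weight_continuous mf2 f2M f2out ce1.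
have le2 : L1 (fun x => f2 x * complex.Im (e' r%:C x)).
  exact: integrable_weight_continuous mf2 f2M f2out ce2.
split.
- have := W1 _ tphi; rewrite (Rintegral_supp _ f1out') E1.
  rewrite Rintegral_inv_sqr_test; last by apply: measurable_funN; exact: measurable_funM.
  rewrite [X in _ = - X -> _](_ : _ =
      - r * \int[mu]_x (f2 x * complex.Im (e' r%:C x))); last first.
    by rewrite -RintegralZl//; apply: eq_Rintegral => x _; ring.
  rewrite E2' => /eqP; rewrite -subr_eq0 => /eqP h; rewrite -[RHS]h /Cf /Sf.
  exact: frequency_eq_Re.
- have := W2 _ tphi; rewrite (Rintegral_supp _ f1out') E2.
  rewrite Rintegral_inv_sqr_test; last exact: measurable_funM.
  rewrite [X in _ = - X -> _](_ : _ =
      r * \int[mu]_x (f2 x * complex.Re (e' r%:C x))); last first.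
    by rewrite -RintegralZl//; apply: eq_Rintegral => x _; ring.
  rewrite E1' => /eqP; rewrite -subr_eq0 => /eqP h; rewrite -[RHS]h /Cf /Sf.
  exact: frequency_eq_Im.
Qed.

Let integrable_weight M (f w : R -> R) : measurable_fun setT f ->
  (forall x, `|f x| <= M) -> (forall x, x \notin `]0, l[ -> f x = 0) ->
  L1 (w \_ `]- l, l[) -> L1 (fun x => f x * w x).
Proof.
move=> mf fM f0 lw.
rewrite (_ : (fun x => _) = (fun x => f x * (w \_ `]- l, l[) x)).
  exact: (integrable_bounded_mul (M := M)).
apply/funext => x; rewrite patchE mem_setE; case: ifPn => // xl.
rewrite f0 ?mul0r//; apply: contra xl; rewrite !in_itv/= => /andP[x0 ->].
by rewrite andbT (lt_trans _ x0)// oppr_lt0.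
Qed.

Let RintegralB_complex (f : R -> R) (z w : R -> R[i]) :
  L1 (fun x => f x * complex.Re (z x)) -> L1 (fun x => f x * complex.Im (z x)) ->
  L1 (fun x => f x * complex.Re (w x)) -> L1 (fun x => f x * complex.Im (w x)) ->
  \int[mu]_x (f x * complex.Re (z x - w x)) =
    \int[mu]_x (f x * complex.Re (z x)) - \int[mu]_x (f x * complex.Re (w x)) /\
  \int[mu]_x (f x * complex.Im (z x - w x)) =
    \int[mu]_x (f x * complex.Im (z x)) - \int[mu]_x (f x * complex.Im (w x)).
Proof.
move=> lz1 lz2 lw1 lw2; rewrite -!RintegralB//; split; apply: eq_Rintegral => x _;
by rewrite -mulrBr; congr (_ * _); case: (z x) (w x) => ? ? [].
Qed.

Lemma pairing_eq_Re (s t p q' fu fg A B A' B' : R) : s = fu - p -> p = A - B ->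
  t = fg - q' -> q' = A' - B' -> fu + fg - A - A' = 0 -> B + B' = 0 -> s = - t.
Proof. by move=> -> -> -> -> h1 h2; lra. Qed.

Lemma pairing_eq_Im (s t p q' fu fg A B A' B' : R) : s = fu - p -> p = A + B ->
  t = fg - q' -> q' = A' + B' -> fu + fg - A - A' = 0 -> B + B' = 0 -> s = - t.
Proof. by move=> -> -> -> -> h1 h2; lra. Qed.

Variable u : R -> R[i].
Hypothesis su : sobolev2 2 (- l) l u.
Let Du := wderiv (- l) l u.
Let DDu := wderiv (- l) l Du.

Let ll : - l < l. Proof. by have := l0; lra. Qed.

Lemma transmutation_pairing :
  \int[mu]_x (f1 x * complex.Re (transmutation l K u x)) =
        - (\int[mu]_x (f2 x * complex.Re (transmutation l K' Du x))) /\
  \int[mu]_x (f1 x * complex.Im (transmutation l K u x)) =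
        - (\int[mu]_x (f2 x * complex.Im (transmutation l K' Du x))).
Proof.
have [M [f1M f2M]] := ex_bound.
have [[/Lfun2_facts[mu1 mu1J lu1 lu1s] /Lfun2_facts[mu2 mu2J lu2 lu2s]] wu
  [[/Lfun2_facts[mg1 mg1J lg1 lg1s] /Lfun2_facts[mg2 mg2J lg2 lg2s]] wg
  [/Lfun2_facts[mh1 mh1J lh1 lh1s] /Lfun2_facts[mh2 mh2J lh2 lh2s]]]] := su.
have /weak_derivativeP[_ _ Wu1 Wu2] := wderivP wu.
have /weak_derivativeP[_ _ Wg1 Wg2] := wderivP wg.
have [c1 uE1] := rweak_prim ll ((integrable_patchP _ _ _).2 lu1)
  ((integrable_patchP _ _ _).2 lg1) Wu1.
have [c2 uE2] := rweak_prim ll ((integrable_patchP _ _ _).2 lu2)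
  ((integrable_patchP _ _ _).2 lg2) Wu2.
have [d1 gE1] := rweak_prim ll ((integrable_patchP _ _ _).2 lg1)
  ((integrable_patchP _ _ _).2 lh1) Wg1.
have [d2 gE2] := rweak_prim ll ((integrable_patchP _ _ _).2 lg2)
  ((integrable_patchP _ _ _).2 lh2) Wg2.
have HX r := (HXY r).1; have HY r := (HXY r).2.
have F11 := functional1 l0 lk1 lk2 lk1' lk2' mf1 mf2 f1M f2M f1out f2out HX HY
  mu1 mg1 mh1 lg1 lh1 lg1s lh1s uE1 gE1.
have F12 := functional1 l0 lk1 lk2 lk1' lk2' mf1 mf2 f1M f2M f1out f2out HX HY
  mu2 mg2 mh2 lg2 lh2 lg2s lh2s uE2 gE2.
have F21 := functional2 l0 lk1 lk2 lk1' lk2' mf1 mf2 f1M f2M f1out f2out HX HY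
  mu1 mg1 mh1 lg1 lh1 lg1s lh1s uE1 gE1.
have F22 := functional2 l0 lk1 lk2 lk1' lk2' mf1 mf2 f1M f2M f1out f2out HX HY
  mu2 mg2 mh2 lg2 lh2 lg2s lh2s uE2 gE2.
have [i1 i2 I1 I2] := @Rintegral_ckint R l K Du lk1 lk2 mg1J mg2J lg1s lg2s
  f1 M mf1 f1M f1out.
have [j1 j2 J1 J2] := @Rintegral_ckint R l K' DDu lk1' lk2' mh1J mh2J lh1s lh2s
  f2 M mf2 f2M f2out.
have lfu1 := integrable_weight mf1 f1M f1out lu1.
have lfu2 := integrable_weight mf1 f1M f1out lu2.
have lfg1 := integrable_weight mf2 f2M f2out lg1.
have lfg2 := integrable_weight mf2 f2M f2out lg2.
have [E1 E2] :
    \int[mu]_x (f1 x * complex.Re (transmutation l K u x)) =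
      \int[mu]_x (f1 x * complex.Re (u x)) -
      \int[mu]_x (f1 x * complex.Re (ckint K Du x)) /\
    \int[mu]_x (f1 x * complex.Im (transmutation l K u x)) =
      \int[mu]_x (f1 x * complex.Im (u x)) -
      \int[mu]_x (f1 x * complex.Im (ckint K Du x)).
  exact: RintegralB_complex lfu1 lfu2 i1 i2.
have [E3 E4] :
    \int[mu]_x (f2 x * complex.Re (transmutation l K' Du x)) =
      \int[mu]_x (f2 x * complex.Re (Du x)) -
      \int[mu]_x (f2 x * complex.Re (ckint K' DDu x)) /\
    \int[mu]_x (f2 x * complex.Im (transmutation l K' Du x)) =
      \int[mu]_x (f2 x * complex.Im (Du x)) -
      \int[mu]_x (f2 x * complex.Im (ckint K' DDu x)).
  exact: RintegralB_complex lfg1 lfg2 j1 j2.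
(* The real part of [K u'] pairs Re K with Re u' and Im K with Im u'. Hence the real component takes
   [functional1] at the real part of [u] and [functional2] at its imaginary part; the imaginary
   component takes them the other way round. *)
split.
- exact: (pairing_eq_Re E1 I1 E3 J1 F11 F22).
- exact: (pairing_eq_Im E2 I2 E4 J2 F12 F21).
Qed.

End Test.

Lemma integrable_transmutation_real (k : R -> R -> R[i]) (v : R -> R[i]) :
  cL2 (mu \x mu)%E (triangle l) (fun p : R * R => k p.1 p.2) ->
  cL2 mu `]- l, l[ v -> cL2 mu `]- l, l[ (wderiv (- l) l v) ->
  mu.-integrable `]0, l[ (EFin \o (fun x => complex.Re (transmutation l k v x))) /\
  mu.-integrable `]0, l[ (EFin \o (fun x => complex.Im (transmutation l k v x))).
Proof.
move=> [lk1 lk2] [/Lfun2_facts[_ _ lv1 _] /Lfun2_facts[_ _ lv2 _]].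
move=> [/Lfun2_facts[_ mw1 _ lw1] /Lfun2_facts[_ mw2 _ lw2]].
have [/integrable_patchP i1 /integrable_patchP i2] :=
  @integrable_ckint R l k (wderiv (- l) l v) lk1 lk2 mw1 mw2 lw1 lw2.
have sub (w : R -> R) : L1 (w \_ `]- l, l[) -> mu.-integrable `]0, l[ (EFin \o w).
  move=> /integrable_patchP h; apply: integrableS h => // x /=.
  rewrite !in_itv/= => /andP[x0 ->]; rewrite andbT (lt_trans _ x0)// oppr_lt0//.
have E (z w : R[i]) : complex.Re (z - w) = complex.Re z - complex.Re w /\
  complex.Im (z - w) = complex.Im z - complex.Im w by case: z w => ? ? [].
split.
- have h : mu.-integrable `]0, l[
      (EFin \o (fun x => complex.Re (v x) - complex.Re (ckint k (wderiv (- l) l v) x))).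
    by apply: (integrableB _ (sub _ lv1) i1).
  move: h; congr (is_true (mu.-integrable _ _)).
  by apply/funext => x; congr EFin; exact/esym/(E _ _).1.
- have h : mu.-integrable `]0, l[
      (EFin \o (fun x => complex.Im (v x) - complex.Im (ckint k (wderiv (- l) l v) x))).
    by apply: (integrableB _ (sub _ lv2) i2).
  move: h; congr (is_true (mu.-integrable _ _)).
  by apply/funext => x; congr EFin; exact/esym/(E _ _).2.
Qed.

Lemma integrable_inv_sqrM (X : R -> R) : mu.-integrable `]0, l[ (EFin \o X) ->
  mu.-integrable `]0, l[ (EFin \o (fun x => a x ^- 2 * X x)).
Proof.
move=> /integrable_patchP lX; have mX : measurable_fun `]0, l[ X.
  by apply/(measurable_restrictT _ _).2 => //; exact: integrable_measurable lX.
have lq : L1 (fun x => q x * (X \_ `]0, l[) x).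
  by apply: (integrable_bounded_mul (M := c ^- 2)).
apply/integrable_patchP; apply: ae_eq_integrable lq.
  by apply/(measurable_restrictT _ _).1 => //; exact: measurable_funM.
apply: aeS qE => x h; rewrite !patchE mem_setE.
by case: ifPn => [/h ->|_] //; rewrite mulr0.
Qed.

(** Once local integrability is known, which uses the bound on [a^-2], the pairing identity is the
    definition of the weak derivative. The coefficient, solutions and kernels are parameters here,
    so that [a] and [1/a] can be exchanged. *)
Lemma transmutation_weak (u : R -> R[i]) : sobolev2 2 (- l) l u ->
  weak_derivative 0 l (transmutation l K u)
    (fun x => (a x ^- 2)%:C * transmutation l K' (wderiv (- l) l u) x).
Proof.
move=> su; have [lu wu [lg wg lh]] := su.
have [kK _ _] := tK; have [kK' _ _] := tK'.
have [i1 i2] := integrable_transmutation_real kK lu lg.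
have [j1 j2] := integrable_transmutation_real kK' lg lh.
have loc (f : R -> R) : mu.-integrable `]0, l[ (EFin \o f) ->
    locally_integrable `]0, l[ f.
  by move=> lf; apply: open_integrable_locally; [exact: itv_open|exact: lf].
have mJ (f : R -> R) : mu.-integrable `]0, l[ (EFin \o f) -> measurable_fun `]0, l[ f.
  by move=> /integrable_patchP lf; apply/(measurable_restrictT _ _).2 => //;
    exact: integrable_measurable lf.
have ReE (z : R[i]) x : complex.Re ((a x ^- 2)%:C * z) = a x ^- 2 * complex.Re z.
  exact: Re_mulCr.
have ImE (z : R[i]) x : complex.Im ((a x ^- 2)%:C * z) = a x ^- 2 * complex.Im z.
  exact: Im_mulCr.
apply/weak_derivativeP; split.
- by split; exact: loc.
- split; apply: loc.
    have := integrable_inv_sqrM j1; congr (is_true (mu.-integrable _ _)).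
    by apply/funext => x; rewrite /= -ReE.
  have := integrable_inv_sqrM j2; congr (is_true (mu.-integrable _ _)).
  by apply/funext => x; rewrite /= -ImE.
- move=> phi tphi; have [P1 _] := transmutation_pairing tphi su.
  under [X in _ = - X]eq_Rintegral do rewrite ReE.
  rewrite (Rintegral_inv_sqr_test tphi (mJ _ j1)) -P1.
  apply: Rintegral_supp => x /= /negP.
  exact: (test_function_out (test_function_derive1 tphi)).
- move=> phi tphi; have [_ P1] := transmutation_pairing tphi su.
  under [X in _ = - X]eq_Rintegral do rewrite ImE.
  rewrite (Rintegral_inv_sqr_test tphi (mJ _ j2)) -P1.
  apply: Rintegral_supp => x /= /negP.
  exact: (test_function_out (test_function_derive1 tphi)).
Qed.

End Transmutation.

(** Local integrability passes along almost everywhere equality to a measurable function. This lets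
    the weak derivative of [T' (D u)] serve for [Da l a (T u)], which is identified with it only up
    to null sets. *)
Lemma weak_derivative_congr_ae (R : realType) (c d : R) (f f' g : R -> R[i]) :
  weak_derivative c d f g ->
  measurable_fun `]c, d[ (fun x => complex.Re (f' x)) ->
  measurable_fun `]c, d[ (fun x => complex.Im (f' x)) ->
  {ae @lebesgue_measure R, forall x, x \in `]c, d[ -> f x = f' x} ->
  weak_derivative c d f' g.
Proof.
move=> /weak_derivativeP[[lf1 lf2] [lg1 lg2] W1 W2] mf1 mf2 ff.
have loc (p p' : R -> R) : locally_integrable `]c, d[ p -> measurable_fun `]c, d[ p' ->
    {ae @lebesgue_measure R, forall x, x \in `]c, d[ -> p x = p' x} ->
    locally_integrable `]c, d[ p'.
  move=> [mp oJ lp] mp' pp; split => // K KJ cK.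
  have mK : measurable K by apply: closed_measurable; exact: compact_closed.
  rewrite [ltLHS](_ : _ = (\int[lebesgue_measure]_(x in K) `|p x|%:E)%E); first exact: lp.
  apply: ae_eq_integral => //.
  - apply/measurable_EFinP; apply: measurableT_comp => //.
    exact: measurable_funS mp'.
  - apply/measurable_EFinP; apply: measurableT_comp => //.
    exact: measurable_funS mp.
  - by apply: aeS pp => x h /KJ/h ->.
have ff1 : {ae @lebesgue_measure R, forall x, x \in `]c, d[ ->
    complex.Re (f x) = complex.Re (f' x)} by apply: aeS ff => x h /h ->.
have ff2 : {ae @lebesgue_measure R, forall x, x \in `]c, d[ ->
    complex.Im (f x) = complex.Im (f' x)} by apply: aeS ff => x h /h ->.
have [m1 _ _] := lf1; have [m2 _ _] := lf2; have [m3 _ _] := lg1; have [m4 _ _] := lg2.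
apply/weak_derivativeP; split.
- by split; [exact: loc lf1 mf1 ff1|exact: loc lf2 mf2 ff2].
- by split.
- by apply: (rweak_ae m1 mf1 m3 m3 ff1 _ W1); exact: aeW.
- by apply: (rweak_ae m2 mf2 m4 m4 ff2 _ W2); exact: aeW.
Qed.

(** [wderiv] picks some representative, so uniqueness of the weak derivative gives an identity
    almost everywhere; measurability comes from the chosen representative itself. *)
Lemma Da_weak (R : realType) (l : R) (a : R -> R) (f g : R -> R[i]) :
  (forall x, x \in `]0, l[ -> 0 < a x) -> measurable_fun `]0, l[ a ->
  weak_derivative 0 l f (fun x => (a x ^- 2)%:C * g x) ->
  [/\ {ae @lebesgue_measure R, forall x, x \in `]0, l[ -> Da l a f x = g x},
      measurable_fun `]0, l[ (fun x => complex.Re (Da l a f x)) &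
      measurable_fun `]0, l[ (fun x => complex.Im (Da l a f x))].
Proof.
move=> apos ma W; have W0 : weak_derivative 0 l f (wderiv 0 l f).
  by apply: wderivP; exists (fun x => (a x ^- 2)%:C * g x).
have [_ [[m1 _ _] [m2 _ _]] _] := W0.
split.
- have := weak_derivative_ae W0 W (aeW _ (fun=> fun=> erefl _)).
  apply: aeS => x h xl; rewrite /Da h// mulrA -rmorphM/= divff ?mul1r//.
  by rewrite expf_neq0// gt_eqF// apos.
- rewrite (_ : (fun x => _) =
    fun x => a x ^+ 2 * complex.Re (wderiv 0 l f x)); last first.
    by apply/funext => x; exact: Re_mulCr.
  by apply: measurable_funM => //; exact: measurable_funX.
- rewrite (_ : (fun x => _) =
    fun x => a x ^+ 2 * complex.Im (wderiv 0 l f x)); last first.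
    by apply/funext => x; exact: Im_mulCr.
  by apply: measurable_funM => //; exact: measurable_funX.
Qed.

Theorem theorem37 (R : realType) (l : R) (a : R -> R)
    (e e' : R[i] -> R -> R[i]) (K K' : R -> R -> R[i]) :
  let mu := @lebesgue_measure R in
  let b := fun x => (a x)^-1 in
  0 < l ->
  (forall x, x \in `]0, l[ -> 0 < a x) ->
  cL2 mu `]0, l[ (fun x => (a x)%:C) ->
  cL2 mu `]0, l[ (fun x => (b x)%:C) ->
  (forall rho, impedance_solution l a rho (e rho)) ->
  (forall rho, impedance_solution l b rho (e' rho)) ->
  transmutation_kernel l e K ->
  transmutation_kernel l e' K' ->
  sobolev2 1 0 l (fun x => (a x)%:C) ->
  let T := transmutation l K in
  let T' := transmutation l K' in
  let D := wderiv (- l) l in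
  (forall u, sobolev2 2 (- l) l u ->
     weakly_differentiable 0 l (T u) /\
     {ae mu, forall x, x \in `]0, l[ -> Da l a (T u) x = T' (D u) x}) /\
  (forall u, sobolev2 3 (- l) l u ->
     [/\ weakly_differentiable 0 l (T u),
         weakly_differentiable 0 l (Da l a (T u)) &
         {ae mu, forall x, x \in `]0, l[ -> La l a (T u) x = T (D (D u)) x}]).
Proof.
move=> mu b l0 apos La2 Lb2 se se' tK tK' [_ wa [La' _]] T T' D.
have [ma _ la _] := Lfun2_facts La2.1.
have [mb _ _ lbs] := Lfun2_facts Lb2.1.
have [_ _ lg lgs] := Lfun2_facts La'.
have /weak_derivativeP[_ _ Wa _] := wderivP wa.
have [c [C [c0 cC]]] := rweak_bounds l0 apos ((integrable_patchP _ _ _).2 la)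
  lbs lg lgs Wa.
have weak u : sobolev2 2 (- l) l u ->
    weak_derivative 0 l (T u) (fun x => (a x ^- 2)%:C * T' (D u) x).
  by apply: (transmutation_weak l0 apos ma mb c0 cC (fun r => se r%:C)
    (fun r => se' r%:C) tK tK').
(* The setting is symmetric: the inverse of [b] is [a], so the same lemma applies with solutions and
   kernels exchanged. *)
have weak' u : sobolev2 2 (- l) l u ->
    weak_derivative 0 l (T' u) (fun x => (b x ^- 2)%:C * T (D u) x).
  have bK : (fun x => (b x)^-1) = a by apply/funext => x; rewrite invrK.
  have bpos x : x \in `]0, l[ -> 0 < b x by move=> /apos; rewrite invr_gt0.
  have mbi : measurable_fun `]0, l[ (fun x => (b x)^-1) by rewrite bK.
  (* [C] comes without a sign; the maximum with 1 is a positive upper bound for [a], whose inverse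
     bounds [b] from below. *)
  have Ci0 : 0 < (Num.max C 1)^-1 by rewrite invr_gt0 lt_max ltr01 orbT.
  have bC : {ae mu, forall x, x \in `]0, l[ -> (Num.max C 1)^-1 <= b x <= c^-1}.
    apply: aeS cC => x h xl; have /andP[h1 h2] := h xl.
    by rewrite !lef_pV2 ?posrE ?apos ?lt_max ?ltr01 ?orbT// le_max h2 h1.
  by apply: (transmutation_weak l0 bpos mb mbi Ci0 bC (fun r => se' r%:C) _ tK' tK);
    move=> r; rewrite bK.
split=> [u su|u [lu wu [lDu wDu [lDDu wDDu lDDDu]]]].
  split; first by exists (fun x => (a x ^- 2)%:C * T' (D u) x); exact: weak.
  by have [] := Da_weak apos ma (weak u su).
have su : sobolev2 2 (- l) l u by exact: And3 lu wu (And3 lDu wDu lDDu).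
have sDu : sobolev2 2 (- l) l (D u)
  by exact: And3 lDu wDu (And3 lDDu wDDu lDDDu).
have W := weak u su; have W' := weak' (D u) sDu.
have [DaE m1 m2] := Da_weak apos ma W.
(* [Da l a (T u)] agrees almost everywhere with [T' (D u)], whose weak derivative is
   [b^-2 T (D (D u))]; since [b^-2 = a^2], this factor later cancels the [a^-2] of [La]. *)
have W2 : weak_derivative 0 l (Da l a (T u)) (fun x => (b x ^- 2)%:C * T (D (D u)) x).
  by apply: weak_derivative_congr_ae W' m1 m2 _; apply: aeS DaE => x h /h.
have w2 : weakly_differentiable 0 l (Da l a (T u)).
  by exists (fun x => (b x ^- 2)%:C * T (D (D u)) x).
split; [by exists (fun x => (a x ^- 2)%:C * T' (D u) x)|exact: w2|].
have := weak_derivative_ae (wderivP w2) W2 (aeW _ (fun=> fun=> erefl _)).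
apply: aeS => x h xl; rewrite /La h// mulrA -rmorphM/= /b exprVn invrK.
by rewrite mulVf ?mul1r// expf_neq0// gt_eqF// apos.
Qed.
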